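(* Let $B$ be a sieving set such that $\langle B\rangle$ has index $\alpha\in(0,1)$, and let $H=H(X)$ satisfy $H\to\infty$ and $\frac{\log H}{\log X}\to0$ as $X\to\infty$. Then for every $z\in\mathbb{R}$, \[ \lim_{X\to\infty}\frac1X\left|\left\{n\le X: \frac{N_{B\text{-free}}(n,H)-\mathcal{M}_BH}{\sqrt{C_{2,B}(H)}}\ge z\right\}\right| = \frac{1}{\sqrt{2\pi}}\int_z^\infty e^{-t^2/2}\,dt. \]
   Context: A sieving set is a non-empty set $B \subset \{2,3,\dots\}$ of pairwise coprime integers with $\sum_{b\in B}1/b<\infty$. A positive integer is $B$-free if divisible by no element of $B$. $\langle B\rangle$ is the multiplicative semigroup generated by $B$ (including $1$). For $J\subset\mathbb{N}$, $N_J(x)=|\{n\le x:n\in J\}|$, and $J$ has index $\alpha$ if $N_J(x)=x^{\alpha+o(1)}$. Let $\mathcal{M}_B=\prod_{b\in B}(1-1/b)$, $N_{B\text{-free}}(n,H)$ the number of $B$-free integers in $(n,n+H]$, and $C_{2,B}(H)=\lim_{X\to\infty}\frac1X\sum_{n\le X}(N_{B\text{-free}}(n,H)-\mathcal{M}_BH)^2$. *)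

(* Defs.v *)
From mathcomp Require Export all_boot all_order all_algebra.
From mathcomp Require Export all_classical all_reals all_analysis.

Set Implicit Arguments.
Unset Strict Implicit.
Unset Printing Implicit Defensive.

Export Order.TTheory GRing.Theory Num.Theory.
Export numFieldNormedType.Exports.

Local Open Scope classical_set_scope.
Local Open Scope ring_scope.

Definition sieving_set (R : realType) (B : set nat) : Prop :=
  [/\ B !=set0,
      forall b, B b -> (2 <= b)%N,
      forall b c, B b -> B c -> b <> c -> coprime b c
    & (\esum_(b in B) ((b%:R : R)^-1)%:E < +oo)%E].

Definition Bfree (B : set nat) : set nat :=
  [set n | (0 < n)%N /\ forall b, B b -> ~~ (b %| n)%N].

(* The empty product puts 1 in the semigroup. *)
Definition semigroup_gen (B : set nat) : set nat :=
  [set n | exists2 s : seq nat,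
     (forall b, b \in s -> B b) & n = (\prod_(b <- s) b)%N].

(* For x >= 0, Num.truncn x is the floor of x. *)
Definition count_upto (R : realType) (J : set nat) (x : R) : nat :=
  (\sum_(1 <= n < (Num.truncn x).+1 | n \in J) 1)%N.

(* N_J(x) = x^(alpha + o(1)); [e] is the o(1) term. *)
Definition has_index (R : realType) (J : set nat) (alpha : R) : Prop :=
  exists2 e : R -> R,
    e x @[x --> (+oo : set_system R)] --> (0 : R)
  & \forall x \near +oo, (count_upto J x)%:R = x `^ (alpha + e x).

(* The partial products are nonincreasing and nonnegative, so this limit exists
   for every sieving set. *)
Definition MB (R : realType) (B : set nat) : R :=
  limn (fun n => \prod_(0 <= b < n | b \in B) (1 - (b%:R : R)^-1)).

Definition NBfree (R : realType) (B : set nat) (n : nat) (H : R) : nat :=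
  (\sum_(n.+1 <= m < (Num.truncn (n%:R + H)).+1 | m \in Bfree B) 1)%N.

(* [lim] is total; for a sieving set the averages do converge, so it is the
   genuine limit here. *)
Definition C2B (R : realType) (B : set nat) (H : R) : R :=
  lim ((X^-1 * \sum_(1 <= n < (Num.truncn X).+1)
          ((NBfree B n H)%:R - MB R B * H) ^+ 2) @[X --> (+oo : set_system R)]).

(* Main.v *)
(* Expand [N_{B-free}(n, H) - M_B H] as the signed sum, over finite subsets [S] of [B]
   with product [d], of the sawtooth functions (number of multiples of [d] in
   [(n, n + h]]) - h / d. Truncating at [d <= y], with [y] a little larger than [h], costs
   a mean-square error of smaller order than the variance. The truncated sum is periodic;
   expanding the sawtooth functions in characters, its [k]-th moment over a period becomes
   a sum over [k]-tuples of fractions [a / d] with integral sum. The tuples in which the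
   first fraction cancels against exactly one other one contribute [(k - 1) m_2 m_{k-2}].
   In all other tuples the least common denominator is smaller than [y ^ (k / 2)] by a
   power of [y], so the index hypothesis makes them negligible against
   [m_2 ^ (k / 2)], where [m_2 >= h ^ (alpha - o(1))] by Bessel's inequality. Hence the
   normalized moments satisfy the recursion of the Gaussian moments up to [o(1)]. As
   [log H = o(log X)], averages over a period may be replaced by averages over [n <= X].
   By Taylor expansion, the averages of [cos (t x + p)], hence of trigonometric
   polynomials, converge to their Gaussian means; half-line indicators are squeezed
   between trigonometric polynomials up to a small multiple of [1 + x ^ 2]. *)

Require Import Defs.
From mathcomp Require Import complex measurable_realfun zify ring lra.
Set Implicit Arguments.
Unset Strict Implicit.
Unset Printing Implicit Defensive.

(** * Coprime families and resonant frequencies *)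

(** Two constraints pull on the truncation [y = h ^ (1 + eps)]. The discarded variance is about
    [h * y ^ (alpha - 1)], which drops below [h ^ alpha] because [eps > 0] and [alpha < 1]. On the
    other side, a [k]-th moment has about [y ^ (alpha * k / 2)] off-diagonal tuples before any
    saving, which exceeds [h ^ (alpha * k / 2)] by the factor [h ^ (alpha * k * eps / 2)]; the
    saving, about [h ^ (alpha / (2 * M))] with [M > k], has to pay for this excess. So [eps] must
    shrink as [k] grows, and no single truncation serves all moments. Each bound [K] on the order
    gets its own approximant [V], tied to the normalized count in mean square only. This gives no
    control of higher moments of the count itself, but it suffices for Lipschitz test functions,
    hence the passage through cosines.

    The upper bound in the index hypothesis is always used through the convergence of
    [sum d ^ (- s)] for [s > alpha] (Rankin's trick). *)

Section CoprimeFamily.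
Import mathcomp.boot.fintype mathcomp.boot.finset.
Variables (I : finType) (b : I -> nat).
Hypothesis b_gt1 : forall i, 1 < b i.
Hypothesis b_coprime : forall i j, i != j -> coprime (b i) (b j).

Implicit Types S T : {set I}.

Definition dd (S : {set I}) : nat := \prod_(i in S) b i.

Lemma b_gt0 i : 0 < b i. Proof. exact: ltnW. Qed.

Lemma dd_gt0 S : 0 < dd S.
Proof. by apply: prodn_gt0 => i; apply: b_gt0. Qed.

Lemma dd0 : dd set0 = 1. Proof. by rewrite /dd big_set0. Qed.

Lemma dd1 i : dd [set i] = b i. Proof. by rewrite /dd big_set1. Qed.

Lemma ddU S T : [disjoint S & T] -> dd (S :|: T) = dd S * dd T.
Proof. by move=> ST; rewrite /dd -bigU //; apply: eq_bigl => i; rewrite !inE. Qed.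

Lemma ddID S T : dd S = dd (S :&: T) * dd (S :\: T).
Proof.
rewrite -ddU ?setID // -setI_eq0 setIDA; apply/eqP/setP=> x.
by rewrite !inE; case: (x \in T); rewrite ?andbF ?andbT.
Qed.

Lemma dd_subset S T : S \subset T -> dd T = dd S * dd (T :\: S).
Proof. by move=> /setIidPr E; rewrite (ddID T S) E. Qed.

Lemma dvdn_dd S T : S \subset T -> dd S %| dd T.
Proof. by move=> /dd_subset ->; apply: dvdn_mulr. Qed.

Lemma leq_dd S T : S \subset T -> dd S <= dd T.
Proof. by move=> /dvdn_dd; apply: dvdn_leq; apply: dd_gt0. Qed.

Lemma dvdn_b_dd i S : i \in S -> b i %| dd S.
Proof. by rewrite -sub1set => /dvdn_dd; rewrite dd1. Qed.

Lemma coprime_b_dd i S : i \notin S -> coprime (b i) (dd S).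
Proof.
move=> iS; rewrite /dd; elim/big_rec: _ => [|j x jS IH]; first exact: coprimen1.
rewrite coprimeMr IH andbT; apply: b_coprime.
by apply: contraNneq iS => ->.
Qed.

Lemma coprime_dd S T : [disjoint S & T] -> coprime (dd S) (dd T).
Proof.
move=> ST; rewrite {1}/dd; elim/big_rec: _ => [|j x jS IH]; first exact: coprime1n.
by rewrite coprimeMl IH andbT coprime_b_dd // (disjointFr ST jS).
Qed.

Lemma dvdn_ddP S m : reflect (forall i, i \in S -> b i %| m) (dd S %| m).
Proof.
apply: (iffP idP) => [dS i iS|H]; first exact: dvdn_trans (dvdn_b_dd iS) dS.
have: (forall i, i \in enum S -> b i %| m) by move=> i; rewrite mem_enum; exact: H.
rewrite /dd -big_enum /=; have := enum_uniq S.
elim: (enum S) => [|i s IH] /=; first by rewrite big_nil dvd1n.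
move=> /andP[is_ us] Hs; rewrite big_cons Gauss_dvd.
  by rewrite Hs ?mem_head // IH // => j js; apply: Hs; rewrite inE js orbT.
elim: s is_ {IH us Hs} => [|j s IH]; rewrite ?big_nil ?coprimen1 //.
rewrite inE negb_or => /andP[ij js]; rewrite big_cons coprimeMr IH // andbT.
exact: b_coprime.
Qed.

Lemma dvdz_ddP S (m : int) :
  reflect (forall i, i \in S -> (b i %| m)%Z) (dd S %| m)%Z.
Proof. exact: dvdn_ddP. Qed.

Lemma dvd_ddE (i : I) S : (b i %| dd S) = (i \in S).
Proof.
apply/idP/idP => [|/dvdn_b_dd //]; apply: contraLR => iS.
have := coprime_b_dd iS; rewrite /coprime => /eqP G.
apply/negP => /gcdn_idPl; rewrite G => E; have := b_gt1 i; by rewrite -E.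
Qed.

Lemma b_inj : injective b.
Proof.
move=> i j E; apply/eqP; apply: contraT => /b_coprime.
by rewrite E /coprime gcdnn => /eqP E1; have := b_gt1 j; rewrite E1.
Qed.

Lemma dd_inj : injective dd.
Proof.
move=> S T E; apply/setP => i.
by rewrite -!dvd_ddE E.
Qed.

Lemma card_dd_le n : #|[set S | dd S <= n]| <= n.
Proof.
rewrite -[X in _ <= X](card_ord n).
pose F (S : {set I}) : 'I_n.+1 := inord (dd S).
rewrite -(card_in_imset (f := F)); last first.
  move=> S T; rewrite !inE => Sn Tn /(congr1 val) /=.
  by rewrite !inordK ?ltnS // => /dd_inj.
apply: leq_trans (_ : #|[set~ (ord0 : 'I_n.+1)]| <= _); last first.
  by rewrite cardsC1 !card_ord.
apply: subset_leq_card; apply/subsetP => x /imsetP[S]; rewrite !inE => Sn ->.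
by rewrite -val_eqE /= inordK ?ltnS // -lt0n dd_gt0.
Qed.

(** The divisor bound [2 ^ #|S| = O(dd S ^ (1 / q))], raised to the power [q] to stay in the
    integers. At most [2 ^ q] of the distinct [b i] lie below [2 ^ q], and each of them costs a
    factor [2 ^ q]; every other [b i] pays for its own factor. *)
Lemma exp2_card_le q S : 2 ^ (q * #|S|) <= (2 ^ q) ^ (2 ^ q) * dd S.
Proof.
pose T := [set i in S | b i < 2 ^ q].
have TS : T \subset S by apply/subsetP => i; rewrite inE => /andP[].
have cT : #|T| <= 2 ^ q.
  rewrite -[X in _ <= X]card_ord.
  pose F i : 'I_(2 ^ q).+1 := inord (b i).
  have Finj : {in T &, injective F}.
    move=> i j; rewrite !inE => /andP[_ bi] /andP[_ bj] /(congr1 val) /=.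
    by rewrite !inordK ?ltnS ?(ltnW bi) ?(ltnW bj) // => /b_inj.
  rewrite -(card_in_imset Finj).
  apply: leq_trans (_ : #|[set~ (ord0 : 'I_(2 ^ q).+1)]| <= _); last first.
    by rewrite cardsC1 !card_ord.
  apply: subset_leq_card; apply/subsetP => x /imsetP[j]; rewrite !inE => /andP[_ bi] ->.
  by rewrite -val_eqE /= inordK ?ltnS ?(ltnW bi) // -lt0n b_gt0.
rewrite expnM (dd_subset TS) mulnA.
have -> : #|S| = #|T| + #|S :\: T|.
  by rewrite -(cardsID T S) (setIidPr TS).
rewrite expnD; apply: leq_mul.
  apply: leq_trans (leq_pmulr _ (dd_gt0 _)).
  by rewrite leq_pexp2l // expn_gt0.
rewrite -prod_nat_const /dd; apply: leq_prod => i; rewrite !inE => /andP[+ iS].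
by rewrite iS /= -leqNgt.
Qed.

Lemma ddU_le S T : dd (S :|: T) <= dd S * dd T.
Proof.
have -> : S :|: T = S :|: (T :\: S).
  by apply/setP => i; rewrite !inE; case: (i \in S).
rewrite ddU; first by rewrite leq_mul2l leq_dd ?subsetDl ?orbT.
by rewrite disjoints_subset; apply/subsetP => i; rewrite !inE => ->.
Qed.

Lemma dd_bigcup_le (J : finType) (P : pred J) (F : J -> {set I}) :
  dd (\bigcup_(j | P j) F j) <= \prod_(j | P j) dd (F j).
Proof.
elim/big_rec2: _ => [|j x y _ IH]; first by rewrite dd0.
by apply: leq_trans (ddU_le _ _) _; rewrite leq_mul2l IH orbT.
Qed.

(* The frequency [a / dd S] modulo 1, written with the common denominator [dd setT]. *)
Definition freq (a : int) S : int := (a * (dd (~: S))%:Z)%R.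

Definition divset (a : int) : {set I} := [set i | (b i %| a)%Z].

(* The factors [b i] that do not cancel from the denominator of [a / dd S]. *)
Definition rsupp (a : int) S : {set I} := S :\: divset a.

(** Divisibility can be tested one [b i] at a time: outside [S] the cofactor [dd (~: S)] contains
    [b i], inside [S] it is coprime to [b i] and only [a] matters. As [b i] need not be prime, it
    cancels only when it divides [a] as a whole. *)
Lemma dvdz_freq i a S : (b i %| freq a S)%Z = (i \notin rsupp a S).
Proof.
rewrite /freq /rsupp !inE negb_and negbK.
have [iS|iS] := boolP (i \in S).
  rewrite orbF Gauss_dvdzl // coprimezE /= coprime_b_dd //.
  by rewrite !inE negbK.
by rewrite orbT dvdz_mull // dvdzE /= dvdn_b_dd // inE.
Qed.

Lemma dd_divset_le (a : int) : a <> 0%R -> dd (divset a) <= `|a|%N.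
Proof.
move=> a0; apply: dvdn_leq; first by rewrite absz_gt0; apply/eqP.
by apply/dvdn_ddP => i; rewrite inE dvdzE.
Qed.

(** * Tuples of fractions with integral sum in which the first fraction does not have exactly one
    partner *)

Section BadTuples.
Variables (n : nat) (a : 'I_n.+1 -> int) (t M : nat).
Local Notation y := (t ^ M).
Hypothesis t_gt0 : 0 < t.
Hypothesis M_ge : n.+2 <= M.
Local Notation tup := {ffun 'I_n.+1 -> {set I}}.
Implicit Types F : tup.

(** [V F l] is the reduced denominator of the [l]-th fraction, [Rset F] the least common
    denominator. [T F j] collects the factors that occur in the fractions [0] and [j] and nowhere
    else, [W F] the factors of the first fraction that occur at least three times. *)
Let V F l := rsupp (a l) (F l).
Let mult F i := #|[set l | i \in V F l]|.
Let Rset F := \bigcup_l V F l.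
Let T F j := [set i in V F ord0 :&: V F j | mult F i == 2].
Let W F := [set i in V F ord0 | 2 < mult F i].

Let inT F j i : (i \in T F j) = [&& i \in V F ord0, i \in V F j & mult F i == 2].
Proof. by rewrite in_set in_setI andbA. Qed.
Let inW F i : (i \in W F) = (i \in V F ord0) && (2 < mult F i).
Proof. by rewrite in_set. Qed.
Let multS F i (L : {set 'I_n.+1}) :
  (forall l, l \in L -> i \in V F l) -> #|L| <= mult F i.
Proof. by move=> H; apply/subset_leq_card/subsetP => l lL; rewrite in_set H. Qed.

Let mult3 F i j k : j != ord0 -> k != ord0 -> j != k ->
  i \in V F ord0 -> i \in V F j -> i \in V F k -> 2 < mult F i.
Proof.
move=> j0 k0 jk i0 ij ik; have <- : #|[set ord0; j; k]| = 3.
  by rewrite -setUA cardsU1 cards2 jk !inE !(eq_sym ord0) (negbTE j0) (negbTE k0).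
by apply: multS => l; rewrite -setUA in_setU in_set2 in_set1 => /or3P[] /eqP ->.
Qed.

Definition freq_sum F : int := (\sum_l freq (a l) (F l))%R.
Definition freq_pair F j : bool :=
  (dd setT %| (freq (a ord0) (F ord0) + freq (a j) (F j))%R)%Z.
Definition partners F : {set 'I_n.+1} := [set j | (j != ord0) && freq_pair F j].

(** The numerator of the sum of the fractions [0] and [j] over the denominator
    [dd (F ord0 :|: F j)], as [freq_addE] shows. If it is zero, the two fractions cancel. *)
Let N F j : int := (a ord0 * (dd (F j :\: F ord0))%:Z
                    + a j * (dd (F ord0 :\: F j))%:Z)%R.

Lemma dvdz_freq_ne F i l : i \notin V F l -> (b i %| freq (a l) (F l))%Z.
Proof. by rewrite dvdz_freq. Qed.

(** A factor present in a single reduced denominator could not disappear from the sum. *)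
Lemma mult_ge2 F i : (dd setT %| freq_sum F)%Z -> i \in Rset F -> 1 < mult F i.
Proof.
move=> /dvdz_ddP /(_ i (in_setT _)) dF /bigcupP[l _ il].
rewrite ltnNge; apply/negP => m1.
move: dF; rewrite /freq_sum (bigD1 l) //= rpredDr; last first.
  apply: rpred_sum => j jl.
  apply: dvdz_freq_ne; apply: contraL m1 => ij; rewrite -ltnNge.
  have <- : #|[set l; j]| = 2 by rewrite cards2 eq_sym jl.
  by apply: multS => k; rewrite in_set2 => /orP[] /eqP ->.
by rewrite dvdz_freq -/(V F l) il.
Qed.

Lemma prod_ddV F : \prod_l dd (V F l) = \prod_i b i ^ mult F i.
Proof.
transitivity (\prod_l \prod_i (if i \in V F l then b i else 1)).
  by apply: eq_bigr => l _; rewrite /dd big_mkcond.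
rewrite exchange_big /=; apply: eq_bigr => i _.
rewrite -big_mkcond /= -prod_nat_const; apply: eq_bigl => l.
by rewrite inE.
Qed.

Lemma dd_as_prod S : dd S = \prod_i b i ^ (i \in S).
Proof. by rewrite /dd big_mkcond; apply: eq_bigr => i _; case: (i \in S). Qed.

(** Compare exponents: in the product of all reduced denominators, [b i] occurs at least twice for
    [i] in [Rset F] and at least three times for [i] in [W F]. *)
Lemma ddR_sqr F : (dd setT %| freq_sum F)%Z ->
  dd (Rset F) ^ 2 * dd (W F) <= \prod_l dd (V F l).
Proof.
move=> dF; rewrite prod_ddV !dd_as_prod -mulnn -!big_split /=.
apply: leq_prod => i _; rewrite -!expnD leq_pexp2l ?b_gt0 //.
have [iR|iR] := boolP (i \in Rset F).
  have := mult_ge2 dF iR; rewrite inW; case: (i \in V F ord0) => //=.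
  by case: (ltnP 2 (mult F i)).
have -> : i \in W F = false; last by [].
by apply: contraNF iR; rewrite inW => /andP[iV _]; apply/bigcupP; exists ord0.
Qed.

(** A factor of the first fraction that occurs exactly twice determines the one other fraction [j]
    that contains it. *)
Lemma V0_cover F : (dd setT %| freq_sum F)%Z ->
  V F ord0 \subset W F :|: \bigcup_(j | j != ord0) T F j.
Proof.
move=> dF; apply/subsetP => i iV; rewrite inE.
have iR : i \in Rset F by apply/bigcupP; exists ord0.
have := mult_ge2 dF iR; rewrite leq_eqVlt => /orP[/eqP m2|m3]; last first.
  by rewrite inW iV m3.
apply/orP; right; apply/bigcupP.
have : 1 < #|[set l | i \in V F l]| by rewrite -/(mult F i) -m2.
rewrite (cardD1 ord0) in_set iV /= add1n ltnS => /card_gt0P[j].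
rewrite inE /= in_set => /andP[j0 jV]; exists j => //.
by rewrite inT iV jV -m2.
Qed.

(* [caseA]: the denominators save a factor [t] over the trivial bound. [caseB]: they
   do so once [T F j] is removed, and [dd (T F j)] divides the nonzero [N F j]. *)
Definition caseA F := dd (Rset F) ^ 2 * t <= y ^ n.+1.
Definition caseB F j := [&& dd (Rset F :\: T F j) ^ 2 * t <= y ^ n.+1, N F j != 0%R
   & dd (T F j) %| `|N F j|].

Lemma rsupp_sub a0 S : rsupp a0 S \subset S.
Proof. exact: subsetDl. Qed.

Lemma freq_pair_rsupp F j : freq_pair F j -> V F j = V F ord0.
Proof.
move=> /dvdz_ddP H; apply/setP => i; apply: negb_inj.
have := H i (in_setT _); rewrite -!dvdz_freq => Hi.
by apply/idP/idP => K; move: Hi; rewrite ?(rpredDr _ K) ?(rpredDl _ K).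
Qed.

Lemma freq_addE F j : (freq (a ord0) (F ord0) + freq (a j) (F j)
   = (dd (~: (F ord0 :|: F j)))%:Z * N F j)%R.
Proof.
rewrite /freq /N.
have E S T' : dd (~: S) = dd (~: (S :|: T')) * dd (T' :\: S).
  rewrite -ddU; last first.
    rewrite disjoints_subset; apply/subsetP => i; rewrite !inE negb_or negb_and.
    by move=> /andP[-> ->].
  by congr dd; apply/setP => i; rewrite !inE; case: (i \in S); case: (i \in T').
rewrite (E (F ord0) (F j)) (E (F j) (F ord0)) (setUC (F j)) !PoszM.
by rewrite mulrDr !(mulrCA (a _)).
Qed.

(** By [ddR_sqr], case A holds as soon as [dd (W F) >= t] or [dd (V F ord0) <= t ^ M.-1]. Two
    partners have the same reduced denominator as the first fraction, so every factor of it occurs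
    three times, [W F = V F ord0], and case A follows. Without partners, if case A is not already
    reached, [V0_cover] and [M >= n.+2] force some [dd (T F j) >= t]; deleting this [T F j] from the
    common denominator saves the factor. Modulo a factor in [T F j] only the fractions [0] and [j]
    contribute, so it divides [N F j], and [N F j] is nonzero because [j] is not a partner. *)
Lemma bad_cases F : (forall l, dd (F l) <= y) -> (dd setT %| freq_sum F)%Z ->
  #|partners F| != 1 -> caseA F \/ exists2 j, j != ord0 & caseB F j.
Proof.
move=> Fy dF np.
have Vy l : dd (V F l) <= y by apply: leq_trans (Fy l); apply/leq_dd/rsupp_sub.
have R2 := ddR_sqr dF.
have prodV : \prod_l dd (V F l) <= dd (V F ord0) * y ^ n.
  rewrite (bigD1 ord0) //= leq_mul2l; apply/orP; right.
  apply: leq_trans (_ : \prod_(l < n.+1 | l != ord0) y <= _).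
    by apply: leq_prod.
  by rewrite prod_nat_const cardC1 card_ord.
have prodV' : \prod_l dd (V F l) <= y ^ n.+1.
  by apply: leq_trans prodV _; rewrite expnS leq_mul2r Vy orbT.
have caseW : t <= dd (W F) -> caseA F.
  by move=> tW; apply: leq_trans prodV'; apply: leq_trans R2; rewrite leq_mul2l tW orbT.
have Mgt0 : 0 < M by apply: leq_trans M_ge.
have yt : y = t * t ^ M.-1 by rewrite -expnS prednK.
have caseV : dd (V F ord0) <= t ^ M.-1 -> caseA F.
  move=> tV; rewrite /caseA mulnC (expnS y n) {1}yt -mulnA leq_mul2l; apply/orP; right.
  apply: leq_trans (_ : dd (V F ord0) * y ^ n <= _); last by rewrite leq_mul2r tV orbT.
  apply: leq_trans prodV; apply: leq_trans R2.
  by rewrite leq_pmulr // dd_gt0.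
have [tW|tW] := leqP t (dd (W F)); first by left; apply: caseW.
have [tV|tV] := leqP (dd (V F ord0)) (t ^ M.-1); first by left; apply: caseV.
case: (posnP #|partners F|) => [p0|ppos]; last first.
  have p2 : 1 < #|partners F| by move: np ppos; case: #|partners F| => [|[]].
  have [j [k [jp kp jk]]] : exists j k, [/\ j \in partners F, k \in partners F & j != k].
    case/card_gt0P: ppos => j jp; move: p2; rewrite (cardD1 j) jp add1n ltnS.
    by case/card_gt0P => k; rewrite inE /= => /andP[kj kp]; exists j, k; split => //; rewrite eq_sym.
  move: jp kp; rewrite !in_set => /andP[j0 /freq_pair_rsupp jp] /andP[k0 /freq_pair_rsupp kp].
  have EW : W F = V F ord0.
    apply/setP => i; rewrite inW; case iV: (i \in V F ord0) => //=.
    by apply: (mult3 j0 k0 jk); rewrite ?jp ?kp.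
  left; apply: caseV; rewrite -EW; apply: leq_trans (ltnW tW) _.
  have := M_ge; case: (M) => [|[|m]] //= _; exact: leq_pexp2l (isT : 0 < m.+1).
right.
have [j j0 jt] : exists2 j, j != ord0 & t <= dd (T F j).
  apply/exists_inP; rewrite -[X in is_true X]negbK negb_exists_in; apply/negP => /forall_inP H.
  have : dd (V F ord0) <= t ^ n.+1.
    apply: leq_trans (leq_dd (V0_cover dF)) _; apply: leq_trans (ddU_le _ _) _.
    rewrite expnS; apply: leq_mul; first exact: ltnW.
    apply: leq_trans (dd_bigcup_le _ _) _.
    apply: leq_trans (_ : \prod_(l < n.+1 | l != ord0) t <= _).
      by apply: leq_prod => l l0; have := H l l0; rewrite -ltnNge => /ltnW.
    by rewrite prod_nat_const cardC1 card_ord.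
  rewrite leqNgt => /negP; apply; apply: leq_trans tV; rewrite ltnS.
  by rewrite leq_pexp2l // -ltnS prednK.
exists j => //; apply/and3P; split.
- apply: leq_trans prodV'; apply: leq_trans R2.
  apply: leq_trans (_ : dd (Rset F) ^ 2 <= _); last by rewrite leq_pmulr // dd_gt0.
  have TR : T F j \subset Rset F.
    by apply/subsetP => i; rewrite inT => /and3P[iV _ _]; apply/bigcupP; exists ord0.
  rewrite (dd_subset TR) expnMn mulnC leq_mul2r; apply/orP; right.
  by apply: leq_trans jt _; rewrite -{1}(expn1 (dd _)) leq_pexp2l // dd_gt0.
- apply/eqP => N0; have : j \in partners F; last by rewrite (cards0_eq p0) in_set0.
  by rewrite in_set j0 /freq_pair freq_addE N0 mulr0 dvdz0.
apply/dvdn_ddP => i; rewrite inT => /and3P[iV0 iVj /eqP m2].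
have iF0 := subsetP (rsupp_sub _ _) _ iV0; have iFj := subsetP (rsupp_sub _ _) _ iVj.
have : (b i %| (freq (a ord0) (F ord0) + freq (a j) (F j))%R)%Z.
  have := dvdz_ddP _ _ dF i (in_setT _); rewrite /freq_sum (bigD1 ord0) // (bigD1 j) //= addrA.
  rewrite rpredDr //; apply: rpred_sum => k /andP[k0 kj]; apply: dvdz_freq_ne; apply/negP => ik.
  have : 2 < mult F i; last by rewrite m2.
  by apply: (mult3 j0 k0 _ iV0 iVj ik); rewrite eq_sym.
rewrite freq_addE Gauss_dvdzr ?dvdzE // coprimezE /= coprime_b_dd //.
by rewrite !inE iF0.
Qed.

(** * Counting these tuples for fixed numerators *)

Section Count.
Variables (Y tau A : nat).
Hypothesis a_neq0 : forall l, a l <> 0%R.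
Hypothesis a_le : forall l, `|a l|%N <= y.
Hypothesis yY : y <= Y.
Hypothesis y2Y : 2 * y ^ 2 <= Y.
Hypothesis ynY : y ^ n.+1 <= Y.
Hypothesis tauP : forall S, dd S <= Y -> 2 ^ #|S| <= tau.
Hypothesis AP : #|[set S | dd S ^ 2 * t <= y ^ n.+1]| <= A.

Let Tset F (j : option 'I_n.+1) := if j is Some j then T F j else set0.
(** Recomputes [N F j] from the encoding with [T F j] left out: [T F j] lies in both [F ord0] and
    [F j], so the two set differences do not see it. Hence the range of [T F j] is known before
    [T F j] is. *)
Let Nf (U V' : tup) j : int :=
  (a ord0 * (dd ((U j :|: V' j) :\: (U ord0 :|: V' ord0)))%:Z
   + a j * (dd ((U ord0 :|: V' ord0) :\: (U j :|: V' j)))%:Z)%R.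
Let Tfam (U V' : tup) (j : option 'I_n.+1) : {set {set I}} :=
  if j is Some j then
    if (Nf U V' j != 0%R) && (`|Nf U V' j|%N <= Y) then powerset (divset (Nf U V' j)) else set0
  else [set set0].
Let cond F (j : option 'I_n.+1) :=
  [forall l, dd (F l) <= y] && (if j is Some j then (j != ord0) && caseB F j else caseA F).
Let target (j : option 'I_n.+1) : {set tup * {set I} * tup * {set I}} :=
  [set x : tup * {set I} * tup * {set I} |
     [&& [forall l, x.1.1.1 l \subset divset (a l)], dd x.1.1.2 ^ 2 * t <= y ^ n.+1,
         [forall l, x.1.2 l \subset x.1.1.2] & x.2 \in Tfam x.1.1.1 x.1.2 j]].
(** Splits a tuple into the cancelled parts of its denominators, the common denominator without
    [T F j], the reduced denominators without [T F j], and [T F j]. The cancelled parts divide the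
    numerators, the third component consists of subsets of the second, and [T F j] divides [N F j];
    each such choice costs only a divisor bound [tau]. The second component alone is expensive and
    is counted by [A]. *)
Let Phi (j : option 'I_n.+1) F : tup * {set I} * tup * {set I} :=
  ([ffun l => F l :&: divset (a l)], Rset F :\: Tset F j,
   [ffun l => V F l :\: Tset F j], Tset F j).

Let Tset_out F j l i : i \in Tset F (Some j) -> j != ord0 -> l != ord0 -> l != j ->
  i \notin V F l.
Proof.
rewrite /= inT => /and3P[i0 ij /eqP m2] j0 l0 lj; apply/negP => il.
have : 2 < mult F i; last by rewrite m2.
by apply: (mult3 j0 l0 _ i0 ij il); rewrite eq_sym.
Qed.

Let F_split F l : F l = (F l :&: divset (a l)) :|: V F l.
Proof. by rewrite /V /rsupp setID. Qed.

(** [T F j] is contained in the reduced denominators [0] and [j] and disjoint from all the others,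
    its factors having multiplicity two; so each reduced denominator can be restored. *)
Let Phi_inj j : {in [set F | cond F j] &, injective (Phi j)}.
Proof.
move=> F G; rewrite !in_set => cF cG [EU _ EV ET]; apply/ffunP => l.
rewrite (F_split F) (F_split G).
have -> : F l :&: divset (a l) = G l :&: divset (a l).
  by move/ffunP/(_ l): EU; rewrite !ffunE.
congr (_ :|: _); move/ffunP/(_ l): EV; rewrite !ffunE.
case: j ET cF cG => [j|] ET; last by rewrite /= !setD0.
move=> /andP[_ /andP[j0 _]] _ E.
have [l0|l0] := boolP ((l == ord0) || (l == j)).
  have sub H : Tset H (Some j) \subset V H l.
    apply/subsetP => i; rewrite /= inT => /and3P[i0 ij _].
    by case/orP: l0 => /eqP ->.
  rewrite -(setID (V F l) (Tset F (Some j))) -(setID (V G l) (Tset G (Some j))).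
  by rewrite E !(setIidPr (sub _)) ET.
move: l0; rewrite negb_or => /andP[l0 lj].
have dis H : V H l :\: Tset H (Some j) = V H l.
  apply/setDidPl; rewrite disjoints_subset; apply/subsetP => i iV; rewrite in_setC.
  by apply: contraL iV => iT; apply: Tset_out iT j0 l0 lj.
by rewrite !dis in E.
Qed.

Let Phi_target j : Phi j @: [set F | cond F j] \subset target j.
Proof.
apply/subsetP => x /imsetP[F]; rewrite in_set => /andP[/forallP Fy cF] ->.
rewrite in_set /Phi; apply/and4P; split.
- by apply/forallP => l; rewrite ffunE subsetIr.
- by case: j cF => [j|] /=; [case/andP => _ /and3P[] | rewrite setD0].
- by apply/forallP => l; rewrite ffunE; apply: setSD; apply: bigcup_sup.
case: j cF => [j|] /=; last by rewrite in_set1.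
move=> /andP[j0 /and3P[_ N0 dN]].
have EF l : (l == ord0) || (l == j) ->
  (F l :&: divset (a l)) :|: (V F l :\: T F j) = F l :\: T F j.
  move=> l0; rewrite [in RHS](F_split F l) setDUl; congr (_ :|: _).
  apply/esym/setDidPl; rewrite disjoints_subset; apply/subsetP => i.
  rewrite in_setI in_setC => /andP[_ id]; apply/negP; rewrite inT => /and3P[i0 ij _].
  have : i \in V F l by case/orP: l0 => /eqP ->.
  by rewrite in_setD id.
have TF l : (l == ord0) || (l == j) -> T F j \subset F l.
  move=> l0; apply/subsetP => i; rewrite inT => /and3P[i0 ij _].
  by apply: (subsetP (rsupp_sub (a l) _)); case/orP: l0 => /eqP ->.
have ED l k : (l == ord0) || (l == j) -> (k == ord0) || (k == j) ->
    (F l :\: T F j) :\: (F k :\: T F j) = F l :\: F k.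
  move=> l0 k0; apply/setP => i; rewrite !in_setD.
  case iT: (i \in T F j) => //=.
  by rewrite (subsetP (TF k k0) _ iT).
have EN : Nf [ffun l => F l :&: divset (a l)] [ffun l => V F l :\: T F j] j = N F j.
  rewrite /Nf !ffunE !EF ?eqxx ?orbT // !ED ?eqxx ?orbT //.
rewrite EN N0 /=.
have -> : `|N F j|%N <= Y.
  have absD (u v : int) : `|(u + v)%R|%N <= `|u| + `|v| by lia.
  apply: leq_trans y2Y; rewrite /N; apply: leq_trans (absD _ _) _.
  rewrite !abszM !absz_nat mul2n -addnn -mulnn.
  by apply: leq_add; apply: leq_mul => //; apply: leq_trans (Fy _); apply: leq_dd; apply: subsetDl.
rewrite in_set; apply/subsetP => i iT; rewrite in_set dvdzE /=.
exact: dvdn_trans (dvdn_b_dd iT) dN.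
Qed.

Let tau_gt0 : 0 < tau.
Proof.
have := @tauP set0; rewrite dd0 cards0; apply.
by apply: leq_trans yY; rewrite expn_gt0 t_gt0.
Qed.

Let card_pow_le S : dd S <= Y -> #|powerset S| <= tau.
Proof. by rewrite card_powerset; apply: tauP. Qed.

Let card_ffun_sub (G : 'I_n.+1 -> {set I}) : (forall l, dd (G l) <= Y) ->
  #|[set U : tup | [forall l, U l \subset G l]]| <= tau ^ n.+1.
Proof.
move=> GY.
have -> : #|[set U : tup | [forall l, U l \subset G l]]| = #|family (fun l => powerset (G l))|.
  apply: eq_card => U; rewrite in_set; apply/forallP/familyP => H l; have := H l; by rewrite ?in_set.
rewrite card_family -[X in tau ^ X](card_ord n.+1) foldrE big_map big_enum /= -prod_nat_const.
by apply: leq_prod => l _; apply: card_pow_le.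
Qed.

(** The components are summed out in turn, since the range of each depends on the earlier ones. *)
Let card_target j : #|target j| <= tau ^ n.+1 * (A * (tau ^ n.+1 * tau)).
Proof.
rewrite -sum1_card; pose p1 (x : tup * {set I} * tup * {set I}) := x.1.1.1.
rewrite (partition_big p1 (mem [set U : tup | [forall l, U l \subset divset (a l)]])) /=; last first.
  by move=> [[[U R'] V'] T']; rewrite !in_set => /and4P[].
apply: leq_trans (leq_sum (E2 := fun=> A * (tau ^ n.+1 * tau)) _ _) _; last first.
  rewrite sum_nat_const leq_mul2r; apply/orP; right; apply: card_ffun_sub => l.
  apply: leq_trans (dd_divset_le (@a_neq0 l)) _; exact: leq_trans (a_le l) yY.
move=> U _; pose p2 (x : tup * {set I} * tup * {set I}) := x.1.1.2.
rewrite (partition_big p2 (mem [set S | dd S ^ 2 * t <= y ^ n.+1])) /=; last first.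
  by move=> [[[U' R'] V'] T']; rewrite !in_set => /andP[/and4P[]].
apply: leq_trans (leq_sum (E2 := fun=> tau ^ n.+1 * tau) _ _) _; last first.
  by rewrite sum_nat_const leq_mul2r AP orbT.
move=> R'; rewrite in_set => R'y; pose p3 (x : tup * {set I} * tup * {set I}) := x.1.2.
rewrite (partition_big p3 (mem [set V' : tup | [forall l, V' l \subset R']])) /=; last first.
  by move=> [[[U' R0] V'] T']; rewrite !in_set /p1 /p2 /= => /andP[/andP[/and4P[_ _ H _] _] /eqP <-].
apply: leq_trans (leq_sum (E2 := fun=> tau) _ _) _; last first.
  rewrite sum_nat_const leq_mul2r; apply/orP; right; apply: (card_ffun_sub (G := fun=> R')) => _.
  apply: leq_trans ynY; apply: leq_trans R'y.
  by rewrite -mulnn -mulnA leq_pmulr // muln_gt0 t_gt0 dd_gt0.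
move=> V' _; rewrite sum1_card.
apply: leq_trans (_ : #|Tfam U V' j| <= _); last first.
  rewrite /Tfam; case: j => [j|]; last by rewrite cards1.
  case: ifP => [/andP[N0 NY]|_]; last by rewrite cards0.
  by apply: card_pow_le; apply: leq_trans NY; apply: dd_divset_le; apply/eqP.
pose p4 (x : tup * {set I} * tup * {set I}) := x.2.
rewrite -(card_in_image (f := p4)).
  apply: subset_leq_card; apply/subsetP => T' /imageP[[[[U0 R0] V0] T0]].
  rewrite unfold_in => /andP[/andP[/andP[]]]; rewrite in_set /p1 /p2 /p3 /p4 /=.
  by move=> /and4P[_ _ _ H] /eqP <- _ /eqP <- ->.
move=> [[[U0 R0] V0] T0] [[[U1 R1] V1] T1]; rewrite !unfold_in /p1 /p2 /p3 /p4 /=.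
by move=> /andP[/andP[/andP[_ /eqP ->] /eqP ->] /eqP ->] /andP[/andP[/andP[_ /eqP ->] /eqP ->] /eqP ->] ->.
Qed.

(** The factor [n.+2] counts case A ([None]) and the [n.+1] indices of case B. *)
Lemma card_bad_tuples :
  #|[set F : tup | [&& [forall l, dd (F l) <= y], (dd setT %| freq_sum F)%Z
       & #|partners F| != 1]]| <= n.+2 * (tau ^ n.+1 * (A * (tau ^ n.+1 * tau))).
Proof.
apply: leq_trans (_ : #|\bigcup_(j : option 'I_n.+1) [set F | cond F j]| <= _).
  apply/subset_leq_card/subsetP => F; rewrite in_set => /and3P[/forallP Fy dF np].
  apply/bigcupP; case: (bad_cases Fy dF np) => [cA|[j j0 cB]].
    by exists None => //; rewrite in_set /cond cA andbT; apply/forallP.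
  by exists (Some j) => //; rewrite in_set; apply/andP; split; [exact/forallP | rewrite j0].
apply: leq_trans (_ : \sum_(j : option 'I_n.+1) #|[set F | cond F j]| <= _).
  elim/big_rec2: _ => [|j x s _ IH]; first by rewrite cards0.
  by rewrite cardsU; apply: leq_trans (leq_subr _ _) _; rewrite leq_add2l.
apply: leq_trans (leq_sum (E2 := fun=> tau ^ n.+1 * (A * (tau ^ n.+1 * tau))) _ _) _.
  move=> j _; rewrite -(card_in_imset (@Phi_inj j)).
  exact: leq_trans (subset_leq_card (@Phi_target j)) (card_target j).
by rewrite sum_nat_const card_option card_ord.
Qed.

End Count.
End BadTuples.
End CoprimeFamily.

Local Open Scope ring_scope.
Local Open Scope complex_scope.

(** * Additive characters *)

Section Characters.
Variable R : realType.
Local Notation normc := (@Normc.normc R).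
Implicit Types (x y : R) (A : int).

Definition e x : R[i] := cos (2 * pi * x) +i* sin (2 * pi * x).

Lemma e0 : e 0 = 1.
Proof. by rewrite /e mulr0 cos0 sin0. Qed.

Lemma eD x y : e (x + y) = e x * e y.
Proof. by rewrite /e mulrDr cosD sinD /=; congr (_ +i* _); ring. Qed.

Lemma normc_e x : normc (e x) = 1.
Proof. by rewrite /= cos2Dsin2 sqrtr1. Qed.

Lemma eMn x n : e (x *+ n) = e x ^+ n.
Proof. by elim: n => [|n IH]; rewrite ?e0 // mulrS eD IH exprS. Qed.

Lemma e1 : e 1 = 1.
Proof. by rewrite /e mulr1 mulr_natl cos2pi sin2pi. Qed.

Lemma eN x : e (- x) = (e x)^-1.
Proof.
have : e (- x) * e x = 1 by rewrite -eD addNr e0.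
by move=> /(canRL (mulfK _)) -> //; rewrite ?mul1r //; apply/eqP => ex0; have := normc_e x;
  rewrite ex0 Normc.normc0 => /eqP; rewrite eq_sym oner_eq0.
Qed.

Lemma e_int (k : int) : e k%:~R = 1.
Proof.
case: k => n; first by rewrite -[_%:~R]/(n%:R) -mulr_natr mul1r eMn e1 expr1n.
by rewrite NegzE rmorphN eN /= -[_%:~R]/(n.+1%:R) eMn e1 expr1n invr1.
Qed.

Lemma e_addint x (k : int) : e (x + k%:~R) = e x.
Proof. by rewrite eD e_int mulr1. Qed.

Lemma normc_sum (J : Type) (r : seq J) (P : pred J) (F : J -> R[i]) :
  normc (\sum_(j <- r | P j) F j) <= \sum_(j <- r | P j) normc (F j).
Proof.
elim/big_rec2: _ => [|j u v _ IH]; first by rewrite Normc.normc0.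
by apply: le_trans (le_normcD _ _) _; rewrite lerD2l.
Qed.

Lemma normc_prod (J : Type) (r : seq J) (P : pred J) (F : J -> R[i]) :
  normc (\prod_(j <- r | P j) F j) = \prod_(j <- r | P j) normc (F j).
Proof.
by elim/big_rec2: _ => [|j u v _ <-]; rewrite ?Normc.normc1 ?Normc.normcM.
Qed.

Lemma normc_ge0 z : 0 <= normc z.
Proof. by case: z => a b; apply: sqrtr_ge0. Qed.

Lemma normc_real x : normc x%:C = `|x|.
Proof. by rewrite /= expr0n addr0 sqrtr_sqr. Qed.

(** With [u = x / 2]: [sin x = 2 * sin u * cos u], the mean value theorem gives
    [sin u >= u * cos u], and [cos u ^+ 2 >= 1 / 2] because [cos (2 * u) >= 0]. *)
Lemma sin_ge_half x : 0 <= x <= pi / 2 -> x / 2 <= sin x.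
Proof.
move=> /andP[x0 xp].
set u := x / 2; have xE : x = u *+ 2 by rewrite /u; field.
have u0 : 0 <= u by rewrite divr_ge0.
have [c cI Ec] : exists2 c, c \in `[0, u] & sin u - sin 0 = cos c * (u - 0).
  by apply: MVT_segment => //; apply: continuous_subspaceT => y; apply: continuous_sin.
rewrite sin0 !subr0 in Ec.
have pi0 := @pi_gt0 R.
have cu : cos u <= cos c.
  move: cI; rewrite in_itv /= => /andP[c0 cu].
  move: cu; rewrite le_eqVlt => /predU1P[->//|cu]; apply: ltW.
  by rewrite ltr_cos // ?in_itv /=; apply/andP; split; lra.
have cu0 : 0 <= cos u by apply: cos_ge0_pihalf; apply/andP; split; lra.
have h2 : 1 / 2 <= cos u ^+ 2.
  have : 0 <= cos (u *+ 2) by apply: cos_ge0_pihalf; apply/andP; split; lra.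
  by rewrite cos_mulr2n mulr2n; lra.
rewrite xE sin_mulr2n Ec.
have : cos u * cos u <= cos u * cos c by apply: ler_wpM2l.
rewrite -expr2 => h3.
have : u * (1 / 2) <= u * (cos u * cos c) by apply: ler_wpM2l => //; lra.
move=> h4.
have -> : cos u * (cos c * u) *+ 2 = 2 * (u * (cos u * cos c)) by ring.
lra.
Qed.

Lemma normc_1Be x : 0 <= x <= 1 -> 2 * Num.min x (1 - x) <= normc (1 - e x).
Proof.
move=> /andP[x0 x1].
have -> : normc (1 - e x) = 2 * sin (pi * x).
  have s0 : 0 <= 2 * sin (pi * x).
    rewrite mulr_ge0 // sin_ge0_pi // mulr_ge0 ?pi_ge0 //=.
    by rewrite ler_piMr ?pi_ge0.
  rewrite -[RHS]ger0_norm // -sqrtr_sqr /e /=; congr Num.sqrt.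
  have -> : 2 * pi * x = (pi * x) *+ 2 by rewrite mulr2n; ring.
  rewrite cos_mulr2n sin_mulr2n !mulr2n.
  have := cos2Dsin2 (pi * x); set c := cos _; set s := sin _ => E.
  have Ec : c ^+ 2 = 1 - s ^+ 2 by lra.
  rewrite sub0r sqrrN.
  have -> : (c * s + c * s) ^+ 2 = 4 * (c ^+ 2 * s ^+ 2) by ring.
  by rewrite Ec; ring.
rewrite ler_pM2l //.
wlog xh : x x0 x1 / x <= 1 / 2.
  move=> W; have [/W->//|xh] := leP x (1 / 2).
  have -> : pi * x = - (pi * (1 - x)) + pi by ring.
  have -> : Num.min x (1 - x) = Num.min (1 - x) (1 - (1 - x)) by rewrite subKr minC.
  by rewrite sinDpi sinN opprK; apply: W; lra.
have -> : Num.min x (1 - x) = x by apply/min_idPl; lra.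
apply: le_trans (_ : pi * x / 2 <= _); first by have := ler_wpM2r x0 (@pi_ge2 R); lra.
apply: sin_ge_half; rewrite mulr_ge0 ?pi_ge0 //=.
by have := ler_wpM2l (@pi_ge0 R) xh; lra.
Qed.

Lemma norm_sum_e_le x N : 0 < x < 1 ->
  normc (\sum_(1 <= j < N.+1) e (x *+ j)) <= (Num.min x (1 - x))^-1.
Proof.
move=> /andP[x0 x1].
set S := \sum_(_ <= _ < _) _.
have m0 : 0 < Num.min x (1 - x) by rewrite lt_min x0 subr_gt0.
have E : (1 - e x) * S = e x * (1 - e (x *+ N)).
  rewrite /S; elim: N {S} => [|N IH]; first by rewrite big_geq // mulr0n e0 subrr !mulr0.
  rewrite big_nat_recr //= mulrDr IH mulrS eD; ring.
have le2 : normc (1 - e x) * normc S <= 2.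
  rewrite -Normc.normcM E Normc.normcM normc_e mul1r.
  apply: le_trans (le_normcD _ _) _.
  by rewrite normcN normc_e Normc.normc1; lra.
have /normc_1Be h : 0 <= x <= 1 by rewrite !ltW.
rewrite -[leRHS]mul1r ler_pdivlMr //.
have := ler_wpM2r (normc_ge0 S) h; rewrite -mulrA => h2.
rewrite mulrC; lra.
Qed.

Definition zeta (Q : nat) A : R[i] := e (A%:~R / Q%:R).

Lemma zetaD Q A B : zeta Q (A + B) = zeta Q A * zeta Q B.
Proof. by rewrite /zeta rmorphD mulrDl eD. Qed.

Lemma zeta0 Q : zeta Q 0 = 1. Proof. by rewrite /zeta mul0r e0. Qed.

Lemma zeta_sum Q (J : Type) (r : seq J) (P : pred J) (F : J -> int) :
  zeta Q (\sum_(j <- r | P j) F j) = \prod_(j <- r | P j) zeta Q (F j).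
Proof. by elim/big_rec2: _ => [|j u v _ <-]; rewrite ?zeta0 ?zetaD. Qed.

Lemma zetaMn Q A n : zeta Q (A *+ n) = zeta Q A ^+ n.
Proof. by rewrite /zeta rmorphMn mulrnAl eMn. Qed.

Lemma zeta_dvd Q A : (0 < Q)%N -> (Q %| A)%Z -> zeta Q A = 1.
Proof.
move=> Q0 /dvdzP[k ->]; rewrite /zeta rmorphM mulfK ?e_int //.
by rewrite intr_eq0 -lt0n.
Qed.

Lemma zeta_mod Q A : (0 < Q)%N -> zeta Q A = zeta Q (A %% Q)%Z.
Proof.
move=> Q0; rewrite {1}(divz_eq A Q) zetaD zeta_dvd ?mul1r //.
exact: dvdz_mull.
Qed.

(** A fraction with denominator [Q] that is not an integer has distance at least [1 / Q] from the
    integers, so the geometric sum is at most [Q], whatever its length. *)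
Lemma norm_sum_zeta_le Q A N : (0 < Q)%N -> ~~ (Q %| A)%Z ->
  normc (\sum_(1 <= n < N.+1) zeta Q (A *+ n)) <= Q%:R.
Proof.
move=> Q0 QA.
have Qz : (Q%:Z != 0)%R by rewrite -lt0n.
have [r rE rQ] : exists2 r : nat, (A %% Q)%Z = r%:Z & (0 < r < Q)%N.
  exists `|(A %% Q)%Z|%N; first by rewrite gez0_abs // modz_ge0.
  have := ltz_mod A Qz; have := modz_ge0 A Qz; rewrite dvdz_eq in QA.
  have : (A %% Q)%Z != 0 by apply: contra QA => /eqP h; rewrite {2}(divz_eq A Q) h addr0.
  lia.
have Qr : (0 : R) < Q%:R by rewrite ltr0n.
have /andP[r0 r1] := rQ.
have r0' : (1 : R) <= r%:R by rewrite ler1n.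
have r1' : (r%:R : R) + 1 <= Q%:R by rewrite natr1 ler_nat.
set x : R := r%:R / Q%:R.
have x01 : 0 < x < 1.
  by rewrite divr_gt0 ?ltr0n //= ltr_pdivrMr // mul1r; lra.
have -> : \sum_(1 <= n < N.+1) zeta Q (A *+ n) = \sum_(1 <= n < N.+1) e (x *+ n).
  by apply: eq_bigr => n _; rewrite zetaMn zeta_mod // rE -eMn.
apply: le_trans (norm_sum_e_le _ x01) _.
rewrite -[leRHS]invrK lef_pV2 ?posrE ?invr_gt0 //; last first.
  by move: x01 => /andP[x0 x1]; rewrite lt_min x0 subr_gt0.
rewrite le_min; apply/andP; split; rewrite -[Q%:R^-1]mul1r ?ler_pM2r ?invr_gt0 //.
rewrite lerBrDl -mulrDl ler_pdivrMr // mul1r; lra.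
Qed.

Lemma sum_zeta Q A : (0 < Q)%N ->
  \sum_(m < Q) zeta Q (A *+ m) = if (Q %| A)%Z then Q%:R else 0.
Proof.
move=> Q0; case: ifP => QA.
  rewrite (eq_bigr (fun=> 1)) ?sumr_const ?card_ord // => m _.
  by rewrite zetaMn zeta_dvd // expr1n.
have h : (zeta Q A - 1) * \sum_(m < Q) zeta Q A ^+ m = 0.
  rewrite -subrX1 -zetaMn zeta_dvd ?subrr // -mulr_natr.
  by apply: dvdz_mull; rewrite natz.
rewrite (eq_bigr (fun m : 'I_Q => zeta Q A ^+ m)); last by move=> m _; rewrite zetaMn.
move/eqP: h; rewrite mulf_eq0 subr_eq0 => /orP[/eqP z1|/eqP //].
(* The root of unity cannot be 1: otherwise the sum of [Q.+1] terms would be [Q.+1], above the bound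
   [Q]. *)
have := @norm_sum_zeta_le Q A Q.+1 Q0 (negbT QA).
have -> : \sum_(1 <= n < Q.+2) zeta Q (A *+ n) = (Q.+1%:R)%:C.
  rewrite (eq_bigr (fun=> 1)); last by move=> m _; rewrite zetaMn z1 expr1n.
  by rewrite sumr_const_nat subn1 /= rmorph_nat.
by rewrite normc_real ger0_norm // ler_nat ltnn.
Qed.

End Characters.

(** * Moments of trigonometric polynomials *)

Section TrigPolynomial.
Import mathcomp.boot.fintype mathcomp.boot.finset.
Variable R : realType.
Local Notation normc := (@Normc.normc R).
Local Notation zeta := (@zeta R).
Variables (X : finType) (w : X -> R[i]) (A : X -> int) (Q : nat).
Hypothesis Q_gt0 : (0 < Q)%N.

Definition trigpoly (m : nat) : R[i] := \sum_x w x * zeta Q (A x *+ m).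
Definition moment k : R[i] := Q%:R^-1 * \sum_(m < Q) trigpoly m ^+ k.

Let Q_neq0 : (Q%:R : R[i]) != 0.
Proof. by rewrite pnatr_eq0 -lt0n. Qed.

Lemma prod_trigpoly k (mm : 'I_k -> nat) :
  \prod_l trigpoly (mm l)
  = \sum_(F : {ffun 'I_k -> X}) (\prod_l w (F l)) * zeta Q (\sum_l A (F l) *+ mm l).
Proof.
rewrite bigA_distr_bigA /=; apply: eq_bigr => F _.
by rewrite big_split /= zeta_sum.
Qed.

Lemma sum_trigpoly_exp k (r : seq nat) :
  \sum_(m <- r) trigpoly m ^+ k = \sum_(F : {ffun 'I_k -> X}) (\prod_l w (F l))
    * \sum_(m <- r) zeta Q ((\sum_l A (F l)) *+ m).
Proof.
transitivity (\sum_(m <- r) \sum_(F : {ffun 'I_k -> X}) (\prod_l w (F l))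
    * zeta Q ((\sum_l A (F l)) *+ m)).
  apply: eq_bigr => m _; rewrite -[in LHS](card_ord k) -prodr_const.
  rewrite (prod_trigpoly (fun=> m)); apply: eq_bigr => F _.
  by rewrite sumrMnl.
by rewrite exchange_big /=; apply: eq_bigr => F _; rewrite mulr_sumr.
Qed.

Lemma momentE k : moment k = \sum_(F : {ffun 'I_k -> X}) (\prod_l w (F l))
    * (Q %| (\sum_l A (F l))%R)%Z%:R.
Proof.
rewrite /moment -(big_mkord xpredT (fun m => trigpoly m ^+ k)) sum_trigpoly_exp.
rewrite mulr_sumr; apply: eq_bigr => F _.
rewrite big_mkord sum_zeta // mulrCA; congr (_ * _).
by case: ifP => _; rewrite ?mulr0 ?mulVf.
Qed.

(** If the total is divisible by [Q], divisibility of the pair [(0, j)] is equivalent to that of the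
    remaining sum together with the pair. The two conditions are detected by independent averages,
    over [m] at the positions [0] and [j] and over [m'] elsewhere, and the double average
    factors. *)
Lemma moment_pair n (j : 'I_n.+2) : j != ord0 ->
  \sum_(F : {ffun 'I_n.+2 -> X}) (\prod_l w (F l))
    * ((Q %| (\sum_l A (F l))%R)%Z && (Q %| (A (F ord0) + A (F j))%R)%Z)%:R
  = moment 2 * moment n.
Proof.
move=> j0.
have D1 (S : Type) (idx : S) (op : Monoid.com_law idx) (G : 'I_n.+2 -> S) :
    \big[op/idx]_l G l = op (op (G ord0) (G j)) (\big[op/idx]_(l | (l != ord0) && (l != j)) G l).
  by rewrite (bigD1 ord0) //= (bigD1 j) //= Monoid.mulmA.
have cardP : #|[pred l : 'I_n.+2 | (l != ord0) && (l != j)]| = n.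
  have := cardC [pred l : 'I_n.+2 | (l != ord0) && (l != j)].
  have -> : #|[predC [pred l : 'I_n.+2 | (l != ord0) && (l != j)]]| = 2.
    rewrite (eq_card (B := [set ord0; j])) ?cards2 1?eq_sym ?j0 // => l.
    by rewrite !inE negb_and !negbK.
  by rewrite card_ord addnC => /(congr1 (subn^~ 2)); rewrite /= addKn => ->; rewrite subn2.
pose mm (m m' : nat) (l : 'I_n.+2) := if (l == ord0) || (l == j) then m else m'.
have E m m' : trigpoly m ^+ 2 * trigpoly m' ^+ n = \prod_l trigpoly (mm m m' l).
  rewrite D1 /= /mm !eqxx orbT expr2; congr (_ * _).
  rewrite -[in LHS]cardP -prodr_const; apply: eq_bigr => l.
  by move=> /andP[/negbTE -> /negbTE ->].
have -> : moment 2 * moment n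
    = (Q%:R * Q%:R)^-1 * \sum_(m < Q) \sum_(m' < Q) trigpoly m ^+ 2 * trigpoly m' ^+ n.
  rewrite /moment mulrACA invfM; congr (_ * _).
  by rewrite big_distrlr.
transitivity ((Q%:R * Q%:R)^-1 * \sum_(F : {ffun 'I_n.+2 -> X}) (\prod_l w (F l)) *
   \sum_(m < Q) \sum_(m' < Q) zeta Q (\sum_l A (F l) *+ mm m m' l)); last first.
  congr (_ * _); rewrite (eq_bigr (fun F : {ffun 'I_n.+2 -> X} => \sum_(m < Q) \sum_(m' < Q)
     (\prod_l w (F l)) * zeta Q (\sum_l A (F l) *+ mm m m' l))); last first.
    move=> F _; rewrite mulr_sumr; apply: eq_bigr => m _; by rewrite mulr_sumr.
  rewrite exchange_big; apply: eq_bigr => m _; rewrite exchange_big; apply: eq_bigr => m' _.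
  by rewrite E prod_trigpoly.
rewrite mulr_sumr; apply: eq_bigr => F _; rewrite mulrCA; congr (_ * _).
set B := \sum_(l | (l != ord0) && (l != j)) A (F l).
set A2 := A (F ord0) + A (F j).
have sumA : \sum_l A (F l) = A2 + B by rewrite D1.
have -> : \sum_(m < Q) \sum_(m' < Q) zeta Q (\sum_l A (F l) *+ mm m m' l)
    = (\sum_(m < Q) zeta Q (A2 *+ m)) * \sum_(m' < Q) zeta Q (B *+ m').
  rewrite big_distrlr; apply: eq_bigr => m _; apply: eq_bigr => m' _ /=.
  rewrite -zetaD; congr zeta; rewrite D1 /= /mm !eqxx orbT -mulrnDl; congr (_ + _).
  rewrite -sumrMnl; apply: eq_bigr => l; by move=> /andP[/negbTE -> /negbTE ->].
rewrite !sum_zeta // sumA.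
have [dA|dA] := boolP (Q %| A2)%Z; last by rewrite andbF mul0r mulr0.
rewrite rpredDl // andbT; case: ifP => _; last by rewrite !mulr0.
by rewrite mulVf // mulf_neq0.
Qed.

Definition tpartners n (F : {ffun 'I_n.+1 -> X}) : {set 'I_n.+1} :=
  [set j | (j != ord0) && (Q %| (A (F ord0) + A (F j))%R)%Z].

(** Summed over [j], [moment_pair] counts every resonant tuple once for each of its partners; so
    tuples with exactly one partner drop out of the difference. *)
Lemma moment_rec n : moment n.+2 - n.+1%:R * moment 2 * moment n
  = \sum_(F : {ffun 'I_n.+2 -> X}) (\prod_l w (F l))
    * ((Q %| (\sum_l A (F l))%R)%Z%:R * (1 - #|tpartners F|%:R)).
Proof.
have -> : n.+1%:R * moment 2 * moment n = \sum_(j : 'I_n.+2 | j != ord0)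
   \sum_(F : {ffun 'I_n.+2 -> X}) (\prod_l w (F l))
    * ((Q %| (\sum_l A (F l))%R)%Z && (Q %| (A (F ord0) + A (F j))%R)%Z)%:R.
  rewrite (eq_bigr (fun=> moment 2 * moment n)); last by move=> j j0; rewrite moment_pair.
  by rewrite sumr_const cardC1 card_ord -mulrA mulr_natl.
rewrite exchange_big momentE -sumrB; apply: eq_bigr => F _ /=.
rewrite -mulr_sumr -mulrBr; congr (_ * _).
rewrite mulrBr mulr1; congr (_ - _).
rewrite -sum1_card natr_sum mulr_sumr [RHS]big_mkcond /= [LHS]big_mkcond /=.
apply: eq_bigr => j _; rewrite inE; case: (j != ord0) => //=.
by case: (Q %| _)%Z; case: (Q %| _)%Z; rewrite /= ?mulr1 ?mulr0.
Qed.

Lemma moment_rec_le n : normc (moment n.+2 - n.+1%:R * moment 2 * moment n)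
  <= n.+2%:R * \sum_(F : {ffun 'I_n.+2 -> X} |
       (Q %| (\sum_l A (F l))%R)%Z && (#|tpartners F| != 1%N)) \prod_l normc (w (F l)).
Proof.
rewrite moment_rec; apply: le_trans (normc_sum _ _ _) _.
rewrite mulr_sumr [leRHS]big_mkcond /=; apply: ler_sum => F _.
rewrite Normc.normcM normc_prod.
have w0 : 0 <= \prod_l normc (w (F l)) by apply: prodr_ge0 => l _; apply: normc_ge0.
case: (Q %| _)%Z; rewrite ?mul1r ?mul0r ?Normc.normc0 ?mulr0 //=.
have [->|p1] := eqVneq #|tpartners F| 1%N; first by rewrite subrr Normc.normc0 mulr0.
rewrite /= mulrC ler_wpM2r //.
have -> : (1 - #|tpartners F|%:R : R[i]) = (1 - #|tpartners F|%:R)%:C.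
  by rewrite rmorphB rmorph1 rmorph_nat.
rewrite normc_real ler_norml.
have : (#|tpartners F| <= n.+1)%N.
  apply: leq_trans (_ : #|[set~ (ord0 : 'I_n.+2)]| <= _)%N; last by rewrite cardsC1 card_ord.
  by apply/subset_leq_card/subsetP => j; rewrite !inE => /andP[].
rewrite -(ler_nat R) => h; have : (0 : R) <= #|tpartners F|%:R by [].
have : (n.+2%:R = n.+1%:R + 1 :> R) by rewrite -natr1.
have : (0 : R) <= n.+1%:R by []; move=> *; apply/andP; split; lra.
Qed.

(** The bound is by any denominator [D] of [B / Q] instead of [Q]. Later [Q] is the product of all
    elements of the family, which can be far larger than the denominators that occur. *)
Lemma norm_sum_zeta_den D B N : (0 < D)%N -> (Q %| (D%:Z * B)%R)%Z -> ~~ (Q %| B)%Z ->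
  normc (\sum_(1 <= n < N.+1) zeta Q (B *+ n)) <= D%:R.
Proof.
move=> D0 /dvdzP[p Ep] QB.
have zE n : zeta Q (B *+ n) = zeta D (p *+ n).
  rewrite !zetaMn; congr (_ ^+ _); rewrite /zeta; congr e; apply/eqP.
  rewrite eqr_div ?pnatr_eq0 -?lt0n // -[Q%:R]/((Q%:Z)%:~R) -[D%:R]/((D%:Z)%:~R) -!intrM.
  by rewrite eqr_int mulrC Ep.
rewrite (eq_bigr (fun n => zeta D (p *+ n))) // => *.
rewrite ?zE //; apply: norm_sum_zeta_le => //.
apply: contra QB => /dvdzP[u Eu]; apply/dvdzP; exists u.
have Dz : D%:Z != 0 by rewrite -lt0n.
by apply: (mulfI Dz); rewrite Ep Eu; ring.
Qed.

(** Resonant tuples contribute the same to both averages. For every other tuple the sum of its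
    fractions has a denominator of at most [Y ^ k], which bounds the incomplete sum independently of
    the period [Q]. *)
Lemma moment_transfer (dx : X -> nat) (Y : nat) k N : (0 < N)%N ->
  (forall x, Q %| ((dx x)%:Z * A x)%R)%Z -> (forall x, 0 < dx x)%N ->
  (forall x, w x != 0 -> (dx x <= Y)%N) ->
  normc (N%:R^-1 * \sum_(1 <= m < N.+1) trigpoly m ^+ k - moment k)
  <= N%:R^-1 * (Y%:R ^+ k * (\sum_x normc (w x)) ^+ k).
Proof.
move=> N0 dQ d0 dY.
have Nn0 : (N%:R : R[i]) != 0 by rewrite pnatr_eq0 -lt0n.
have N0r : 0 <= (N%:R : R)^-1 by rewrite invr_ge0.
rewrite sum_trigpoly_exp momentE mulr_sumr -sumrB.
apply: le_trans (normc_sum _ _ _) _.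
have -> : (\sum_x normc (w x)) ^+ k = \sum_(F : {ffun 'I_k -> X}) \prod_l normc (w (F l)).
  by rewrite -(bigA_distr_bigA (fun (l : 'I_k) x => normc (w x))) /= prodr_const card_ord.
rewrite mulr_sumr mulr_sumr; apply: ler_sum => F _.
set B := \sum_l A (F l); set W := \prod_l w (F l).
rewrite mulrCA -mulrBr Normc.normcM normc_prod -/W.
have [W0|W0] := eqVneq W 0.
  by rewrite -normc_prod -/W W0 Normc.normc0 !(mul0r, mulr0).
rewrite [leRHS]mulrA [leRHS]mulrC; apply: ler_wpM2l; first by apply: prodr_ge0 => l _; apply: normc_ge0.
have [QB|QB] := boolP (Q %| B)%Z.
  rewrite (eq_bigr (fun=> 1)); last by move=> m _; rewrite zetaMn zeta_dvd // expr1n.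
  rewrite sumr_const_nat subn1 /= mulVf // subrr Normc.normc0.
  by rewrite mulr_ge0 // exprn_ge0.
rewrite subr0 Normc.normcM.
have -> : normc N%:R^-1 = N%:R^-1.
  by rewrite Normc.normcV -(rmorph_nat (real_complex R)) normc_real ger0_norm.
apply: ler_wpM2l => //.
apply: le_trans (@norm_sum_zeta_den (\prod_l dx (F l)) B N _ _ QB) _.
- by apply: prodn_gt0 => l.
- rewrite /B mulr_sumr; apply: rpred_sum => l _.
  by rewrite (bigD1 l) //= PoszM mulrAC; apply: dvdz_mulr.
rewrite -natrX ler_nat -[X in (_ <= Y ^ X)%N]card_ord -prod_nat_const.
apply: leq_prod => l _; apply: dY; apply: contraNneq W0 => w0.
by rewrite /W (bigD1 l) //= w0 mul0r.
Qed.

End TrigPolynomial.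

(** * Bessel's inequality for functions on the residues modulo [Q] *)

Section Bessel.
Variable R : realType.
Local Notation normc := (@Normc.normc R).
Local Notation zeta := (@zeta R).

Lemma sqr_normc (z : R[i]) : (normc z ^+ 2)%:C = z * z^*.
Proof. by rewrite rmorphXn /= -[LHS]/(`|z| ^+ 2) normCK. Qed.

Lemma conj_zeta Q A : (zeta Q A)^* = zeta Q (- A).
Proof. by rewrite /zeta rmorphN mulNr /e /= mulrN cosN sinN. Qed.

Lemma bessel (Q : nat) (V : finType) (P : pred V) (rho : V -> int) (f : nat -> R) :
  (0 < Q)%N -> {in P &, forall v u, (Q %| (rho v - rho u)%R)%Z -> v = u} ->
  \sum_(v | P v) normc (Q%:R^-1 * \sum_(m < Q) (f m)%:C * zeta Q (- rho v *+ m)) ^+ 2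
  <= Q%:R^-1 * \sum_(m < Q) f m ^+ 2.
Proof.
move=> Q0 rinj.
set c : V -> R[i] := fun v => Q%:R^-1 * \sum_(m < Q) (f m)%:C * zeta Q (- rho v *+ m).
have Qn0 : (Q%:R : R[i]) != 0 by rewrite pnatr_eq0 -lt0n.
have cE v : \sum_(m < Q) (f m)%:C * zeta Q (- rho v *+ m) = Q%:R * c v.
  by rewrite /c mulrA divff ?mul1r.
have ccE v : \sum_(m < Q) (f m)%:C * zeta Q (rho v *+ m) = Q%:R * (c v)^*.
  rewrite -[in RHS](conjc_nat R Q) -rmorphM /= -cE rmorph_sum; apply: eq_bigr => m _.
  rewrite rmorphM; congr (_ * _); first exact/esym/conjc_real.
  by rewrite [RHS]conj_zeta mulNrn opprK.
(* The residual of [f] after projection onto the characters [rho v]; its energy is nonnegative, and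
   orthogonality evaluates it. *)
pose g (m : nat) : R[i] := (f m)%:C - \sum_(v | P v) c v * zeta Q (rho v *+ m).
have gE : \sum_(m < Q) g m * (g m)^* = \sum_(m < Q) ((f m) ^+ 2)%:C
    - Q%:R * \sum_(v | P v) c v * (c v)^*.
  have E m : g m * (g m)^* = ((f m) ^+ 2)%:C
     - (\sum_(v | P v) (c v)^* * ((f m)%:C * zeta Q (- rho v *+ m)))
     - (\sum_(v | P v) c v * ((f m)%:C * zeta Q (rho v *+ m)))
     + \sum_(v | P v) \sum_(u | P u) c v * (c u)^* * zeta Q ((rho v - rho u) *+ m).
    have gc : (g m)^* = (f m)%:C - \sum_(v | P v) (c v)^* * zeta Q (- rho v *+ m).
      rewrite /g rmorphB rmorph_sum; congr (_ - _); first exact: conjc_real.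
      apply: eq_bigr => v _; rewrite rmorphM; congr (_ * _).
      by rewrite [LHS]conj_zeta mulNrn.
    rewrite [X in _ * X]gc /g mulrBl !mulrBr.
    have -> : (f m)%:C * (f m)%:C = (f m ^+ 2)%:C by rewrite rmorphXn.
    have -> : (f m)%:C * (\sum_(v | P v) (c v)^* * zeta Q (- rho v *+ m))
       = \sum_(v | P v) (c v)^* * ((f m)%:C * zeta Q (- rho v *+ m)).
      by rewrite mulr_sumr; apply: eq_bigr => v _; rewrite mulrCA.
    have -> : (\sum_(v | P v) c v * zeta Q (rho v *+ m)) * (f m)%:C
       = \sum_(v | P v) c v * ((f m)%:C * zeta Q (rho v *+ m)).
      by rewrite mulr_suml; apply: eq_bigr => v _; rewrite -mulrA (mulrC (zeta _ _)).
    have -> : (\sum_(v | P v) c v * zeta Q (rho v *+ m)) *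
       (\sum_(v | P v) (c v)^* * zeta Q (- rho v *+ m))
       = \sum_(v | P v) \sum_(u | P u) c v * (c u)^* * zeta Q ((rho v - rho u) *+ m).
      rewrite big_distrlr; apply: eq_bigr => v _; apply: eq_bigr => u _ /=.
      by rewrite mulrACA -zetaD -mulrnDl.
    ring.
  under eq_bigr => m _ do rewrite (E m).
  rewrite big_split /= !sumrB.
  have -> : \sum_(m < Q) \sum_(v | P v) (c v)^* * ((f m)%:C * zeta Q (- rho v *+ m))
     = Q%:R * \sum_(v | P v) c v * (c v)^*.
    rewrite exchange_big mulr_sumr; apply: eq_bigr => v _.
    by rewrite -mulr_sumr cE; ring.
  have -> : \sum_(m < Q) \sum_(v | P v) c v * ((f m)%:C * zeta Q (rho v *+ m))
     = Q%:R * \sum_(v | P v) c v * (c v)^*.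
    rewrite exchange_big mulr_sumr; apply: eq_bigr => v _.
    by rewrite -mulr_sumr ccE; ring.
  have -> : \sum_(m < Q) \sum_(v | P v) \sum_(u | P u)
       c v * (c u)^* * zeta Q ((rho v - rho u) *+ m) = Q%:R * \sum_(v | P v) c v * (c v)^*.
    rewrite exchange_big mulr_sumr; apply: eq_bigr => v Pv; rewrite exchange_big /=.
    rewrite (bigD1 v) //= -mulr_sumr sum_zeta // subrr dvdz0 big1 ?addr0; first by ring.
    move=> u /andP[Pu uv]; rewrite -mulr_sumr sum_zeta //.
    case: ifP => [/(rinj _ _ Pv Pu) vu|_]; last by rewrite mulr0.
    by rewrite vu eqxx in uv.
  by rewrite subrK.
have h : 0 <= \sum_(m < Q) f m ^+ 2 - Q%:R * \sum_(v | P v) normc (c v) ^+ 2.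
  rewrite -ler0c rmorphB rmorphM rmorph_sum rmorph_nat rmorph_sum /=.
  under [X in _ - _ * X]eq_bigr do rewrite sqr_normc.
  by rewrite -gE; apply: sumr_ge0 => m _; apply: mulcJ_ge0.
rewrite ler_pdivlMl ?ltr0n //; lra.
Qed.

End Bessel.

(** * Sawtooth sums over a coprime family *)

Section RealToComplex.
Variable R : realType.
Implicit Types x y : R.

Lemma RtoCM x y : (x * y)%:C = x%:C * y%:C. Proof. exact: rmorphM. Qed.
Lemma RtoCB x y : (x - y)%:C = x%:C - y%:C. Proof. exact: rmorphB. Qed.
Lemma RtoCV x : (x^-1)%:C = (x%:C)^-1. Proof. exact: fmorphV. Qed.
Lemma RtoCX x n : (x ^+ n)%:C = x%:C ^+ n. Proof. exact: rmorphXn. Qed.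
Lemma RtoC_nat n : (n%:R : R)%:C = n%:R. Proof. exact: rmorph_nat. Qed.
Lemma RtoC_sign n : ((-1) ^+ n : R)%:C = (-1) ^+ n. Proof. exact: rmorph_sign. Qed.
Lemma RtoC_sum (J : Type) (r : seq J) (P : pred J) (F : J -> R) :
  (\sum_(j <- r | P j) F j)%:C = \sum_(j <- r | P j) (F j)%:C.
Proof. exact: rmorph_sum. Qed.

End RealToComplex.

Section Sawtooth.
Variable R : realType.
Local Notation normc := (@Normc.normc R).
Local Notation zeta := (@zeta R).

Definition hits (d h m : nat) : nat := (\sum_(1 <= j < h.+1) (d %| m + j))%N.
Definition saw (d h m : nat) : R := (hits d h m)%:R - h%:R / d%:R.

Definition snum (s : bool) (a : nat) : int := if s then - a.+1%:Z else a.+1%:Z.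

(** Nonzero residues modulo [d] are represented by signed integers of least absolute value [a.+1];
    the residue [d / 2] of an even [d] is taken with the positive sign only, hence the two different
    inequalities. The index set does not depend on [d], and the coefficients decay in the
    numerator. *)
Definition coef (d h : nat) (s : bool) (a : nat) : R[i] :=
  if (if s then 2 * a.+1 < d else 2 * a.+1 <= d)%N
  then d%:R^-1 * \sum_(1 <= j < h.+1) zeta d (snum s a *+ j) else 0.

Lemma dvd_zeta d k : (0 < d)%N ->
  ((d %| k)%N%:R : R[i]) = d%:R^-1 * \sum_(a < d) zeta d (a%:Z *+ k).
Proof.
move=> d0; rewrite (eq_bigr (fun a : 'I_d => zeta d (k%:Z *+ a))); last first.
  by move=> a _; congr zeta; rewrite -(mulr_natr a%:Z) -(mulr_natr k%:Z) !natz mulrC.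
rewrite sum_zeta // dvdzE /=; case: ifP => _; last by rewrite mulr0.
by rewrite mulVf // pnatr_eq0 -lt0n.
Qed.

Lemma hits_zeta d h m : (0 < d)%N -> ((hits d h m)%:R : R[i])
  = \sum_(a < d) (d%:R^-1 * \sum_(1 <= j < h.+1) zeta d (a%:Z *+ j)) * zeta d (a%:Z *+ m).
Proof.
move=> d0; rewrite /hits natr_sum.
under eq_bigr do rewrite dvd_zeta //.
under [RHS]eq_bigr do rewrite -mulrA mulr_suml.
rewrite -!mulr_sumr; congr (_ * _); rewrite exchange_big; apply: eq_bigr => a _.
by apply: eq_bigr => j _; rewrite -zetaD -mulrnDr addnC.
Qed.

Lemma sum_signed (d : nat) (Phi : int -> R[i]) : (forall u : int, Phi (u + d%:Z) = Phi u) ->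
  \sum_(1 <= a < d) Phi a
  = \sum_(1 <= a < d | (2 * a <= d)%N) Phi a + \sum_(1 <= a < d | (2 * a < d)%N) Phi (- a%:Z).
Proof.
move=> per; rewrite (bigID (fun a => 2 * a <= d)%N) /=; congr (_ + _).
rewrite big_nat_rev /= big_nat_cond [RHS]big_nat_cond; apply: eq_big => a.
  by apply/andP/andP => -[ad h]; split => //; lia.
move=> /andP[/andP[a1 ad] _]; rewrite add1n subSS -[RHS]per; congr Phi.
by rewrite -subzn ?(ltnW ad) //; lia.
Qed.

(** The zero frequency of [hits] is exactly the subtracted mean [h / d], so only nonzero residues
    remain. *)
Lemma saw_fourier d h m Y : (0 < d)%N -> (d <= Y)%N ->
  (saw d h m)%:C = \sum_(x : bool * 'I_Y) coef d h x.1 x.2 * zeta d (snum x.1 x.2 *+ m).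
Proof.
move=> d0 dY.
pose Phi (u : int) := (d%:R^-1 * \sum_(1 <= j < h.+1) zeta d (u *+ j)) * zeta d (u *+ m).
have per (u : int) : Phi (u + d%:Z) = Phi u.
  have zper n : zeta d ((u + d%:Z) *+ n) = zeta d (u *+ n).
    rewrite mulrnDl zetaD (zeta_dvd _ d0 (A := d%:Z *+ n)) ?mulr1 //.
    by rewrite -mulr_natr; apply: dvdz_mulr; rewrite dvdzz.
  rewrite /Phi zper; congr (_ * _ * _); by apply: eq_bigr => j _; rewrite zper.
have -> : (saw d h m)%:C = \sum_(1 <= a < d) Phi a.
  rewrite /saw RtoCB RtoCM RtoCV !RtoC_nat hits_zeta //.
  rewrite -(big_mkord xpredT Phi) big_ltn // addrC.
  have -> : Phi 0%Z = h%:R / d%:R.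
    rewrite /Phi (mul0rn _ m) zeta0 mulr1 mulrC; congr (_ / _).
    rewrite (eq_bigr (fun=> 1)); last by move=> j _; rewrite (mul0rn _ j) zeta0.
    by rewrite sumr_const_nat subn1.
  by rewrite addKr.
rewrite (sum_signed per).
have ext (P : pred nat) (G : nat -> R[i]) : (forall a, (0 < a)%N -> P a -> (a < d)%N) ->
    \sum_(1 <= a < d | P a) G a = \sum_(a < Y) (if P a.+1 then G a.+1 else 0).
  move=> Pd; rewrite -(big_mkord xpredT (fun a => if P a.+1 then G a.+1 else 0)).
  have dY1 : (d <= Y.+1)%N by exact: leqW.
  rewrite -big_mkcond /= -(big_add1 _ _ 0 Y.+1) /= [RHS](big_cat_nat (n := d)) //=.
  rewrite [X in _ = _ + X]big_nat_cond [X in _ = _ + X]big1 ?addr0 // => a.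
  by move=> /andP[/andP[da _] Pa]; have := Pd a; rewrite Pa; lia.
rewrite !ext; try by move=> a; lia.
rewrite -(pair_bigA _ (fun s (a : 'I_Y) => coef d h s a * zeta d (snum s a *+ m))) /=.
rewrite big_bool /= addrC; congr (_ + _); apply: eq_bigr => a _; rewrite /coef /snum /=;
  by case: ifP; rewrite ?mul0r.
Qed.

Lemma normc_natV d : normc (d%:R^-1) = d%:R^-1.
Proof. by rewrite Normc.normcV -(rmorph_nat (real_complex R)) normc_real ger0_norm. Qed.

(** The geometric sum is at most [d / a.+1], and the factor [1 / d] removes [d]: the bound is
    uniform in both [d] and [h]. *)
Lemma normc_coef d h s a : normc (coef d h s a) <= a.+1%:R^-1.
Proof.
rewrite /coef; case: ifP => ha; last by rewrite Normc.normc0.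
have had : (2 * a.+1 <= d)%N by case: s ha => // /ltnW.
have d0 : (0 < d)%N by lia.
have d0r : (0 : R) < d%:R by rewrite ltr0n.
have a0r : (0 : R) < a.+1%:R by rewrite ltr0n.
have had' : 2 * a.+1%:R <= (d%:R : R) by rewrite -natrM ler_nat.
rewrite Normc.normcM normc_natV ler_pdivrMl //.
pose x : R := if s then 1 - a.+1%:R / d%:R else a.+1%:R / d%:R.
have ad0 : 0 < a.+1%:R / (d%:R : R) by rewrite divr_gt0.
have ad1 : a.+1%:R / (d%:R : R) <= 1 / 2 by rewrite ler_pdivrMr //; lra.
have -> : \sum_(1 <= j < h.+1) zeta d (snum s a *+ j) = \sum_(1 <= j < h.+1) e (x *+ j).
  apply: eq_bigr => j _; rewrite zetaMn eMn; congr (_ ^+ _); rewrite /zeta /snum /x.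
  case: s {ha x} => //; rewrite rmorphN mulNr addrC -[1]/(1%:~R) e_addint //.
apply: le_trans (norm_sum_e_le _ _) _; first by rewrite /x; case: (s); lra.
have -> : Num.min x (1 - x) = a.+1%:R / d%:R.
  by rewrite /x; case: (s); [rewrite subKr; apply/min_idPr | apply/min_idPl]; lra.
by rewrite invf_div.
Qed.

End Sawtooth.

(** * Moments of signed sums of sawtooth functions *)

Section FamilyMoments.
Import mathcomp.boot.fintype mathcomp.boot.finset.
Variable R : realType.
Local Notation normc := (@Normc.normc R).
Local Notation zeta := (@zeta R).
Local Notation saw := (@saw R).
Local Notation coef := (@coef R).
Variables (I : finType) (b : I -> nat).
Hypothesis b_gt1 : forall i, (1 < b i)%N.
Hypothesis b_coprime : forall i j, i != j -> coprime (b i) (b j).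
Local Notation dd := (dd b).
Local Notation freq := (freq b).
Local Notation Q := (dd setT).
Variable h : nat.
Implicit Types (D : {set {set I}}) (S : {set I}).

Definition fsum D (m : nat) : R := \sum_(S in D) (-1) ^+ #|S| * saw (dd S) h m.
Definition mom D k : R := Q%:R^-1 * \sum_(m < Q) fsum D m ^+ k.

Let Q_gt0 : (0 < Q)%N := dd_gt0 b_gt1 setT.

Section Index.
Variable (D : {set {set I}}) (Y : nat).
Hypothesis DY : forall S, S \in D -> (dd S <= Y)%N.

Let X : finType := ({set I} * (bool * 'I_Y))%type.
Let w (x : X) : R[i] :=
  if x.1 \in D then (-1) ^+ #|x.1| * coef (dd x.1) h x.2.1 x.2.2 else 0.
Let A (x : X) : int := freq (snum x.2.1 x.2.2) x.1.

Lemma zeta_freq a S m : zeta (dd S) (a *+ m) = zeta Q (freq a S *+ m).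
Proof.
rewrite !zetaMn; congr (_ ^+ _); rewrite /zeta /freq; congr e.
have -> : Q = (dd S * dd (~: S))%N by rewrite (dd_subset b (subsetT S)) setTD.
have d0 : ((dd (~: S))%:R : R) != 0 by rewrite pnatr_eq0 -lt0n dd_gt0.
by rewrite intrM natrM -mulf_div divff ?mulr1.
Qed.

Lemma fsum_trigpoly m : (fsum D m)%:C = trigpoly w A Q m.
Proof.
rewrite /fsum RtoC_sum /trigpoly big_mkcond /=.
rewrite -(pair_bigA _ (fun S (y : bool * 'I_Y) => w (S, y) * zeta Q (A (S, y) *+ m))) /=.
apply: eq_bigr => S _; rewrite /w /A /=; case: ifP => SD; last by rewrite big1 // => y _; rewrite mul0r.
rewrite RtoCM RtoC_sign (@saw_fourier _ _ _ _ Y) ?dd_gt0 ?DY // mulr_sumr.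
by apply: eq_bigr => y _; rewrite zeta_freq mulrA.
Qed.

Lemma mom_moment k : (mom D k)%:C = moment w A Q k.
Proof.
rewrite /mom /moment RtoCM RtoCV RtoC_nat RtoC_sum; congr (_ * _).
by apply: eq_bigr => m _; rewrite RtoCX fsum_trigpoly.
Qed.

Lemma normc_w x : normc (w x) <= x.2.2.+1%:R^-1.
Proof.
rewrite /w; case: ifP => _; last by rewrite Normc.normc0 invr_ge0.
rewrite Normc.normcM -(rmorph_sign (real_complex R)) normc_real normr_sign mul1r.
exact: normc_coef.
Qed.

(** The base [2 * Y ^ 3] is crude: one [Y] bounds the denominators, at most [Y] sets [S] occur, and
    each carries [2 * Y] signed numerators with coefficients of size at most 1. *)
Lemma fsum_transfer k N : (0 < N)%N ->
  `|N%:R^-1 * (\sum_(1 <= m < N.+1) fsum D m ^+ k) - mom D k|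
  <= N%:R^-1 * (2 * Y%:R ^+ 3) ^+ k.
Proof.
move=> N0.
have -> : `|N%:R^-1 * (\sum_(1 <= m < N.+1) fsum D m ^+ k) - mom D k|
   = normc (N%:R^-1 * (\sum_(1 <= m < N.+1) trigpoly w A Q m ^+ k) - moment w A Q k).
  rewrite -normc_real RtoCB RtoCM RtoCV RtoC_nat RtoC_sum mom_moment.
  congr (normc (_ * _ - _)); apply: eq_bigr => m _.
  by rewrite RtoCX fsum_trigpoly.
apply: le_trans (@moment_transfer R X w A Q Q_gt0 (fun x => dd x.1) Y k N N0 _ _ _) _.
- move=> x; rewrite /A /freq; apply/dvdzP; exists (snum x.2.1 x.2.2).
  by rewrite (dd_subset b (subsetT x.1)) setTD PoszM; ring.
- by move=> x; apply: dd_gt0.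
- by move=> x; rewrite /w; case: ifP => [/DY|]; rewrite ?eqxx.
apply: ler_wpM2l; first by rewrite invr_ge0.
rewrite -exprMn; apply: lerXn2r; rewrite ?nnegrE.
- by rewrite mulr_ge0 // sumr_ge0 // => x _; apply: normc_ge0.
- by rewrite mulr_ge0 // exprn_ge0.
have -> : 2 * (Y%:R : R) ^+ 3 = Y%:R * (Y%:R * (2 * Y%:R)) by ring.
apply: ler_wpM2l => //.
apply: le_trans (_ : \sum_(x : X | x.1 \in D) 1 <= _).
  rewrite [leRHS]big_mkcond; apply: ler_sum => x _.
  have := normc_w x; rewrite /w; case: ifP => _ hx; last by rewrite Normc.normc0.
  by apply: le_trans hx _; rewrite invf_le1 ?ler1n.
have -> : \sum_(x : X | x.1 \in D) (1 : R) = \sum_(S in D) \sum_(y : bool * 'I_Y) 1.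
  by rewrite pair_big_dep /=; apply: eq_bigl => x; rewrite andbT.
rewrite (eq_bigr (fun=> 2 * Y%:R)); last first.
  by move=> S _; rewrite sumr_const card_prod card_bool card_ord natrM.
rewrite sumr_const -(mulr_natr (2 * Y%:R)) mulrC; apply: ler_wpM2r; first by rewrite mulr_ge0.
rewrite ler_nat; apply: leq_trans (card_dd_le b_gt1 b_coprime Y).
by apply/subset_leq_card/subsetP => S /DY; rewrite inE.
Qed.

End Index.

Lemma sum_bool_ord (Y k : nat) :
  \sum_(G : {ffun 'I_k -> bool * 'I_Y}) \prod_l ((G l).2.+1%:R : R)^-1
  = (2 * \sum_(a < Y) a.+1%:R^-1) ^+ k.
Proof.
rewrite -(bigA_distr_bigA (fun (l : 'I_k) (x : bool * 'I_Y) => (x.2.+1%:R : R)^-1)) /=.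
rewrite prodr_const card_ord; congr (_ ^+ _).
by rewrite -(pair_bigA _ (fun (s : bool) (a : 'I_Y) => (a.+1%:R : R)^-1)) /= big_bool mulr_natl mulr2n.
Qed.

(** The tuple [G] of signed numerators is fixed first. [card_bad_tuples] bounds the number of
    denominator tuples uniformly in [G], and the weights [1 / |a|] then sum to a power of a harmonic
    sum. *)
Lemma mom_rec_le (t M n Y tau C : nat) D : D = [set S | dd S <= t ^ M]%N ->
  (0 < t)%N -> (n.+3 <= M)%N ->
  (t ^ M <= Y)%N -> (2 * (t ^ M) ^ 2 <= Y)%N -> ((t ^ M) ^ n.+2 <= Y)%N ->
  (forall S, dd S <= Y -> 2 ^ #|S| <= tau)%N ->
  (#|[set S | dd S ^ 2 * t <= (t ^ M) ^ n.+2]| <= C)%N ->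
  `|mom D n.+2 - n.+1%:R * mom D 2 * mom D n|
  <= n.+2%:R * ((2 * \sum_(a < t ^ M) a.+1%:R^-1) ^+ n.+2
     * (n.+3 * (tau ^ n.+2 * (C * (tau ^ n.+2 * tau))))%N%:R).
Proof.
move=> DE t0 Mn yY y2Y ynY tauP CP; set y := (t ^ M)%N.
have DY S : S \in D -> (dd S <= y)%N by rewrite DE inE.
pose X : finType := ({set I} * (bool * 'I_y))%type.
pose w (x : X) : R[i] :=
  if x.1 \in D then (-1) ^+ #|x.1| * coef (dd x.1) h x.2.1 x.2.2 else 0.
pose A (x : X) : int := freq (snum x.2.1 x.2.2) x.1.
have -> : `|mom D n.+2 - n.+1%:R * mom D 2 * mom D n|
   = normc (moment w A Q n.+2 - n.+1%:R * moment w A Q 2 * moment w A Q n).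
  by rewrite -normc_real RtoCB (RtoCM _ (mom D n)) (RtoCM _ (mom D 2)) RtoC_nat !(mom_moment DY).
apply: le_trans (moment_rec_le _ _ Q_gt0 _) _; apply: ler_wpM2l => //.
set K : nat := (n.+3 * _)%N.
pose snd_ (F : {ffun 'I_n.+2 -> X}) : {ffun 'I_n.+2 -> bool * 'I_y} := [ffun l => (F l).2].
rewrite (partition_big snd_ xpredT) //= -sum_bool_ord mulr_suml; apply: ler_sum => G _.
pose P (F : {ffun 'I_n.+2 -> X}) : bool :=
  (Q %| (\sum_l A (F l))%R)%Z && (#|tpartners A Q F| != 1%N) && (snd_ F == G).
apply: le_trans (_ : \sum_(F | P F && [forall l, (F l).1 \in D]) \prod_l ((G l).2.+1%:R : R)^-1 <= _).
  rewrite [leLHS](bigID (fun F : {ffun 'I_n.+2 -> X} => [forall l, (F l).1 \in D])) /=.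
  rewrite [X in _ + X]big1 ?addr0; last first.
    move=> F /andP[_]; rewrite negb_forall => /existsP[l Fl].
    by rewrite (bigD1 l) //= /w (negbTE Fl) Normc.normc0 mul0r.
  apply: ler_sum => F /andP[/andP[_ /eqP FG] _]; apply: ler_prod => l _.
  rewrite normc_ge0 /=; have := @normc_w D y (F l).
  by rewrite -FG /snd_ ffunE.
rewrite sumr_const -[leLHS]mulr_natr; apply: ler_wpM2l.
  by apply: prodr_ge0 => l _; rewrite invr_ge0.
rewrite ler_nat.
pose a (l : 'I_n.+2) := snum (G l).1 (G l).2.
have aE l : `|a l|%N = (G l).2.+1 by rewrite /a /snum; case: (G l).1; lia.
have a0 l : a l <> 0 by move=> al; have := aE l; rewrite al.
have ay l : (`|a l| <= y)%N by rewrite aE; apply: ltn_ord.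
apply: leq_trans (@card_bad_tuples I b b_gt1 b_coprime n.+1 a t M t0 Mn Y tau C a0 ay yY y2Y ynY tauP CP).
pose fst_ (F : {ffun 'I_n.+2 -> X}) : {ffun 'I_n.+2 -> {set I}} := [ffun l => (F l).1].
rewrite -(card_in_image (f := fst_)).
  apply/subset_leq_card/subsetP => F' /imageP[F].
  rewrite unfold_in => /andP[/andP[/andP[dQ np] /eqP FG] /forallP FD] ->.
  have AE l : A (F l) = freq (a l) (fst_ F l) by rewrite /A /a -FG /snd_ /fst_ !ffunE.
  rewrite in_set; apply/and3P; split.
  - by apply/forallP => l; rewrite ffunE; apply: DY.
  - by rewrite /freq_sum -(eq_bigr _ (fun l _ => AE l)).
  apply: contra np => /eqP <-; apply/eqP; apply: eq_card => j; rewrite !in_set.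
  by rewrite /freq_pair !AE.
move=> F1 F2; rewrite !unfold_in => /andP[/andP[_ /eqP G1] _] /andP[/andP[_ /eqP G2] _] E.
apply/ffunP => l; have := congr1 (fun F : {ffun _} => F l) E; rewrite !ffunE => E1.
have : (F1 l).2 = (F2 l).2 by move: G1; rewrite -G2 => /ffunP /(_ l); rewrite !ffunE.
by move: E1; case: (F1 l) => ? ?; case: (F2 l) => ? ? /= -> ->.
Qed.

End FamilyMoments.

(** * Second moments of sawtooth sums *)

Lemma sum_eqmod_block (D r : nat) : (0 < D)%N -> (\sum_(m < D) (m == r %[mod D]))%N = 1%N.
Proof.
move=> D0; rewrite (bigD1 (Ordinal (ltn_pmod r D0))) //= modn_mod eqxx big1 // => m.
by rewrite -val_eqE /= => /negbTE mr; rewrite (modn_small (ltn_ord m)) mr.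
Qed.

Lemma sum_eqmod (D r q : nat) : (0 < D)%N -> (\sum_(m < q * D) (m == r %[mod D]))%N = q.
Proof.
move=> D0; rewrite -(big_mkord xpredT (fun m => nat_of_bool (m == r %[mod D]))).
elim: q => [|q IH]; first by rewrite mul0n big_geq.
rewrite mulSnr (big_cat_nat (n := (q * D)%N)) ?leq_addr //= IH -{1}[(q * D)%N]add0n big_addn addKn.
rewrite big_mkord (eq_bigr (fun m : 'I_D => nat_of_bool (m == r %[mod D]))).
  by rewrite sum_eqmod_block // addn1.
by move=> m _; rewrite addnC modnMDl.
Qed.

Lemma sum_eqmod_le (R : realType) (D r h : nat) : (0 < D)%N ->
  `|((\sum_(1 <= m < h.+1) (m == r %[mod D]))%N%:R : R) - h%:R / D%:R| <= 1.
Proof.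
move=> D0; have D0r : (0 : R) < D%:R by rewrite ltr0n.
(* Adding [D.-1] subtracts 1 modulo [D]; it compensates for the sum starting at 1 rather than 0. *)
pose r' := (r + D.-1)%N.
have -> : (\sum_(1 <= m < h.+1) (m == r %[mod D]) = \sum_(m < h) (m == r' %[mod D]))%N.
  rewrite big_add1 /= big_mkord; apply: eq_bigr => m _; congr nat_of_bool.
  by rewrite -(eqn_modDr D.-1) addSnnS prednK // modnDr.
pose F n := (\sum_(m < n) (m == r' %[mod D]))%N.
have mono n n' : (n <= n')%N -> (F n <= F n')%N.
  move=> nn'; rewrite /F -!(big_mkord xpredT (fun m => nat_of_bool (m == r' %[mod D]))).
  by rewrite [X in (_ <= X)%N](big_cat_nat (n := n)) //= leq_addr.
have h1 : (h %/ D <= F h)%N by rewrite -{1}(sum_eqmod r' (h %/ D) D0); apply/mono/leq_divM.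
have h2 : (F h <= (h %/ D).+1)%N.
  by rewrite -[X in (_ <= X)%N](sum_eqmod r' (h %/ D).+1 D0); apply/mono/ltnW/ltn_ceil.
have l1 : ((h %/ D)%N%:R : R) <= h%:R / D%:R.
  by rewrite ler_pdivlMr // -natrM ler_nat leq_divM.
have l2 : (h%:R : R) / D%:R <= (h %/ D).+1%:R.
  by rewrite ler_pdivrMr // -natrM ler_nat ltnW // ltn_ceil.
move: h1 h2; rewrite -!(ler_nat R) -/(F h) => h1 h2.
by move: l2 h2; rewrite -!natr1 => l2 h2; rewrite ler_norml; apply/andP; split; lra.
Qed.

(** [j * d.-1] stands for [- j] modulo [d] within the natural numbers. *)
Lemma dvdn_addE (d m j : nat) : (0 < d)%N -> (d %| m + j)%N = (m == j * d.-1 %[mod d]).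
Proof.
by move=> d0; rewrite -(eqn_modDr j) -mulnSr prednK // modnMl /dvdn.
Qed.

Section FamilyVariance.
Import mathcomp.boot.fintype mathcomp.boot.finset.
Variable R : realType.
Local Notation normc := (@Normc.normc R).
Local Notation zeta := (@zeta R).
Local Notation saw := (@saw R).
Variables (I : finType) (b : I -> nat).
Hypothesis b_gt1 : forall i, (1 < b i)%N.
Hypothesis b_coprime : forall i j, i != j -> coprime (b i) (b j).
Local Notation dd := (dd b).
Local Notation freq := (freq b).
Local Notation Q := (dd setT).
Variable h : nat.
Local Notation mom := (@mom R I b h).
Local Notation fsum := (@fsum R I b h).
Implicit Types (D : {set {set I}}) (S T V : {set I}).

Let Q_gt0 : (0 < Q)%N := dd_gt0 b_gt1 setT.
Let d_gt0 S : (0 < dd S)%N := dd_gt0 b_gt1 S.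
Let Q0 : (0 : R) < Q%:R. Proof. by rewrite ltr0n. Qed.
Let d0 S : (0 : R) < (dd S)%:R. Proof. by rewrite ltr0n. Qed.

Let mean_eqmod S r : Q%:R^-1 * ((\sum_(m < Q) (m == r %[mod dd S]))%N%:R : R) = (dd S)%:R^-1.
Proof.
have -> : Q = (dd (~: S) * dd S)%N by rewrite (dd_subset b (subsetT S)) setTD mulnC.
by rewrite sum_eqmod // natrM invfM mulrAC mulVf ?mul1r // gt_eqF.
Qed.

Lemma mean_hits S : Q%:R^-1 * (\sum_(m < Q) ((hits (dd S) h m)%:R : R)) = h%:R / (dd S)%:R.
Proof.
under eq_bigr do rewrite /hits natr_sum.
rewrite exchange_big mulr_sumr (eq_bigr (fun=> (dd S)%:R^-1)); last first.
  move=> j _; rewrite -natr_sum -(mean_eqmod S (j * (dd S).-1)); congr (_ * _%:R).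
  by apply: eq_bigr => m _; rewrite dvdn_addE.
by rewrite sumr_const_nat subn1 /= -[LHS]mulr_natl.
Qed.

(** Chinese remaindering with the coprime moduli [dd S] and [dd (T :\: S)]: the common part
    [dd (S :&: T)] imposes no further condition on [m], only compatibility of [j] and [j']. *)
Lemma dvd_pairE S T j j' : exists r : nat, forall m : nat,
  ((dd S %| m + j) && (dd T %| m + j'))%N
  = (j == j' %[mod dd (S :&: T)]) && (m == r %[mod dd (S :|: T)]).
Proof.
set d := dd S; set g := dd (S :&: T); set t := dd (T :\: S).
have Tgt : dd T = (g * t)%N by rewrite /g /t setIC -ddID.
have gd : (g %| d)%N by apply: dvdn_dd; apply: subsetIl.
have disj : [disjoint S & T :\: S] by rewrite -setI_eq0 setIDA setIC -setIDA setDv setI0.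
have ct : coprime d t by apply: coprime_dd.
have dp : (0 < d)%N by exact: d_gt0.
have tp : (0 < t)%N by exact: d_gt0.
have cgt : coprime g t by apply: coprime_dvdl gd ct.
have -> : dd (S :|: T) = (d * t)%N.
  rewrite -ddU //; congr dd; apply/setP => i; rewrite !inE; by case: (i \in S).
exists (chinese d t (j * d.-1) (j' * t.-1)) => m.
rewrite Tgt Gauss_dvd // chinese_remainder // chinese_modl // chinese_modr // -!dvdn_addE //.
case dm: (d %| m + j)%N; last by rewrite /= andbF.
have gm : (g %| m + j)%N by apply: dvdn_trans dm.
rewrite /=; congr (_ && _); rewrite -(eqn_modDl m).
by move: gm; rewrite /dvdn => /eqP ->; rewrite eq_sym.
Qed.

Definition npairs g : nat := (\sum_(1 <= j < h.+1) \sum_(1 <= j' < h.+1) (j == j' %[mod g]))%N.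

Lemma mean_hits2 S T :
  Q%:R^-1 * (\sum_(m < Q) ((hits (dd S) h m)%:R * (hits (dd T) h m)%:R : R))
  = (npairs (dd (S :&: T)))%:R / (dd (S :|: T))%:R.
Proof.
have E m : ((hits (dd S) h m)%:R * (hits (dd T) h m)%:R : R)
   = \sum_(1 <= j < h.+1) \sum_(1 <= j' < h.+1) ((dd S %| m + j) && (dd T %| m + j'))%N%:R.
  rewrite /hits !natr_sum big_distrlr; apply: eq_bigr => j _; apply: eq_bigr => j' _ /=.
  by rewrite -natrM mulnb.
under eq_bigr => m _ do rewrite E.
rewrite exchange_big mulr_sumr /npairs natr_sum mulr_suml; apply: eq_bigr => j _.
rewrite exchange_big mulr_sumr natr_sum mulr_suml; apply: eq_bigr => j' _.
have [r Hr] := dvd_pairE S T j j'.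
rewrite -(mean_eqmod (S :|: T) r) mulrCA natr_sum; congr (_ * _).
rewrite mulr_sumr; apply: eq_bigr => m _.
by rewrite Hr -natrM mulnb.
Qed.

(** With [L = dd (S :|: T)] and [g = dd (S :&: T)] the covariance is [(npairs g - h ^ 2 / g) / L].
    For each [j] the number of [j' <= h] congruent to [j] differs from [h / g] by at most 1, so a
    single factor [h] is lost instead of [h ^ 2]. *)
Lemma cov_le S T :
  `|Q%:R^-1 * (\sum_(m < Q) saw (dd S) h m * saw (dd T) h m)| <= h%:R / (dd (S :|: T))%:R.
Proof.
set L := dd (S :|: T); set g := dd (S :&: T).
have LgE : (dd S * dd T = g * L)%N.
  rewrite /g /L (_ : S :|: T = S :|: (T :\: S)); last first.
    by apply/setP => i; rewrite !inE; case: (i \in S).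
  rewrite ddU; last by rewrite -setI_eq0 setIDA setIC -setIDA setDv setI0.
  by rewrite [in LHS](ddID b T S) (setIC T S) mulnCA.
have -> : Q%:R^-1 * (\sum_(m < Q) saw (dd S) h m * saw (dd T) h m)
   = L%:R^-1 * ((npairs g)%:R - h%:R * (h%:R / g%:R)).
  set u := h%:R / (dd T)%:R : R; set v := h%:R / (dd S)%:R : R.
  have E (m : 'I_Q) : saw (dd S) h m * saw (dd T) h m =
     (hits (dd S) h m)%:R * (hits (dd T) h m)%:R
     - u * (hits (dd S) h m)%:R - v * (hits (dd T) h m)%:R + v * u by rewrite /saw /u /v; ring.
  rewrite (eq_bigr _ (fun m _ => E m)) big_split /= !sumrB sumr_const card_ord -!mulr_sumr.
  rewrite mulrDr 2!mulrBr mean_hits2 (mulrCA _ u) (mulrCA _ v) !mean_hits.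
  rewrite -(mulr_natr (v * u)) (mulrCA Q%:R^-1) mulVf ?gt_eqF // mulr1 -/L -/g /u /v.
  have -> : h%:R / (dd T)%:R * (h%:R / (dd S)%:R) = h%:R ^+ 2 / (g%:R * L%:R) :> R.
    by rewrite -natrM -LgE natrM; field; rewrite !gt_eqF.
  have -> : h%:R / (dd S)%:R * (h%:R / (dd T)%:R) = h%:R ^+ 2 / (g%:R * L%:R) :> R.
    by rewrite -natrM -LgE natrM; field; rewrite !gt_eqF.
  by field; rewrite !gt_eqF // ltr0n dd_gt0.
have L0 : (0 : R) < L%:R by rewrite ltr0n d_gt0.
rewrite normrM [X in X * _]ger0_norm ?invr_ge0 // [leRHS]mulrC ler_pM2l ?invr_gt0 //.
rewrite /npairs natr_sum.
have -> : h%:R * (h%:R / g%:R) = \sum_(1 <= j < h.+1) (h%:R / g%:R) :> R.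
  by rewrite sumr_const_nat subn1 /= -[RHS]mulr_natl.
rewrite -sumrB; apply: le_trans (ler_norm_sum _ _ _) _.
apply: le_trans (_ : \sum_(1 <= j < h.+1) (1 : R) <= _).
  apply: ler_sum => j _.
  rewrite (eq_bigr (fun j' => nat_of_bool (j' == j %[mod g]))) => [|j' _]; last by rewrite eq_sym.
  by apply: sum_eqmod_le; exact: d_gt0.
by rewrite sumr_const_nat subn1.
Qed.

Lemma mom2_le D : mom D 2 <= h%:R * \sum_(S in D) \sum_(T in D) ((dd (S :|: T))%:R)^-1.
Proof.
have -> : mom D 2 = \sum_(S in D) \sum_(T in D) (-1) ^+ #|S| * (-1) ^+ #|T|
    * (Q%:R^-1 * (\sum_(m < Q) saw (dd S) h m * saw (dd T) h m)).
  rewrite /mom mulr_sumr.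
  under eq_bigr => m _ do rewrite /fsum expr2 big_distrlr /= mulr_sumr.
  rewrite exchange_big; apply: eq_bigr => S _.
  under eq_bigr => m _ do rewrite mulr_sumr.
  rewrite exchange_big; apply: eq_bigr => T _.
  by rewrite !mulr_sumr; apply: eq_bigr => m _; ring.
rewrite mulr_sumr; apply: ler_sum => S _; rewrite mulr_sumr; apply: ler_sum => T _.
apply: le_trans (ler_norm _) _; rewrite 2!normrM !normrX normrN1 !expr1n !mul1r.
exact: cov_le.
Qed.

Let zeta_one S T j : S \subset T ->
  zeta (dd T) ((dd (T :\: S))%:Z *+ j) = zeta (dd S) (j%:Z).
Proof.
move=> ST; rewrite -[j%:Z]natz zetaMn -[RHS]/(zeta (dd S) (1 *+ j)) zetaMn; congr (_ ^+ _).
rewrite /zeta (dd_subset b ST); congr e; rewrite natrM /=.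
by rewrite -[(dd (T :\: S))%:~R]/((dd (T :\: S))%:R); field; rewrite !gt_eqF.
Qed.

(** [dd (~: V)] over the denominator [Q] is the fraction [1 / dd V]; written with denominator [dd S]
    it has numerator [dd (S :\: V)]. *)
Lemma dvd_freq_compl a S V : V \subset S -> V != set0 -> (a < dd S)%N ->
  (Q %| (freq a%:Z S - (dd (~: V))%:Z)%R)%Z = (a == dd (S :\: V)).
Proof.
move=> VS V0 ad.
have EV : dd (~: V) = (dd (S :\: V) * dd (~: S))%N.
  rewrite -ddU; last by rewrite disjoints_subset; apply/subsetP => i; rewrite !inE negbK => /andP[].
  congr dd; apply/setP => i; rewrite !inE; case iS: (i \in S); rewrite ?andbT ?orbF //.
  by rewrite orbT; apply/negP => /(subsetP VS); rewrite iS.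
have lt : (dd (S :\: V) < dd S)%N.
  rewrite (dd_subset b VS) -[X in (X < _)%N]mul1n ltn_pmul2r //.
  case/set0Pn: V0 => i iV; apply: leq_trans (b_gt1 i) _.
  by rewrite -(dd1 b i); apply: leq_dd => //; rewrite sub1set.
rewrite /freq EV PoszM -mulrBl (dd_subset b (subsetT S)) setTD PoszM.
rewrite dvdz_mul2r; last by rewrite -lt0n.
apply/idP/eqP => [|->]; last by rewrite subrr dvdz0.
by rewrite -eqz_mod_dvd !modz_nat !modn_small // => /eqP[].
Qed.

(** The Fourier coefficient at the frequency [1 / dd V]. If some [i] in [V] is missing from [S], no
    fraction with denominator [dd S] equals [1 / dd V], and the coefficient vanishes. *)
Lemma saw_coeff S V : V != set0 ->
  Q%:R^-1 * \sum_(m < Q) (saw (dd S) h m)%:C * zeta Q (- (dd (~: V))%:Z *+ m)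
  = if V \subset S then (dd S)%:R^-1 * \sum_(1 <= j < h.+1) zeta (dd V) j%:Z else 0.
Proof.
move=> V0; set rho := (dd (~: V))%:Z.
have QC0 : (Q%:R : R[i]) != 0 by rewrite pnatr_eq0 -lt0n.
have rhoQ : ~~ (Q %| - rho)%Z.
  rewrite dvdzE abszN /=; apply/negP => /(dvdn_ddP b_coprime) H.
  case/set0Pn: V0 => i iV; have := H i (in_setT _).
  by rewrite dvd_ddE // !inE iV.
have -> : \sum_(m < Q) (saw (dd S) h m)%:C * zeta Q (- rho *+ m)
   = \sum_(a < dd S) ((dd S)%:R^-1 * \sum_(1 <= j < h.+1) zeta (dd S) (a%:Z *+ j))
       * (if (Q %| (freq a%:Z S - rho)%R)%Z then Q%:R else 0).
  transitivity (\sum_(m < Q) (hits (dd S) h m)%:R * zeta Q (- rho *+ m)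
     - (h%:R / (dd S)%:R) * \sum_(m < Q) zeta Q (- rho *+ m)).
    rewrite mulr_sumr -sumrB; apply: eq_bigr => m _.
    by rewrite /saw RtoCB RtoCM RtoCV !RtoC_nat mulrBl.
  rewrite sum_zeta // (negbTE rhoQ) mulr0 subr0.
  under eq_bigr => m _ do rewrite hits_zeta // mulr_suml.
  rewrite exchange_big; apply: eq_bigr => a _; rewrite -sum_zeta //.
  set c := (_ * \sum_(1 <= j < h.+1) _); rewrite mulr_sumr.
  apply: eq_bigr => m _; rewrite -mulrA (@zeta_freq R I b b_gt1); congr (_ * _).
  by rewrite -zetaD -mulrnDl.
case: ifP => VS.
  have aP : (dd (S :\: V) < dd S)%N.
    rewrite (dd_subset b VS) -[X in (X < _)%N]mul1n ltn_pmul2r //.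
    case/set0Pn: V0 => i iV; apply: leq_trans (b_gt1 i) _.
    by rewrite -(dd1 b i); apply: leq_dd => //; rewrite sub1set.
  rewrite (bigD1 (Ordinal aP)) //= [X in _ * (_ + X)]big1 ?addr0.
    rewrite dvd_freq_compl // eqxx mulrC mulfK //; congr (_ * _).
    by apply: eq_bigr => j _; rewrite zeta_one.
  move=> a; rewrite -val_eqE /= => aa.
  by rewrite dvd_freq_compl // (negbTE aa) mulr0.
rewrite big1 ?mulr0 // => a _; case: ifP => [|_]; last by rewrite mulr0.
move/negbT/subsetPn: VS => [i iV iS] /(dvdz_ddP b_coprime) /(_ i (in_setT _)).
rewrite /freq rpredBl; last by apply: dvdz_mull; rewrite dvdzE /= dvdn_b_dd // inE.
by rewrite /rho dvdzE /= dvd_ddE // !inE iV.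
Qed.

(** For [8 * h <= d] all angles [2 * pi * j / d] are at most [pi / 4], so every term has real part
    at least [1 / 2] and nothing cancels. *)
Lemma norm_sum_zeta_ge d : (8 * h <= d)%N ->
  h%:R / 2 <= normc (\sum_(1 <= j < h.+1) zeta d j%:Z).
Proof.
case: d => [|d] hd.
  have -> : h = 0%N by lia.
  by rewrite mul0r normc_ge0.
have ReS (r : seq nat) (F : nat -> R[i]) : complex.Re (\sum_(j <- r) F j) = \sum_(j <- r) complex.Re (F j).
  by elim/big_rec2: _ => [//|j x y _ <-]; case: (F j); case: y.
have Rele (z : R[i]) : complex.Re z <= normc z.
  case: z => u v /=; apply: le_trans (ler_norm _) _.
  by rewrite -sqrtr_sqr ler_wsqrtr // lerDl sqr_ge0.
apply: le_trans (Rele _); rewrite ReS.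
have -> : h%:R / 2 = \sum_(1 <= j < h.+1) (1 / 2 : R).
  by rewrite sumr_const_nat subn1 /= -[RHS]mulr_natl mul1r.
rewrite big_nat_cond [leRHS]big_nat_cond; apply: ler_sum => j /andP[/andP[j1 jh] _].
rewrite /zeta /e /= -[(j%:Z)%:~R]/(j%:R).
have dr : (0 : R) < d.+1%:R by rewrite ltr0n.
have jd : 8 * j%:R <= (d.+1%:R : R).
  by rewrite -natrM ler_nat; apply: leq_trans hd; rewrite leq_mul2l -ltnS jh.
have x0 : 0 <= j%:R / d.+1%:R :> R by rewrite divr_ge0.
have x8 : j%:R / d.+1%:R <= 1 / 8 :> R by rewrite ler_pdivrMr //; lra.
set x := j%:R / d.+1%:R in x0 x8 *.
have p0 := @pi_gt0 R.
have px0 : 0 <= pi * x by rewrite mulr_ge0 // ltW.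
have px8 : pi * x <= pi * (1 / 8) by rewrite ler_pM2l.
set u := 2 * pi * x; have uE : u = 2 * (pi * x) by rewrite /u mulrA.
have c0 : 0 <= cos u by apply: cos_ge0_pihalf; apply/andP; split; lra.
have : 0 <= cos (u *+ 2) by apply: cos_ge0_pihalf; rewrite (mulr2n u); apply/andP; split; lra.
rewrite cos_mulr2n (mulr2n (cos u ^+ 2)) => hc.
have := sqr_ge0 (cos u - 1 / 2); set c := cos u in c0 hc * => _.
case: (lerP (1 / 2) c) => // hlt.
have : c ^+ 2 <= c * (1 / 2) by rewrite expr2; apply: ler_wpM2l => //; apply: ltW.
lra.
Qed.

(** Bessel's inequality restricted to the frequencies [1 / dd V]. At such a frequency all [S]
    containing [V] contribute the same exponential sum, so the coefficient is that sum times a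
    signed sum of [1 / dd S]. *)
Lemma mom2_ge D (W : {set {set I}}) :
  (forall V, V \in W -> 8 * h <= dd V)%N -> (0 < h)%N ->
  \sum_(V in W) (h%:R / 2 * \sum_(S in D | V \subset S) (-1) ^+ #|S| / (dd S)%:R) ^+ 2
  <= mom D 2.
Proof.
move=> W8 h0.
have V0 V : V \in W -> V != set0.
  by move=> /W8; apply: contraTneq => ->; rewrite dd0; lia.
rewrite /mom.
have rinj : {in mem W &, forall V U : {set I},
    (Q %| ((dd (~: V))%:Z - (dd (~: U))%:Z)%R)%Z -> V = U}.
  move=> V U VW UW /(dvdz_ddP b_coprime) H; apply/setP => i; have := H i (in_setT _) => Hi.
  apply: negb_inj; rewrite -!in_setC -!(dvd_ddE b_gt1 b_coprime).
  apply/idP/idP => K.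
    by move: Hi; rewrite rpredBl.
  by move: Hi; rewrite rpredBr.
apply: le_trans (@bessel R Q _ (mem W) (fun V => (dd (~: V))%:Z) (fsum D) Q_gt0 rinj).
apply: ler_sum => V VW.
set c := \sum_(S in D | V \subset S) _.
have -> : Q%:R^-1 * \sum_(m < Q) (fsum D m)%:C * zeta Q (- (dd (~: V))%:Z *+ m)
    = c%:C * \sum_(1 <= j < h.+1) zeta (dd V) j%:Z.
  transitivity (\sum_(S in D) (-1) ^+ #|S| * (Q%:R^-1 * \sum_(m < Q)
      (saw (dd S) h m)%:C * zeta Q (- (dd (~: V))%:Z *+ m))).
    under eq_bigr => m _ do rewrite /fsum RtoC_sum mulr_suml.
    rewrite exchange_big mulr_sumr; apply: eq_bigr => S _.
    rewrite mulrCA; congr (_ * _); rewrite mulr_sumr; apply: eq_bigr => m _.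
    by rewrite RtoCM RtoC_sign mulrA.
  rewrite /c RtoC_sum mulr_suml [RHS]big_mkcondr; apply: eq_bigr => S _.
  rewrite saw_coeff ?V0 //; case: ifP => _; rewrite ?mulr0 //.
  by rewrite RtoCM RtoC_sign RtoCV RtoC_nat mulrA.
rewrite Normc.normcM normc_real !exprMn real_normK ?num_real // mulrC.
apply: ler_wpM2l; first exact: sqr_ge0.
rewrite -exprMn; apply: lerXn2r; rewrite ?nnegrE ?normc_ge0 ?divr_ge0 //.
exact/norm_sum_zeta_ge/W8.
Qed.

End FamilyVariance.

Local Close Scope complex_scope.

(** * Products of elements of B *)

Section PowerToolbox.
Variable R : realType.
Implicit Types x y s C : R.

Lemma powR_dom C (e1 e2 : R) : e1 < e2 ->
  exists2 x0, 1 <= x0 & forall x, x0 <= x -> C * x `^ e1 <= x `^ e2.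
Proof.
move=> e12; have d0 : 0 < e2 - e1 by rewrite subr_gt0.
pose C1 := Num.max 1 C.
have C1_ge1 : 1 <= C1 by rewrite le_max lexx.
exists (C1 `^ (e2 - e1)^-1).
  by rewrite -(powRr0 C1) ler_powR // invr_ge0 ltW.
move=> x hx.
have x1 : 1 <= x by apply: le_trans hx; rewrite -(powRr0 C1) ler_powR // invr_ge0 ltW.
have x0 : 0 < x by apply: lt_le_trans x1.
have : C1 <= x `^ (e2 - e1).
  have -> : C1 = (C1 `^ (e2 - e1)^-1) `^ (e2 - e1).
    by rewrite -powRrM mulVf ?gt_eqF // powRr1 // (le_trans _ C1_ge1).
  by apply: ge0_ler_powR; rewrite ?nnegrE ?powR_ge0 ?(ltW d0) ?(ltW x0).
rewrite powRB ?(gt_eqF x0) ?implybT // ler_pdivlMr ?powR_gt0 // => h.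
apply: le_trans h; apply: ler_wpM2r; first exact: powR_ge0.
by rewrite le_max lexx orbT.
Qed.

Lemma near_pinftyP (P : R -> Prop) :
  (\forall x \near +oo, P x) <-> exists2 x0 : R, 1 <= x0 & forall x, x0 <= x -> P x.
Proof.
split=> [[M [_ HM]]|[x0 _ H]].
  exists (Num.max 1 (M + 1)); first by rewrite le_max lexx.
  move=> x; rewrite ge_max => /andP[_ hx]; apply: HM; lra.
by exists x0; split; [exact: num_real | move=> x hx; apply: H; exact: ltW].
Qed.

End PowerToolbox.

Section SievingIndex.
Variables (R : realType) (B : set nat) (alpha : R).
Hypothesis hB : sieving_set R B.
Hypothesis halpha : 0 < alpha < 1.
Hypothesis hindex : has_index (semigroup_gen B) alpha.

Local Notation SB := (semigroup_gen B).

(** The elements of [B] below [L] as a finite family. The cutoff [L] is auxiliary: the bounds below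
    are uniform in it, and sums over [dd S <= y] do not change once [L > y]. *)
Definition Bidx (L : nat) : finType := {i : 'I_L | (i : nat) \in B}.
Definition bval L (i : Bidx L) : nat := \val (\val i).

Lemma B_gt1 (c : nat) : B c -> (1 < c)%N.
Proof. by case: hB => _ h _ _ /h. Qed.

Lemma bval_in L (i : Bidx L) : B (bval i).
Proof. exact: set_mem (valP i). Qed.

Lemma bval_gt1 L (i : Bidx L) : (1 < bval i)%N.
Proof. by apply: B_gt1; apply: bval_in. Qed.

Lemma bval_inj L : injective (@bval L).
Proof. by move=> i j /val_inj /val_inj. Qed.

Lemma bval_coprime L (i j : Bidx L) : i != j -> coprime (bval i) (bval j).
Proof.
case: hB => _ _ h _ ij; apply: h; try exact: bval_in.
by move=> /bval_inj E; rewrite E eqxx in ij.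
Qed.

Lemma bval_surj L (c : nat) : B c -> (c < L)%N -> exists i : Bidx L, bval i = c.
Proof.
move=> Bc cL; have Pc : (Ordinal cL : nat) \in B by exact: mem_set.
by exists (exist (fun i : 'I_L => is_true ((i : nat) \in B)) (Ordinal cL) Pc).
Qed.

Lemma SB_gt0 m : SB m -> (0 < m)%N.
Proof.
case=> s sB ->; elim: s sB => [|c s IH] sB; first by rewrite big_nil.
rewrite big_cons muln_gt0 IH ?andbT; last by move=> x xs; apply: sB; rewrite inE xs orbT.
by apply/ltnW/B_gt1/sB; rewrite mem_head.
Qed.

Lemma SB_M c m : B c -> SB m -> SB (c * m)%N.
Proof.
move=> Bc [s sB ->]; exists (c :: s); last by rewrite big_cons.
by move=> x; rewrite inE => /predU1P[-> //|]; exact: sB.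
Qed.

Section Sets.
Import mathcomp.boot.fintype mathcomp.boot.finset.

Lemma dd_in_SB L (S : {set Bidx L}) : SB (dd (@bval L) S).
Proof.
exists [seq bval i | i <- enum S].
  by move=> c /mapP[i _ ->]; exact: bval_in.
by rewrite /dd big_map big_enum.
Qed.

Lemma index_upper s : alpha < s ->
  exists2 C : R, 0 < C & forall x, 1 <= x -> (count_upto SB x)%:R <= C * x `^ s.
Proof.
move=> als; case: hindex => e e0 /near_pinftyP[x1 x11 H1].
have d0 : 0 < s - alpha by rewrite subr_gt0.
have s0 : 0 <= s by case/andP: halpha => a0 _; apply: ltW; apply: lt_trans als.
have : \forall x \near +oo, `|0 - e x| <= s - alpha.
  by move/cvgrPdist_le: e0; apply.
move=> /near_pinftyP[x2 x21 H2].
pose x3 := Num.max x1 x2.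
exists (1 + (count_upto SB x3)%:R); first by rewrite ltr_wpDr.
move=> x x_ge1; case: (lerP x3 x) => hx.
  move: (hx); rewrite ge_max => /andP[h1 h2].
  rewrite (H1 x) //; have := H2 _ h2; rewrite sub0r normrN => h3.
  apply: le_trans (_ : x `^ s <= _).
    by apply: ler_powR => //; move: h3; rewrite ler_norml => /andP[_]; lra.
  by apply: ler_peMl; [exact: powR_ge0 | rewrite lerDl].
have mono : (count_upto SB x <= count_upto SB x3)%N.
  rewrite /count_upto [X in (_ <= X)%N](big_cat_nat (n := (Num.truncn x).+1)) //= ?leq_addr //.
  by rewrite ltnS; apply: le_truncn; apply: ltW.
apply: le_trans (_ : 1 + (count_upto SB x3)%:R <= _).
  by rewrite -(ler_nat R) in mono; lra.
apply: ler_peMr; first by rewrite addr_ge0.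
by rewrite -(powRr0 x) ler_powR.
Qed.

(** Dyadic decomposition: with [s'] strictly between [alpha] and [s], the block from [2 ^ j] to
    [2 ^ j.+1] contributes at most a constant times [2 ^ (j * (s' - s))], a convergent geometric
    series. *)
Lemma SB_sum_le s : alpha < s -> exists2 Z : R, 0 < Z & forall M : nat,
  \sum_(1 <= m < M | m \in SB) (m%:R : R) `^ (- s) <= Z.
Proof.
move=> als; pose s' := (alpha + s) / 2.
have as' : alpha < s' by rewrite /s'; lra.
have s's : s' < s by rewrite /s'; lra.
have s0 : 0 < s by case/andP: halpha => a0 _; apply: lt_trans als.
have [C C0 HC] := index_upper as'.
pose q : R := 2 `^ (s' - s).
have q0 : 0 <= q by exact: powR_ge0.
have q1 : q < 1.
  have -> : 1 = (2 : R) `^ 0 by rewrite powRr0.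
  by rewrite /q /powR pnatr_eq0 /= ltr_expR mul0r pmulr_llt0 ?ln_gt0 //; lra.
exists (C * 2 `^ s' / (1 - q)).
  by rewrite divr_gt0 ?mulr_gt0 ?powR_gt0 // subr_gt0.
move=> M.
have dy J : \sum_(1 <= m < 2 ^ J | m \in SB) (m%:R : R) `^ (- s) <= C * 2 `^ s' * \sum_(j < J) q ^+ j.
  elim: J => [|J IH]; first by rewrite big_geq // big_ord0 mulr0.
  rewrite (big_cat_nat (n := (2 ^ J)%N)) ?expn_gt0 ?leq_exp2l //= big_ord_recr /= mulrDr.
  apply: lerD => //.
  apply: le_trans (_ : \sum_(2 ^ J <= m < 2 ^ J.+1 | m \in SB) ((2 ^ J)%N%:R : R) `^ (- s) <= _).
    rewrite big_nat_cond [leRHS]big_nat_cond; apply: ler_sum => m /andP[/andP[hm _] _].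
    rewrite !powRN lef_pV2 ?posrE ?powR_gt0 ?ltr0n ?expn_gt0 //; last by apply: leq_trans hm; rewrite expn_gt0.
    by apply: ge0_ler_powR; rewrite ?nnegrE ?ler_nat // ltW.
  have -> : \sum_(2 ^ J <= m < 2 ^ J.+1 | m \in SB) ((2 ^ J)%N%:R : R) `^ (- s)
     = (\sum_(2 ^ J <= m < 2 ^ J.+1 | m \in SB) 1)%N%:R * ((2 ^ J)%N%:R : R) `^ (- s).
    by rewrite natr_sum mulr_suml; apply: eq_bigr => m _; rewrite mul1r.
  apply: le_trans (_ : C * ((2 ^ J.+1)%N%:R `^ s') * ((2 ^ J)%N%:R : R) `^ (- s) <= _).
    apply: ler_wpM2r; first exact: powR_ge0.
    apply: le_trans (HC _ _); last by rewrite ler1n expn_gt0.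
    rewrite ler_nat /count_upto natrK [X in (_ <= X)%N](big_cat_nat (n := (2 ^ J)%N)) /=; last 2 first.
    - by rewrite expn_gt0.
    - by apply: leqW; rewrite leq_exp2l.
    rewrite -[X in (X <= _)%N]add0n leq_add //.
    by rewrite [X in (_ <= X)%N](big_cat_nat (n := (2 ^ J.+1)%N)) ?leq_exp2l //= leq_addr.
  have E2 j : ((2 ^ j)%N%:R : R) = 2 `^ j%:R by rewrite natrX powR_mulrn.
  rewrite !E2 -!powRrM -mulrA -powRD ?pnatr_eq0 ?implybT //.
  rewrite -(powR_mulrn J q0) /q -powRrM -mulrA -powRD ?pnatr_eq0 ?implybT //.
  rewrite le_eqVlt; apply/orP; left; apply/eqP; congr (_ * _ `^ _).
  by rewrite -natr1; ring.
have [J MJ] : exists J, (M <= 2 ^ J)%N by exists M; apply/ltnW/ltn_expl.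
apply: le_trans (_ : \sum_(1 <= m < 2 ^ J | m \in SB) (m%:R : R) `^ (- s) <= _).
  case: M MJ => [|M] MJ; first by rewrite big_geq // sumr_ge0 // => m _; exact: powR_ge0.
  rewrite [leRHS](big_cat_nat (n := M.+1)) //= lerDl sumr_ge0 // => m _; exact: powR_ge0.
apply: le_trans (dy J) _; apply: ler_wpM2l.
  by rewrite mulr_ge0 ?powR_ge0 // ltW.
have := subrX1 q J; set G := \sum_(_ < _) _ => E.
rewrite -[leRHS]mul1r ler_pdivlMr ?subr_gt0 //.
have : 0 <= q ^+ J by exact: exprn_ge0.
have -> : G * (1 - q) = - ((q - 1) * G) by ring.
rewrite -E; lra.
Qed.

(** Distinct [S] give distinct elements [dd S] of the semigroup, so the series over the semigroup
    dominates for every [L]. *)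
Lemma dd_sum_le s : alpha < s -> exists2 Z : R, 0 < Z & forall L,
  \sum_(S : {set Bidx L}) ((dd (@bval L) S)%:R : R) `^ (- s) <= Z.
Proof.
move=> als; have [Z Z0 HZ] := SB_sum_le als; exists Z => // L.
set M := (dd (@bval L) setT).+1.
apply: le_trans (HZ M).
have ddM (S : {set Bidx L}) : (dd (@bval L) S < M)%N.
  by rewrite ltnS; apply: leq_dd; [exact: bval_gt1 | exact: subsetT].
rewrite (partition_big (fun S => Ordinal (ddM S)) xpredT) //=.
rewrite [leRHS](_ : _ = \sum_(m < M | (0 < m)%N && ((m : nat) \in SB)) (m%:R : R) `^ (- s)); last first.
  rewrite -(big_mkord (fun m => (0 < m)%N && (m \in SB)) (fun m => (m%:R : R) `^ (- s))).
  rewrite [RHS]big_ltn_cond //= big_nat_cond [RHS]big_nat_cond; apply: eq_bigl => m.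
  by case: m => [|m] //; rewrite andbT.
rewrite [leRHS]big_mkcond; apply: ler_sum => m _.
have [[S0 /eqP E0]|no] := pselect (exists S, Ordinal (ddM S) == m); last first.
  rewrite big_pred0; last by move=> S; apply/negP => h; apply: no; exists S.
  by case: ifP => _ //; exact: powR_ge0.
rewrite (big_pred1 S0); last first.
  move=> S; apply/idP/eqP => [/eqP|->]; last by rewrite E0.
  rewrite -E0 => /(congr1 val) /=; apply: dd_inj; [exact: bval_gt1 | exact: bval_coprime].
rewrite -E0 /= dd_gt0 /=; last exact: bval_gt1.
by rewrite mem_set //; exact: dd_in_SB.
Qed.

(** Rankin's trick: every counted [S] has [(u / dd S) ^ s >= 1]. *)
Lemma card_dd_rankin s Z : (forall L, \sum_(S : {set Bidx L}) ((dd (@bval L) S)%:R : R) `^ (- s) <= Z) ->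
  0 <= s -> forall L (u : R), 0 <= u ->
  (#|[set S : {set Bidx L} | (dd (@bval L) S)%:R <= u]|)%:R <= Z * u `^ s.
Proof.
move=> HZ s0 L u u0.
apply: le_trans (_ : (\sum_(S : {set Bidx L}) ((dd (@bval L) S)%:R : R) `^ (- s)) * u `^ s <= _); last first.
  by apply: ler_wpM2r => //; exact: powR_ge0.
rewrite mulr_suml -sum1_card natr_sum big_mkcond; apply: ler_sum => S _.
rewrite inE; case: ifP => [h|_]; last by rewrite mulr_ge0 // powR_ge0.
have d0 : (0 : R) < (dd (@bval L) S)%:R by rewrite ltr0n dd_gt0 //; exact: bval_gt1.
rewrite powRN mulrC ler_pdivlMr ?powR_gt0 // mul1r.
by apply: ge0_ler_powR; rewrite ?nnegrE // ltW.
Qed.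

(** Parity of multiplicities: multiplying by [c] toggles its membership in [S], and when [c] leaves
    [S] the completed square moves into [k]. *)
Lemma SB_split L m : SB m -> (m < L)%N ->
  exists S : {set Bidx L}, exists2 k, SB k & m = (dd (@bval L) S * k ^ 2)%N.
Proof.
case=> s sB -> mL.
have sL : forall c, c \in s -> (c < L)%N.
  move=> c cs; apply: leq_ltn_trans mL; apply: dvdn_leq.
    by apply: SB_gt0; exists s.
  by rewrite (big_rem c) //= dvdn_mulr.
elim: s sB sL {mL} => [|c s IH] sB sL.
  by exists set0; exists 1%N; [exists nil; rewrite ?big_nil | rewrite dd0 big_nil].
have [||S [k kSB E]] := IH.
- by move=> x xs; apply: sB; rewrite inE xs orbT.
- by move=> x xs; apply: sL; rewrite inE xs orbT.
have Bc : B c by apply: sB; rewrite mem_head.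
have [i ic] := bval_surj Bc (sL c (mem_head _ _)).
rewrite big_cons E; case iS: (i \in S).
  exists (S :\ i), (c * k)%N; first exact: SB_M.
  have -> : dd (@bval L) S = (c * dd (@bval L) (S :\ i))%N.
    by rewrite /dd (big_setD1 i) //= ic.
  by ring.
exists (i |: S), k => //.
by rewrite /dd big_setU1 ?iS //= ic; ring.
Qed.

(** Write [n = dd S * k ^ 2]. For [k <= z] the number of [S] is bounded by its value at [k = 1]. For
    [k > z] Rankin gives [Z * N ^ s * k ^ (-2 * s)]; one factor [k ^ (- s)] is at most [z ^ (- s)]
    and the other is summed over the semigroup. *)
Lemma count_SB_le L (N z : nat) (s Z Z' : R) : (N < L)%N -> (0 < z)%N -> 0 <= s ->
  (forall L, \sum_(S : {set Bidx L}) ((dd (@bval L) S)%:R : R) `^ (- s) <= Z) ->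
  (forall M : nat, \sum_(1 <= m < M | m \in SB) (m%:R : R) `^ (- s) <= Z') ->
  ((\sum_(1 <= n < N.+1 | n \in SB) 1)%N%:R : R)
  <= z%:R * #|[set S : {set Bidx L} | dd (@bval L) S <= N]%N|%:R
     + Z * Z' * N%:R `^ s * z%:R `^ (- s).
Proof.
move=> NL z0 s0 HZ HZ'; set d := dd (@bval L).
pose A (u : nat) := #|[set S : {set Bidx L} | d S * u ^ 2 <= N]%N|.
have h1 : (\sum_(1 <= n < N.+1 | n \in SB) 1 <= \sum_(1 <= k < N.+1 | k \in SB) A k)%N.
  apply: leq_trans (_ : \sum_(1 <= n < N.+1 | n \in SB) \sum_(1 <= k < N.+1 | k \in SB)
      \sum_(S : {set Bidx L} | d S * k ^ 2 <= N) (n == d S * k ^ 2) <= _)%N.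
    rewrite big_nat_cond [X in (_ <= X)%N]big_nat_cond; apply: leq_sum => n /andP[/andP[n1 nN] nS].
    have [S [k kSB E]] := SB_split (set_mem nS) (leq_trans nN NL).
    have k0 := SB_gt0 kSB.
    have d0 : (0 < d S)%N by apply: dd_gt0; exact: bval_gt1.
    have kN : (k < N.+1)%N.
      rewrite ltnS; rewrite ltnS in nN; apply: leq_trans nN; rewrite E -mulnn mulnA.
      by apply: leq_pmull; rewrite muln_gt0 d0.
    rewrite big_mkcond (bigD1_seq k) /= ?iota_uniq ?mem_index_iota ?k0 ?kN //=.
    rewrite mem_set // (bigD1 S) /=; last by rewrite -ltnS -E.
    by rewrite -E eqxx.
  rewrite exchange_big; apply: leq_sum => k _; rewrite exchange_big /A -sum1_card.
  rewrite [X in (_ <= X)%N](eq_bigl (fun S => d S * k ^ 2 <= N)%N); last by move=> S; rewrite inE.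
  apply: leq_sum => S _; rewrite big_mkcond /=.
  have [hin|hout] := boolP ((d S * k ^ 2)%N \in index_iota 1 N.+1).
    rewrite (bigD1_seq (d S * k ^ 2)%N) ?iota_uniq //= eqxx big1 ?addn0; first by case: ifP.
    by move=> n /negbTE ->; case: ifP.
  rewrite big_nat_cond big1 // => n /andP[nin _]; case: ifP => // _.
  by case: eqP => // E; rewrite -E mem_index_iota nin in hout.
have A_le k : (0 < k)%N -> (A k)%:R <= Z * (N%:R `^ s * (k%:R : R) `^ (- s) ^+ 2).
  move=> k0.
  have k0r : (0 : R) < k%:R by rewrite ltr0n.
  have -> : A k = #|[set S : {set Bidx L} | (d S)%:R <= N%:R / (k%:R ^+ 2) :> R]|.
    rewrite /A; apply: eq_card => S; rewrite !inE ler_pdivlMr ?exprn_gt0 //.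
    by rewrite -natrX -natrM ler_nat.
  apply: le_trans (card_dd_rankin HZ s0 _ _) _; first by rewrite divr_ge0 // exprn_ge0.
  rewrite powRM ?invr_ge0 ?exprn_ge0 //; apply: ler_wpM2l.
    by apply: le_trans (HZ 0%N); apply: sumr_ge0 => S _; exact: powR_ge0.
  apply: ler_wpM2l; first exact: powR_ge0.
  rewrite -(@powR_invn R k%:R 2) // -(@powR_mulrn R _ 2) ?powR_ge0 // -!powRrM.
  by rewrite le_eqVlt; apply/orP; left; apply/eqP; congr (_ `^ _); ring.
apply: le_trans (_ : (\sum_(1 <= k < N.+1 | k \in SB) A k)%N%:R <= _).
  by rewrite ler_nat.
rewrite (bigID (fun k => k <= z)%N) /= natrD; apply: lerD.
  rewrite -natrM ler_nat.
  apply: leq_trans (_ : \sum_(1 <= k < N.+1 | k <= z) #|[set S : {set Bidx L} | d S <= N]| <= _)%N.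
    rewrite big_nat_cond [X in (_ <= X)%N]big_nat_cond [X in (_ <= X)%N]big_mkcond [X in (X <= _)%N]big_mkcond.
    apply: leq_sum => k _; case: ifP => [/andP[/andP[k1 kN] /andP[_ kz]]|_ //].
    rewrite k1 kN kz /=; apply: subset_leq_card; apply/subsetP => S; rewrite !inE.
    by apply: leq_trans; apply: leq_pmulr; rewrite expn_gt0 k1.
  apply: leq_trans (_ : \sum_(1 <= k < (N + z).+1 | k < z.+1) #|[set S : {set Bidx L} | d S <= N]| <= _)%N.
    by rewrite [X in (_ <= X)%N](big_cat_nat (n := N.+1)) ?ltnS ?leq_addr //= leq_addr.
  rewrite -(big_nat_widen 1 z.+1 (N + z).+1 xpredT) ?ltnS ?leq_addl //.
  by rewrite sum_nat_const_nat subn1.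
have Z_ge0 : 0 <= Z by apply: le_trans (HZ 0%N); apply: sumr_ge0 => S _; exact: powR_ge0.
rewrite natr_sum.
apply: le_trans (_ : \sum_(1 <= k < N.+1 | k \in SB) (Z * N%:R `^ s * z%:R `^ (- s)) * (k%:R : R) `^ (- s) <= _).
  rewrite big_nat_cond [leRHS]big_nat_cond [leRHS]big_mkcond [leLHS]big_mkcond.
  apply: ler_sum => k _; case: ifP => [/andP[/andP[k1 kN] /andP[kS kz]]|_]; last first.
    by case: ifP => _ //; rewrite !mulr_ge0 // powR_ge0.
  rewrite k1 kN kS /=; apply: le_trans (A_le k k1) _.
  rewrite -!mulrA; apply: ler_wpM2l => //; apply: ler_wpM2l; first exact: powR_ge0.
  rewrite expr2; apply: ler_wpM2r; first exact: powR_ge0.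
  rewrite !powRN lef_pV2 ?posrE ?powR_gt0 ?ltr0n //.
  by apply: ge0_ler_powR; rewrite ?nnegrE ?ler_nat //; apply: ltnW; rewrite ltnNge.
rewrite -mulr_sumr.
have -> : Z * Z' * N%:R `^ s * z%:R `^ (- s) = Z * N%:R `^ s * z%:R `^ (- s) * Z' by ring.
by apply: ler_wpM2l; rewrite ?HZ' // !mulr_ge0 // powR_ge0.
Qed.

(* Every element of the semigroup is [dd S * k ^ 2] with [k] in the semigroup, and
   large [k] contribute little. *)
Lemma index_lower eta : 0 < eta -> exists2 x0 : R, 1 <= x0 & forall x L, x0 <= x ->
  (Num.truncn x < L)%N ->
  x `^ (alpha - eta) <= #|[set S : {set Bidx L} | (dd (@bval L) S)%:R <= x :> R]|%:R.
Proof.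
move=> eta0; have /andP[a0 a1] := halpha.
(* The squares are cut at [z] of size [x ^ th]. The part beyond is [x ^ (s - s * th)] with
   [s = alpha + dl], and [dl = alpha * th / 4] keeps this below the count [x ^ (alpha - dl)];
   dividing by [z] then loses only [th] in the exponent. *)
pose th := eta / 4; pose dl := alpha * th / 4.
have th0 : 0 < th by rewrite divr_gt0.
have ath0 : 0 < alpha * th by rewrite mulr_gt0.
have athl : alpha * th <= th by rewrite ler_piMl // ltW.
have dl0 : 0 < dl by rewrite divr_gt0.
have dlE : 4 * dl = alpha * th by rewrite /dl; lra.
have thE : 4 * th = eta by rewrite /th; lra.
have dlth : 0 < dl * th by rewrite mulr_gt0.
have hs3 : (alpha + dl) - (alpha + dl) * th < alpha - dl by rewrite mulrDl; move: dl dlE dlth {dl0} => dl' *; lra.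
have hs4 : alpha - eta < alpha - dl - th by lra.
have als : alpha < alpha + dl by rewrite ltrDl.
have s0 : 0 <= alpha + dl by lra.
have [Z Z0 HZ] := dd_sum_le als; have [Z' Z'0 HZ'] := SB_sum_le als.
set s := alpha + dl in als s0 HZ HZ'.
case: hindex => e e0 /near_pinftyP[x1 x11 H1].
have : \forall x \near +oo, `|0 - e x| <= dl by move/cvgrPdist_le: e0; apply.
move=> /near_pinftyP[x2 x21 H2].
have [x3 x31 H3] := @powR_dom R (2 * (Z * Z')) (s - s * th) (alpha - dl) hs3.
have [x4 x41 H4] := @powR_dom R 4 (alpha - eta) (alpha - dl - th) hs4.
exists (Num.max (Num.max x1 x2) (Num.max x3 x4)); first by rewrite !le_max x11.
move=> x L; rewrite !ge_max => /andP[/andP[h1 h2] /andP[h3 h4]] NL.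
have xge1 : 1 <= x by apply: le_trans h1.
have xgt0 : 0 < x by apply: lt_le_trans xge1.
pose z := (Num.truncn (x `^ th)).+1.
have xth1 : 1 <= x `^ th by rewrite -(powRr0 x) ler_powR // ltW.
have z_ge : x `^ th <= z%:R by apply/ltW/truncnS_gt.
have z_le : z%:R <= 2 * x `^ th.
  have : (Num.truncn (x `^ th))%:R <= x `^ th by rewrite truncn_le powR_ge0.
  by rewrite /z -natr1; lra.
have N_le : (Num.truncn x)%:R <= x by rewrite truncn_le ?ltW.
have := @count_SB_le L (Num.truncn x) z s Z Z' NL isT s0 HZ HZ'.
rewrite -/(count_upto SB x) (H1 _ h1).
set A := #|[set S : {set Bidx L} | dd (@bval L) S <= Num.truncn x]%N|.
have -> : #|[set S : {set Bidx L} | (dd (@bval L) S)%:R <= x]| = A.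
  rewrite /A; apply: eq_card => S; rewrite !inE -truncn_ge_nat // ltW //.
move=> hmain.
have l1 : x `^ (alpha - dl) <= x `^ (alpha + e x).
  apply: ler_powR => //; have := H2 _ h2; rewrite sub0r normrN ler_norml => /andP[]; lra.
have l2 : Z * Z' * (Num.truncn x)%:R `^ s * z%:R `^ (- s) <= x `^ (alpha - dl) / 2.
  have := H3 _ h3.
  have -> : x `^ (s - s * th) = x `^ s * (x `^ th) `^ (- s).
    by rewrite -powRrM -powRD ?(gt_eqF xgt0) ?implybT //; congr (_ `^ _); ring.
  move=> h5; apply: le_trans (_ : Z * Z' * (x `^ s * (x `^ th) `^ (- s)) <= _); last by lra.
  rewrite -mulrA; apply: ler_wpM2l; first by rewrite mulr_ge0 // ltW.
  apply: ler_pM; rewrite ?powR_ge0 //.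
    by apply: ge0_ler_powR; rewrite ?nnegrE // ltW.
  rewrite !powRN lef_pV2 ?posrE ?powR_gt0 // ?ltr0n //.
  by apply: ge0_ler_powR; rewrite ?nnegrE ?powR_ge0.
have l3 : z%:R * A%:R <= 2 * x `^ th * A%:R by apply: ler_wpM2r.
have l4 : x `^ (alpha - dl) <= 4 * x `^ th * A%:R by lra.
have l5 : 4 * x `^ (alpha - eta) <= x `^ (alpha - dl) / x `^ th.
  apply: le_trans (H4 _ h4) _.
  by rewrite (@powRB R x (alpha - dl) th) ?(gt_eqF xgt0) ?implybT.
rewrite -(ler_pM2l (_ : 0 < 4)) //; apply: le_trans l5 _.
rewrite ler_pdivrMr ?powR_gt0 //; apply: le_trans l4 _.
by rewrite -!mulrA (mulrC A%:R).
Qed.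

End Sets.
End SievingIndex.

(** * Euler products and their tails *)

Section ProductFormula.
Import mathcomp.boot.fintype mathcomp.boot.finset.
Variables (R : realType) (I : finType).

Lemma sum_supset (x : I -> R) (V : {set I}) :
  \sum_(S : {set I} | V \subset S) \prod_(i in S) x i
  = \prod_(i in V) x i * \prod_(i | i \notin V) (1 + x i).
Proof.
transitivity (\prod_i (x i + (i \notin V)%:R)).
  rewrite bigA_distr big_mkcond /=; apply: eq_bigr => S _; case: ifP => [VS|/negbT/subsetPn[i iV iS]].
    rewrite big_mkcond; apply: eq_bigr => i _; case: ifP => // iS.
    have -> // : i \notin V; by apply/negP => /(subsetP VS); rewrite iS.
  by rewrite (bigD1 i) //= (negbTE iS) iV mul0r.
rewrite (bigID (mem V)) /=; congr (_ * _); apply: eq_bigr => i iV.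
  by rewrite iV addr0.
by rewrite iV addrC.
Qed.

Lemma sum_prod_set (x : I -> R) : \sum_(S : {set I}) \prod_(i in S) x i = \prod_i (1 + x i).
Proof.
transitivity (\sum_(S : {set I} | set0 \subset S) \prod_(i in S) x i).
  by apply: eq_bigl => S; rewrite sub0set.
by rewrite sum_supset big_set0 mul1r; apply: eq_bigl => i; rewrite inE.
Qed.

Lemma prod_signed (b : I -> nat) (S : {set I}) :
  \prod_(i in S) - ((b i)%:R : R)^-1 = (-1) ^+ #|S| / (dd b S)%:R.
Proof.
rewrite /dd natr_prod -prodfV -prodr_const -big_split.
by apply: eq_bigr => i _; rewrite /= mulN1r.
Qed.

End ProductFormula.

Section Tails.
Import mathcomp.boot.fintype mathcomp.boot.finset.
Variables (R : realType) (B : set nat) (alpha : R).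
Hypothesis hB : sieving_set R B.
Hypothesis halpha : 0 < alpha < 1.
Hypothesis hindex : has_index (semigroup_gen B) alpha.
Local Notation Bidx := (Bidx B).
Local Notation ddB L := (dd (@bval B L)).

Let ddB_gt0 L (S : {set Bidx L}) : (0 : R) < (ddB L S)%:R.
Proof. by rewrite ltr0n dd_gt0 //; exact: (bval_gt1 hB). Qed.

(** Every factor of [dd S <= y] is at most [y], hence already available below [L]. *)
Lemma dd_widen L L' (y : nat) (G : nat -> nat -> R) : (y < L)%N -> (L <= L')%N ->
  \sum_(S : {set Bidx L'} | (ddB L' S <= y)%N) G (ddB L' S) #|S|
  = \sum_(S : {set Bidx L} | (ddB L S <= y)%N) G (ddB L S) #|S|.
Proof.
move=> yL LL'.
have wP (i : Bidx L) : (widen_ord LL' (\val i) : nat) \in B by exact: (valP i).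
pose w (i : Bidx L) : Bidx L' := exist _ (widen_ord LL' (\val i)) (wP i).
have wE i : bval (w i) = bval i by [].
have winj : injective w by move=> i j E; apply: (@bval_inj B L); rewrite -!wE E.
have wcard (S : {set Bidx L}) : #|w @: S| = #|S| by rewrite card_imset.
have wdd (S : {set Bidx L}) : ddB L' (w @: S) = ddB L S.
  by rewrite /dd big_imset //; move=> i j _ _; exact: winj.
rewrite (reindex_onto (fun S : {set Bidx L} => w @: S) (fun S' => w @^-1: S')) /=.
  apply: eq_big => [S|S _]; rewrite wdd ?wcard //.
  have -> : w @^-1: (w @: S) = S by apply/setP => i; rewrite inE mem_imset.
  by rewrite eqxx andbT.
move=> S' S'y; apply/setP => i'; apply/imsetP/idP => [[i iS ->]|iS'].
  by rewrite inE in iS.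
have iL : (bval i' < L)%N.
  apply: leq_ltn_trans yL; apply: leq_trans S'y; apply: dvdn_leq.
    by apply: dd_gt0; exact: (bval_gt1 hB).
  exact: dvdn_b_dd.
have [i iE] := bval_surj (bval_in i') iL.
have wi : w i = i' by apply: (@bval_inj B L'); rewrite wE.
by exists i; rewrite ?inE wi.
Qed.

Lemma dd_tail s Z : s <= 1 -> (forall L, \sum_(S : {set Bidx L}) ((ddB L S)%:R : R) `^ (- s) <= Z) ->
  forall L (Y : R), 0 < Y ->
  \sum_(S : {set Bidx L} | Y < (ddB L S)%:R) ((ddB L S)%:R : R)^-1 <= Z * Y `^ (s - 1).
Proof.
move=> s1 HZ L Y Y0.
apply: le_trans (_ : (\sum_(S : {set Bidx L}) ((ddB L S)%:R : R) `^ (- s)) * Y `^ (s - 1) <= _); last first.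
  by apply: ler_wpM2r => //; exact: powR_ge0.
rewrite mulr_suml big_mkcond; apply: ler_sum => S _; case: ifP => h; last by rewrite mulr_ge0 // powR_ge0.
have d0 := ddB_gt0 S; set d : R := (ddB L S)%:R in d0 h *.
have -> : d^-1 = d `^ (- s) * d `^ (s - 1).
  by rewrite -powRD ?(gt_eqF d0) ?implybT // -powR_inv1 ?ltW //; congr (_ `^ _); ring.
apply: ler_wpM2l; first exact: powR_ge0.
rewrite -(opprB 1 s) !powRN lef_pV2 ?posrE ?powR_gt0 //.
by apply: ge0_ler_powR; rewrite ?nnegrE ?subr_ge0 // ltW.
Qed.

Lemma exp2_card_pow (q : nat) L (S : {set Bidx L}) : (0 < q)%N ->
  (2 ^ #|S|)%N%:R <= (((2 ^ q) ^ (2 ^ q))%N%:R * (ddB L S)%:R : R) `^ (q%:R^-1).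
Proof.
move=> q0; have := exp2_card_le (@bval_gt1 R B hB L) (@bval_coprime R B hB L) q S.
rewrite -(ler_nat R) natrM => h.
have q0r : (0 : R) < q%:R by rewrite ltr0n.
have -> : (2 ^ #|S|)%N%:R = ((2 ^ (q * #|S|))%N%:R : R) `^ (q%:R^-1).
  by rewrite mulnC expnM [in RHS]natrX -(@powR_mulrn R _ q) // -powRrM mulfV ?gt_eqF // powRr1.
by apply: ge0_ler_powR; rewrite ?nnegrE ?mulr_ge0 ?invr_ge0.
Qed.

(** Pairs are grouped by their union [W], at most [(2 ^ #|W|) ^ 2] pairs each. The divisor bound
    absorbs this count into [dd W ^ (2 / q)] with [2 / q <= beta - s], and Rankin finishes with
    exponent [s]. *)
Lemma pair_tail beta : alpha < beta < 1 -> exists2 C : R, 0 < C & forall L (Y : R), 1 <= Y ->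
  \sum_(S : {set Bidx L} | Y < (ddB L S)%:R) \sum_(T : {set Bidx L} | Y < (ddB L T)%:R)
    ((ddB L (S :|: T))%:R : R)^-1 <= C * Y `^ (beta - 1).
Proof.
move=> /andP[ab b1]; pose s := (alpha + beta) / 2.
have as_ : alpha < s by rewrite /s; lra.
have sb : s < beta by rewrite /s; lra.
have bs0 : 0 < beta - s by rewrite subr_gt0.
have [Z Z0 HZ] := dd_sum_le hB halpha hindex as_.
pose q := (Num.truncn (2 / (beta - s))).+1.
have q0 : (0 < q)%N by [].
have q0r : (0 : R) < q%:R by rewrite ltr0n.
have qle : 2 / q%:R <= beta - s :> R.
  rewrite ler_pdivrMr // mulrC -ler_pdivrMr //; exact/ltW/truncnS_gt.
pose Cq : R := ((2 ^ q) ^ (2 ^ q))%N%:R.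
have Cq0 : 0 < Cq by rewrite ltr0n !expn_gt0.
exists ((Cq `^ (q%:R^-1)) ^+ 2 * Z).
  by rewrite mulr_gt0 // exprn_gt0 // powR_gt0.
move=> L Y Y1; have Y0 : 0 < Y by apply: lt_le_trans Y1.
apply: le_trans (_ : \sum_(W : {set Bidx L} | Y < (ddB L W)%:R)
    ((2 ^ #|W|)%N%:R ^+ 2) * ((ddB L W)%:R : R)^-1 <= _).
  rewrite pair_big_dep /=.
  rewrite (partition_big (fun p : {set Bidx L} * {set Bidx L} => p.1 :|: p.2)
     (fun W : {set Bidx L} => Y < (ddB L W)%:R)) /=; last first.
    move=> [S T] /= /andP[YS _]; apply: lt_le_trans YS _; rewrite ler_nat.
    by apply: leq_dd; [exact: (bval_gt1 hB) | exact: subsetUl].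
  apply: ler_sum => W YW.
  apply: le_trans (_ : \sum_(p : {set Bidx L} * {set Bidx L} | (p.1 \subset W) && (p.2 \subset W))
      ((ddB L W)%:R : R)^-1 <= _).
    rewrite big_mkcond [leRHS]big_mkcond; apply: ler_sum => -[S T] _ /=.
    case: ifP => [/andP[_ /eqP <-]|_]; first by rewrite subsetUl subsetUr.
    by case: ifP => _ //; rewrite invr_ge0 ltW.
  rewrite sumr_const -[leLHS]mulr_natl; apply: ler_wpM2r; first by rewrite invr_ge0 ltW.
  rewrite -natrX ler_nat -mulnn.
  rewrite (eq_card (B := setX (powerset W) (powerset W))) ?cardsX ?card_powerset // => -[S T].
  by rewrite !inE.
apply: le_trans (_ : (Cq `^ (q%:R^-1)) ^+ 2 * \sum_(W : {set Bidx L} | Y < (ddB L W)%:R)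
    ((ddB L W)%:R : R) `^ (2 / q%:R - 1) <= _).
  rewrite mulr_sumr; apply: ler_sum => W _.
  have d0 := ddB_gt0 W; set d : R := (ddB L W)%:R in d0 *.
  have -> : d `^ (2 / q%:R - 1) = (d `^ (q%:R^-1)) ^+ 2 * d^-1.
    rewrite -powR_mulrn ?powR_ge0 // -powRrM -[d^-1]powR_inv1 ?ltW // -powRD ?(gt_eqF d0) ?implybT //.
    by congr (_ `^ _); ring.
  rewrite mulrA; apply: ler_wpM2r; first by rewrite invr_ge0 ltW.
  have := exp2_card_pow W q0; rewrite powRM ?(ltW Cq0) ?(ltW d0) // => hW.
  by rewrite -exprMn; apply: lerXn2r; rewrite ?nnegrE ?mulr_ge0 ?powR_ge0.
rewrite -mulrA; apply: ler_wpM2l; first by rewrite exprn_ge0 // powR_ge0.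
apply: le_trans (_ : (\sum_(W : {set Bidx L}) ((ddB L W)%:R : R) `^ (- s)) * Y `^ (beta - 1) <= _); last first.
  by apply: ler_wpM2r => //; exact: powR_ge0.
rewrite mulr_suml big_mkcond; apply: ler_sum => W _; case: ifP => h; last by rewrite mulr_ge0 // powR_ge0.
have d0 := ddB_gt0 W; set d : R := (ddB L W)%:R in d0 h *.
have d1 : 1 <= d by apply: ltW; apply: le_lt_trans h.
apply: le_trans (_ : d `^ (beta - s - 1) <= _); first by apply: ler_powR => //; lra.
have -> : d `^ (beta - s - 1) = d `^ (- s) * d `^ (beta - 1).
  by rewrite -powRD ?(gt_eqF d0) ?implybT //; congr (_ `^ _); ring.
apply: ler_wpM2l; first exact: powR_ge0.
rewrite -(opprB 1 beta) !powRN lef_pV2 ?posrE ?powR_gt0 //.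
by apply: ge0_ler_powR; rewrite ?nnegrE ?subr_ge0 // ltW.
Qed.

Definition Bprod L : R := \prod_(i : Bidx L) (1 - (bval i)%:R^-1).

Lemma Bprod_nat L : \prod_(0 <= c < L | c \in B) (1 - (c%:R : R)^-1) = Bprod L.
Proof.
rewrite big_mkord /Bprod.
rewrite (reindex_omap (fun i : Bidx L => \val i) (fun i : 'I_L => insub i)) /=; last first.
  by move=> i iB; rewrite insubT.
apply: eq_bigl => i; rewrite valK eqxx andbT; exact: (valP i).
Qed.

Lemma Bprod_sum L : Bprod L = \sum_(S : {set Bidx L}) (-1) ^+ #|S| / (ddB L S)%:R.
Proof.
rewrite /Bprod -sum_prod_set; apply: eq_bigr => S _; exact: prod_signed.
Qed.

Lemma bvalV_le L (i : Bidx L) : 0 < ((bval i)%:R : R)^-1 <= 1 / 2.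
Proof.
have h : (2 : R) <= (bval i)%:R by rewrite ler_nat; exact: (bval_gt1 hB).
rewrite invr_gt0; apply/andP; split; first lra.
by rewrite div1r lef_pV2 ?posrE //; lra.
Qed.

Lemma Bprod_itv L : 0 <= Bprod L <= 1.
Proof.
apply/andP; split.
  by apply: prodr_ge0 => i _; have := bvalV_le i => /andP[]; lra.
apply: le_trans (_ : \prod_(i : Bidx L) 1 <= _); last by rewrite big1.
by apply: ler_prod => i _; have := bvalV_le i => /andP[]; lra.
Qed.

Lemma Bprod_cvg :
  ((fun n => \prod_(0 <= c < n | c \in B) (1 - (c%:R : R)^-1)) @ \oo --> MB R B)%classic.
Proof.
set u := fun n => _.
have uE n : u n = Bprod n by exact: Bprod_nat.
have : cvgn u; last by [].
apply: nonincreasing_is_cvgn; last first.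
  by exists 0 => _ [n _ <-]; rewrite uE; case/andP: (Bprod_itv n).
apply/nonincreasing_seqP => n; rewrite /u big_mkcond big_nat_recr //= -big_mkcond /= -/(u n).
have u0 : 0 <= u n by rewrite uE; case/andP: (Bprod_itv n).
case: ifP => nB; last by rewrite mulr1.
by apply: ler_piMr => //; rewrite gerBl invr_ge0.
Qed.

Lemma MB_approx s Z : alpha < s -> s <= 1 ->
  (forall L, \sum_(S : {set Bidx L}) ((ddB L S)%:R : R) `^ (- s) <= Z) ->
  forall L (Y : nat), (0 < Y)%N -> (Y < L)%N ->
  `|MB R B - \sum_(S : {set Bidx L} | (ddB L S <= Y)%N) (-1) ^+ #|S| / (ddB L S)%:R|
  <= Z * Y%:R `^ (s - 1).
Proof.
move=> als s1 HZ L Y Y0 YL; set c := \sum_(S | _) _.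
have : ((fun n => `|(\prod_(0 <= c < n | c \in B) (1 - (c%:R : R)^-1)) - c|) @ \oo --> `|MB R B - c|)%classic.
  by apply: cvg_norm; apply: cvgB; [exact: Bprod_cvg | exact: cvg_cst].
move=> hcv; rewrite -(cvg_lim _ hcv) //; apply: limr_le; first by apply/cvg_ex; exists `|MB R B - c|.
near=> n; have nL : (L <= n)%N by near: n; exact: nbhs_infty_ge.
rewrite Bprod_nat Bprod_sum (bigID (fun S => ddB n S <= Y)%N) /=.
rewrite (dd_widen (fun d k => (-1) ^+ k / d%:R) YL nL) -/c addrAC subrr add0r.
apply: le_trans (ler_norm_sum _ _ _) _.
have := @dd_tail s Z s1 HZ n Y%:R; rewrite ltr0n => /(_ Y0); apply: le_trans.
rewrite [leRHS](eq_bigl (fun S => ~~ (ddB n S <= Y)%N)); last by move=> S; rewrite -ltnNge ltr_nat.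
apply: ler_sum => S _; rewrite normrM normrX normrN1 expr1n mul1r ger0_norm // invr_ge0 //.
Unshelve. all: by end_near. Qed.

Lemma MB_itv : 0 <= MB R B <= 1.
Proof.
apply/andP; split.
  rewrite -(cvg_lim _ Bprod_cvg) //; apply: limr_ge; first by apply/cvg_ex; exists (MB R B); exact: Bprod_cvg.
  by near=> n; rewrite Bprod_nat; case/andP: (Bprod_itv n).
rewrite -(cvg_lim _ Bprod_cvg) //; apply: limr_le; first by apply/cvg_ex; exists (MB R B); exact: Bprod_cvg.
by near=> n; rewrite Bprod_nat; case/andP: (Bprod_itv n).
Unshelve. all: by end_near. Qed.

(** Inclusion-exclusion, by expanding the product of [1 - [b divides m]]. The condition [m < L]
    ensures that all elements of [B] that can divide [m] are in the family. *)
Lemma Bfree_indicator L m : (0 < m)%N -> (m < L)%N ->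
  ((m \in Bfree B)%:R : R) = \sum_(S : {set Bidx L}) (-1) ^+ #|S| * (ddB L S %| m)%N%:R.
Proof.
move=> m0 mL.
transitivity (\prod_(i : Bidx L) (1 + - ((bval i %| m)%N%:R : R))).
  have [mB|mB] := boolP (m \in Bfree B).
    case: (set_mem mB) => _ H; rewrite big1 // => i _.
    by rewrite (negbTE (H _ (bval_in i))) subr0.
  have [i iE] : exists i : Bidx L, (bval i %| m)%N.
    apply: contrapT => no; move/negP: mB; apply; apply: mem_set; split => // c Bc.
    apply/negP => cm; apply: no.
    have [i ic] := bval_surj Bc (leq_ltn_trans (dvdn_leq m0 cm) mL).
    by exists i; rewrite ic.
  by rewrite (bigD1 i) //= iE subrr mul0r.
rewrite -sum_prod_set; apply: eq_bigr => S _.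
have -> : \prod_(i in S) - ((bval i %| m)%N%:R : R) = (-1) ^+ #|S| * \prod_(i in S) (bval i %| m)%N%:R.
  by rewrite -prodr_const -big_split; apply: eq_bigr => i _; rewrite /= mulN1r.
congr (_ * _); have [/(dvdn_ddP (@bval_coprime R B hB L)) H|] := boolP (ddB L S %| m)%N.
  by rewrite big1 // => i iS; rewrite H.
have [[i iS im]|no] := pselect (exists2 i, i \in S & ~~ (bval i %| m)%N).
  by move=> _; rewrite (bigD1 i) //= (negbTE im) mul0r.
move=> /negP[]; apply/(dvdn_ddP (@bval_coprime R B hB L)) => i iS.
by apply: contrapT => /negP im; apply: no; exists i.
Qed.

Lemma NBfree_hits L n (H : R) : 0 <= H -> (n + Num.truncn H < L)%N ->
  ((NBfree B n H)%:R : R) = \sum_(S : {set Bidx L}) (-1) ^+ #|S| * (hits (ddB L S) (Num.truncn H) n)%:R.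
Proof.
move=> H0 nL; set h := Num.truncn H in nL *.
have -> : NBfree B n H = (\sum_(1 <= j < h.+1) ((n + j)%N \in Bfree B))%N.
  rewrite /NBfree; have -> : Num.truncn (n%:R + H) = (n + h)%N.
    apply: truncn_def; have /andP[h1 h2] := truncn_itv H0; rewrite natrD lerD2l h1 /=.
    by rewrite -addnS natrD ltrD2l.
  rewrite -[n.+1]add1n big_addn; have -> : ((n + h).+1 - n = h.+1)%N by lia.
  by rewrite big_mkcond; apply: eq_bigr => j _; rewrite addnC; case: ifP.
rewrite natr_sum.
transitivity (\sum_(1 <= j < h.+1) \sum_(S : {set Bidx L}) (-1) ^+ #|S| * ((ddB L S %| n + j)%N%:R : R)).
  rewrite big_nat_cond [RHS]big_nat_cond; apply: eq_bigr => j /andP[/andP[j1 jh] _].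
  by apply: Bfree_indicator; lia.
rewrite exchange_big; apply: eq_bigr => S _.
by rewrite -mulr_sumr /hits natr_sum.
Qed.

End Tails.

(** * Mean-square truncation *)

Section Averages.
Variable R : realType.
Implicit Types (u v : nat -> R) (N : nat).

Definition avg N u : R := N%:R^-1 * \sum_(1 <= n < N.+1) u n.

Lemma le_avg N u v : (forall n, (0 < n <= N)%N -> u n <= v n) -> avg N u <= avg N v.
Proof.
move=> h; apply: ler_wpM2l; first by rewrite invr_ge0.
by rewrite big_nat [leRHS]big_nat; apply: ler_sum => n; apply: h.
Qed.

Lemma avgD N u v : avg N (fun n => u n + v n) = avg N u + avg N v.
Proof. by rewrite /avg big_split mulrDr. Qed.

Lemma avgZ N c u : avg N (fun n => c * u n) = c * avg N u.
Proof. by rewrite /avg -mulr_sumr mulrCA. Qed.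

Lemma avg_cst N c : (0 < N)%N -> avg N (fun=> c) = c.
Proof.
move=> N0; rewrite /avg sumr_const_nat subn1 /= -[X in _ * X]mulr_natl mulrA mulVf ?mul1r //.
by rewrite pnatr_eq0 -lt0n.
Qed.

Lemma avg_ge0 N u : (forall n, 0 <= u n) -> 0 <= avg N u.
Proof. by move=> h; rewrite /avg mulr_ge0 ?invr_ge0 // sumr_ge0. Qed.

Lemma eq_avg N u v : u =1 v -> avg N u = avg N v.
Proof. by move=> h; rewrite /avg; congr (_ * _); apply: eq_bigr => n _; apply: h. Qed.

Lemma sqr_sum_le (h : nat) (x : nat -> R) :
  (\sum_(1 <= j < h.+1) x j) ^+ 2 <= h%:R * \sum_(1 <= j < h.+1) x j ^+ 2.
Proof.
rewrite !big_add1 /= !big_mkord.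
have E : h%:R * (\sum_(i < h) x i.+1 ^+ 2) - (\sum_(i < h) x i.+1) ^+ 2
   = 2^-1 * \sum_(i < h) \sum_(j < h) (x i.+1 - x j.+1) ^+ 2.
  have E1 : \sum_(i < h) \sum_(j < h) (x i.+1 - x j.+1) ^+ 2
     = \sum_(i < h) \sum_(j < h) (x i.+1 ^+ 2 + x j.+1 ^+ 2)
       - 2 * \sum_(i < h) \sum_(j < h) (x i.+1 * x j.+1).
    rewrite mulr_sumr -sumrB; apply: eq_bigr => i _; rewrite mulr_sumr -sumrB.
    by apply: eq_bigr => j _; ring.
  rewrite E1.
  have -> : \sum_(i < h) \sum_(j < h) (x i.+1 ^+ 2 + x j.+1 ^+ 2)
     = 2 * (h%:R * \sum_(i < h) x i.+1 ^+ 2).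
    under eq_bigr do rewrite big_split /= sumr_const card_ord.
    set S := \sum_(i < h) x i.+1 ^+ 2; rewrite big_split /= sumr_const card_ord sumrMnl -/S.
    by rewrite -(mulr_natl S h); ring.
  by rewrite -big_distrlr /= -expr2; field.
rewrite -subr_ge0 E mulr_ge0 ?invr_ge0 // sumr_ge0 // => i _; apply: sumr_ge0 => j _.
exact: sqr_ge0.
Qed.

Lemma count_dvd_le (d j N : nat) : (0 < d)%N -> (0 < N)%N ->
  \sum_(1 <= n < N.+1) ((d %| n + j)%N%:R : R) <= 2 * (N + j)%N%:R / d%:R.
Proof.
move=> d0 N0; have d0r : (0 : R) < d%:R by rewrite ltr0n.
have [dN|dN] := leqP d (N + j); last first.
  rewrite big_nat big1; first by rewrite divr_ge0 // mulr_ge0.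
  move=> n /andP[n1 nN]; case: (boolP (d %| n + j)%N) => // /dvdn_leq; lia.
have := @sum_eqmod_le R d (j * d.-1) N d0.
have -> : (\sum_(1 <= m < N.+1) (m == j * d.-1 %[mod d]))%N%:R = \sum_(1 <= n < N.+1) ((d %| n + j)%N%:R : R).
  by rewrite natr_sum; apply: eq_bigr => n _; rewrite dvdn_addE.
rewrite ler_norml => /andP[_ h].
have h1 : 1 <= (N + j)%N%:R / d%:R :> R by rewrite ler_pdivlMr // mul1r ler_nat.
have h2 : N%:R / d%:R <= (N + j)%N%:R / d%:R :> R.
  by apply: ler_wpM2r; rewrite ?invr_ge0 ?ler_nat ?leq_addr.
rewrite -mulrA; lra.
Qed.

End Averages.

Section L2Approximation.
Import mathcomp.boot.fintype mathcomp.boot.finset.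
Variables (R : realType) (B : set nat) (alpha : R).
Hypothesis hB : sieving_set R B.
Hypothesis halpha : 0 < alpha < 1.
Hypothesis hindex : has_index (semigroup_gen B) alpha.
Local Notation Bidx := (Bidx B).
Local Notation ddB L := (dd (@bval B L)).

Definition Dset L (y : nat) : {set {set Bidx L}} := [set S | ddB L S <= y]%N.
Definition fB (y h n : nat) : R := fsum R (@bval B y.+1) h (Dset y.+1 y) n.
Definition momB (y h k : nat) : R := mom R (@bval B y.+1) h (Dset y.+1 y) k.

Let ddB_gt0 L (S : {set Bidx L}) : (0 : R) < (ddB L S)%:R.
Proof. by rewrite ltr0n dd_gt0 //; exact: (bval_gt1 hB). Qed.

Lemma fB_widen L y h n : (y < L)%N ->
  \sum_(S : {set Bidx L} | (ddB L S <= y)%N) (-1) ^+ #|S| * saw R (ddB L S) h n = fB y h n.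
Proof.
move=> yL; rewrite (dd_widen hB (fun d k => (-1) ^+ k * saw R d h n) (ltnSn y) yL) /fB /fsum.
by apply: eq_bigl => S; rewrite inE.
Qed.

Lemma fB_transfer y h k N : (0 < N)%N ->
  `|avg N (fun n => fB y h n ^+ k) - momB y h k| <= N%:R^-1 * (2 * y%:R ^+ 3) ^+ k.
Proof.
move=> N0; apply: (@fsum_transfer R _ _ (@bval_gt1 R B hB y.+1) (@bval_coprime R B hB y.+1)) => //.
by move=> S; rewrite inE.
Qed.

Lemma sub_pairs L (D D' : pred {set Bidx L}) : (forall S, D S -> D' S) ->
  \sum_(S | D S) \sum_(T | D T) ((ddB L (S :|: T))%:R : R)^-1
  <= \sum_(S | D' S) \sum_(T | D' T) ((ddB L (S :|: T))%:R : R)^-1.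
Proof.
move=> DD; have p0 (P : pred {set Bidx L}) S : 0 <= \sum_(T | P T) ((ddB L (S :|: T))%:R : R)^-1.
  by apply: sumr_ge0 => T _; rewrite invr_ge0.
rewrite big_mkcond [leRHS]big_mkcond; apply: ler_sum => S _.
case: ifP => [/DD ->|_]; last by case: ifP.
rewrite big_mkcond [leRHS]big_mkcond; apply: ler_sum => T _.
by case: ifP => [/DD ->//|_]; case: ifP => _ //; rewrite invr_ge0.
Qed.

Definition gap (y Y h n : nat) : R :=
  fsum R (@bval B Y.+1) h [set S | (y < ddB Y.+1 S <= Y)%N] n.

Lemma fB_gap y Y h n : (y <= Y)%N -> fB Y h n = fB y h n + gap y Y h n.
Proof.
move=> yY; rewrite -(@fB_widen Y.+1 y h n) ?ltnS // /fB /gap /fsum.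
rewrite (bigID (fun S => ddB Y.+1 S <= y)%N) /=; congr (_ + _); apply: eq_bigl => S.
  by rewrite !inE andbC; case: (leqP (ddB Y.+1 S) y) => //= h'; rewrite (leq_trans h').
by rewrite !inE andbC ltnNge.
Qed.

Definition htail L (Y h n : nat) : R :=
  \sum_(S : {set Bidx L} | ~~ (ddB L S <= Y)%N) (-1) ^+ #|S| * (hits (ddB L S) h n)%:R.
Definition cMB L (Y : nat) : R :=
  \sum_(S : {set Bidx L} | (ddB L S <= Y)%N) (-1) ^+ #|S| / (ddB L S)%:R.

(** The auxiliary level [Y] separates two methods. Between [y] and [Y] the sawtooth functions are
    kept, since their covariances cost only one factor [h], but passing from the period to [n <= N]
    costs [Y ^ 6 / N]. Above [Y] the number of moduli has no useful bound; there the hits are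
    counted with absolute values, and the loss of [h ^ 2] is repaid by taking [Y] large. The last
    term is the truncation error of the density [MB]. *)
Lemma NBfree_decomp L (y Y n : nat) (H : R) : 0 <= H -> (y <= Y)%N -> (Y < L)%N ->
  (n + Num.truncn H < L)%N ->
  (NBfree B n H)%:R - MB R B * (Num.truncn H)%:R - fB y (Num.truncn H) n
  = gap y Y (Num.truncn H) n + htail L Y (Num.truncn H) n
    - (Num.truncn H)%:R * (MB R B - cMB L Y).
Proof.
move=> H0 yY YL nL; set h := Num.truncn H in nL *.
rewrite (NBfree_hits hB halpha H0 nL) -/h (bigID (fun S => ddB L S <= Y)%N) /= -/(htail L Y h n).
have -> : \sum_(S : {set Bidx L} | (ddB L S <= Y)%N) (-1) ^+ #|S| * ((hits (ddB L S) h n)%:R : R)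
   = fB Y h n + h%:R * cMB L Y.
  rewrite -(fB_widen h n YL) /cMB mulr_sumr -big_split; apply: eq_bigr => S _ /=.
  by rewrite /saw; ring.
by rewrite (fB_gap h n yY); ring.
Qed.

Lemma avg_gap beta C : (forall L (Y : R), 1 <= Y ->
  \sum_(S : {set Bidx L} | Y < (ddB L S)%:R) \sum_(T : {set Bidx L} | Y < (ddB L T)%:R)
    ((ddB L (S :|: T))%:R : R)^-1 <= C * Y `^ (beta - 1)) ->
  forall y Y h N : nat, (0 < y)%N -> (0 < N)%N ->
  avg N (fun n => gap y Y h n ^+ 2) <= C * (h%:R * y%:R `^ (beta - 1)) + 4 * (Y%:R ^+ 6 / N%:R).
Proof.
move=> HC y Y h N y0 N0; set D := [set S : {set Bidx Y.+1} | (y < ddB Y.+1 S <= Y)%N].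
have DY S : S \in D -> (ddB Y.+1 S <= Y)%N by rewrite inE => /andP[].
have := @fsum_transfer R _ _ (@bval_gt1 R B hB Y.+1) (@bval_coprime R B hB Y.+1) h D Y DY 2 N N0.
rewrite -/(avg N _) ler_norml => /andP[_ h1].
have h2 := @mom2_le R _ _ (@bval_gt1 R B hB Y.+1) (@bval_coprime R B hB Y.+1) h D.
have h3 : \sum_(S in D) \sum_(T in D) ((ddB Y.+1 (S :|: T))%:R : R)^-1 <= C * y%:R `^ (beta - 1).
  apply: le_trans (HC Y.+1 y%:R _); last by rewrite ler1n.
  by apply: (@sub_pairs _ (mem D)) => S /=; rewrite inE ltr_nat => /andP[].
have h4 : h%:R * (\sum_(S in D) \sum_(T in D) ((ddB Y.+1 (S :|: T))%:R : R)^-1)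
    <= C * (h%:R * y%:R `^ (beta - 1)).
  by rewrite mulrCA; apply: ler_wpM2l.
have -> : 4 * (Y%:R ^+ 6 / N%:R) = N%:R^-1 * (2 * Y%:R ^+ 3) ^+ 2 :> R by ring.
rewrite /gap -/D; lra.
Qed.

(** After Cauchy-Schwarz over the [h] shifts, a pair [S], [T] contributes only if [dd (S :|: T)]
    divides [n + j]. Counting such [n] directly works for all moduli, including those larger than
    [N]. *)
Lemma avg_htail beta C : (forall L (Y : R), 1 <= Y ->
  \sum_(S : {set Bidx L} | Y < (ddB L S)%:R) \sum_(T : {set Bidx L} | Y < (ddB L T)%:R)
    ((ddB L (S :|: T))%:R : R)^-1 <= C * Y `^ (beta - 1)) ->
  forall L Y h N : nat, (0 < Y)%N -> (0 < N)%N -> (h <= N)%N ->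
  avg N (fun n => htail L Y h n ^+ 2) <= 4 * C * (h%:R ^+ 2 * Y%:R `^ (beta - 1)).
Proof.
move=> HC L Y h N Y0 N0 hN.
have N0r : (0 : R) < N%:R by rewrite ltr0n.
pose D := fun S : {set Bidx L} => ~~ (ddB L S <= Y)%N.
pose P := \sum_(S | D S) \sum_(T | D T) ((ddB L (S :|: T))%:R : R)^-1.
have HP : P <= C * Y%:R `^ (beta - 1).
  apply: le_trans (HC L Y%:R _); last by rewrite ler1n.
  by apply: sub_pairs => S; rewrite /D -ltnNge ltr_nat.
have pt n : htail L Y h n ^+ 2 <= h%:R * \sum_(1 <= j < h.+1) \sum_(S | D S) \sum_(T | D T)
    ((ddB L (S :|: T) %| n + j)%N%:R : R).
  apply: le_trans (_ : (\sum_(1 <= j < h.+1) \sum_(S | D S) (ddB L S %| n + j)%N%:R : R) ^+ 2 <= _).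
    rewrite -[leLHS]real_normK ?num_real //; apply: lerXn2r; rewrite ?nnegrE //.
      by apply: sumr_ge0 => j _; apply: sumr_ge0.
    apply: le_trans (ler_norm_sum _ _ _) _; rewrite exchange_big; apply: ler_sum => S _ /=.
    by rewrite normrM normrX normrN1 expr1n mul1r ger0_norm // /hits natr_sum.
  apply: le_trans (sqr_sum_le _ _) _; apply: ler_wpM2l => //; apply: ler_sum => j _.
  rewrite expr2 big_distrlr /=; apply: ler_sum => S _; apply: ler_sum => T _.
  rewrite -natrM ler_nat mulnb.
  case: (boolP ((ddB L S %| n + j) && (ddB L T %| n + j))%N) => // /andP[dS dT].
  have -> // : (ddB L (S :|: T) %| n + j)%N.
  apply/(dvdn_ddP (@bval_coprime R B hB L)) => i; rewrite inE => /orP[] iS.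
    exact: dvdn_trans (dvdn_b_dd _ iS) dS.
  exact: dvdn_trans (dvdn_b_dd _ iS) dT.
apply: le_trans (le_avg (fun n _ => pt n)) _; rewrite avgZ.
have h1 : avg N (fun n => \sum_(1 <= j < h.+1) \sum_(S | D S) \sum_(T | D T)
    ((ddB L (S :|: T) %| n + j)%N%:R : R)) <= \sum_(1 <= j < h.+1) (4 * P).
  rewrite /avg exchange_big mulr_sumr big_nat [leRHS]big_nat; apply: ler_sum => j /andP[j1 jh].
  rewrite exchange_big mulr_sumr /P mulr_sumr; apply: ler_sum => S _.
  rewrite exchange_big !mulr_sumr; apply: ler_sum => T _ /=.
  rewrite ler_pdivrMl //; apply: le_trans (count_dvd_le R j _ N0) _.
    by apply: dd_gt0; exact: (bval_gt1 hB).
  have -> : N%:R * (4 * ((ddB L (S :|: T))%:R)^-1) = (4 * N%:R) / (ddB L (S :|: T))%:R :> R by ring.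
  apply: ler_wpM2r; first by rewrite invr_ge0.
  by rewrite -!natrM ler_nat; lia.
rewrite sumr_const_nat subn1 /= -(mulr_natl (4 * P)) in h1.
have h2 := ler_wpM2l (ler0n R h) h1; apply: le_trans h2 _.
have h0 : 0 <= (h%:R : R) ^+ 2 by exact: sqr_ge0.
have h3 := ler_wpM2l h0 HP.
have -> : h%:R * (h%:R * (4 * P)) = 4 * (h%:R ^+ 2 * P) :> R by ring.
have -> : 4 * C * (h%:R ^+ 2 * Y%:R `^ (beta - 1)) = 4 * (h%:R ^+ 2 * (C * Y%:R `^ (beta - 1))) by ring.
by apply: ler_wpM2l.
Qed.

Lemma L2main beta : alpha < beta < 1 -> exists2 C : R, 0 < C &
  forall (H : R) (y Y N : nat), 0 <= H -> (0 < y <= Y)%N -> (0 < N)%N -> (Num.truncn H <= N)%N ->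
  avg N (fun n => ((NBfree B n H)%:R - MB R B * (Num.truncn H)%:R - fB y (Num.truncn H) n) ^+ 2)
  <= C * ((Num.truncn H)%:R * y%:R `^ (beta - 1) + Y%:R ^+ 6 / N%:R
          + (Num.truncn H)%:R ^+ 2 * Y%:R `^ (beta - 1)).
Proof.
move=> hb; have /andP[ab b1] := hb.
have [C C0 HC] := pair_tail hB halpha hindex hb.
have [Z Z0 HZ] := dd_sum_le hB halpha hindex ab.
exists (3 * (4 * C + 4 + Z ^+ 2)); first by have := sqr_ge0 Z; lra.
move=> H y Y N H0 /andP[y0 yY] N0 hN; set h := Num.truncn H in hN *.
have Y0 : (0 < Y)%N by apply: leq_trans yY.
pose L := (N + h + Y).+1.
have YL : (Y < L)%N by rewrite ltnS leq_addl.
have N0r : (0 : R) < N%:R by rewrite ltr0n.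
have E n : (0 < n <= N)%N -> ((NBfree B n H)%:R - MB R B * h%:R - fB y h n) ^+ 2
   <= 3 * (gap y Y h n ^+ 2 + (htail L Y h n ^+ 2 + (h%:R * (MB R B - cMB L Y)) ^+ 2)).
  move=> /andP[_ nN]; rewrite (@NBfree_decomp L y Y n H) //; last by rewrite -/h /L; lia.
  rewrite -/h; set a := gap _ _ _ _; set b := htail _ _ _ _; set c := _ * _.
  have := sqr_ge0 (a - b); have := sqr_ge0 (a + c); have := sqr_ge0 (b + c); nra.
apply: le_trans (le_avg E) _; rewrite avgZ !avgD avg_cst //.
have h1 := avg_gap HC Y h y0 N0.
have h2 := avg_htail HC L Y0 N0 hN.
have pY0 : 0 < (Y%:R : R) `^ (beta - 1) by rewrite powR_gt0 // ltr0n.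
have pY1 : (Y%:R : R) `^ (beta - 1) <= 1.
  by rewrite -[leRHS](powRr0 Y%:R) ler_powR ?ler1n // subr_le0 ltW.
have h3 : (h%:R * (MB R B - cMB L Y)) ^+ 2 <= Z ^+ 2 * (h%:R ^+ 2 * Y%:R `^ (beta - 1)).
  have := @MB_approx R B alpha hB beta Z ab (ltW b1) HZ L Y Y0 YL; rewrite -/(cMB L Y) => hM.
  rewrite exprMn [leRHS]mulrCA; apply: ler_wpM2l; first exact: sqr_ge0.
  rewrite -real_normK ?num_real //; apply: le_trans (_ : (Z * Y%:R `^ (beta - 1)) ^+ 2 <= _).
    by apply: lerXn2r; rewrite ?nnegrE // mulr_ge0 // ltW.
  rewrite exprMn; apply: ler_wpM2l; first exact: sqr_ge0.
  by rewrite expr2; apply: ler_piMr => //; apply: ltW.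
set A := h%:R * y%:R `^ (beta - 1) in h1 *; set D := Y%:R ^+ 6 / N%:R in h1 *.
set F := h%:R ^+ 2 * Y%:R `^ (beta - 1) in h2 h3 *.
have A0 : 0 <= A by rewrite mulr_ge0 // powR_ge0.
have D0 : 0 <= D by rewrite divr_ge0 // exprn_ge0.
have F0 : 0 <= F by rewrite mulr_ge0 ?sqr_ge0 // ltW.
rewrite -!mulrA; apply: ler_wpM2l => //.
have CA : 0 <= C * A by rewrite mulr_ge0 // ltW.
have CD : 0 <= C * D by rewrite mulr_ge0 // ltW.
have CF : 0 <= C * F by rewrite mulr_ge0 // ltW.
have ZA : 0 <= Z ^+ 2 * A by rewrite mulr_ge0 // sqr_ge0.
have ZD : 0 <= Z ^+ 2 * D by rewrite mulr_ge0 // sqr_ge0.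
have -> : (4 * C + 4 + Z ^+ 2) * (A + D + F) = 4 * (C * A) + 4 * (C * D) + 4 * (C * F)
   + 4 * A + 4 * D + 4 * F + Z ^+ 2 * A + Z ^+ 2 * D + Z ^+ 2 * F by ring.
have h2' : avg N (fun n => htail L Y h n ^+ 2) <= 4 * (C * F) by rewrite mulrA.
lra.
Qed.

End L2Approximation.

(** * The variance [C2B] *)

Section Variance.
Import mathcomp.boot.fintype mathcomp.boot.finset.
Variables (R : realType) (B : set nat) (alpha : R).
Hypothesis hB : sieving_set R B.
Hypothesis halpha : 0 < alpha < 1.
Hypothesis hindex : has_index (semigroup_gen B) alpha.
Local Notation Bidx := (Bidx B).
Local Notation ddB L := (dd (@bval B L)).
Local Notation fB := (@fB R B).
Local Notation momB := (@momB R B).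

Definition dev (H : R) (n : nat) : R := (NBfree B n H)%:R - MB R B * H.

Lemma dev_le H n : 0 <= H -> `|dev H n| <= H.
Proof.
move=> H0; have /andP[M0 M1] := MB_itv hB.
have hM : 0 <= MB R B * H <= H by rewrite mulr_ge0 //= ler_piMl.
have hN : 0 <= ((NBfree B n H)%:R : R) <= H.
  rewrite ler0n /=; have /andP[t1 t2] := truncn_itv H0.
  apply: le_trans t1; rewrite ler_nat /NBfree.
  have -> : Num.truncn (n%:R + H) = (n + Num.truncn H)%N.
    apply: truncn_def; rewrite natrD lerD2l -addnS natrD ltrD2l t2 andbT.
    by have /andP[] := truncn_itv H0.
  apply: leq_trans (_ : \sum_(n.+1 <= m < (n + Num.truncn H).+1) 1 <= _)%N.
    by rewrite big_mkcond; apply: leq_sum => m _; case: ifP.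
  by rewrite sum_nat_const_nat muln1 subSS addKn.
by rewrite /dev ler_norml; apply/andP; split; lra.
Qed.

Lemma exists_powR_le (C e : R) : 0 < C -> e < 0 -> forall eps : R, 0 < eps ->
  exists2 Y0 : nat, (0 < Y0)%N & forall Y : nat, (Y0 <= Y)%N -> C * Y%:R `^ e <= eps.
Proof.
move=> C0 e0 eps eps0; have [x0 x01 Hx] := @powR_dom R (C / eps) e 0 e0.
exists (Num.truncn x0).+1 => // Y hY.
have := Hx Y%:R; rewrite powRr0 mulrAC ler_pdivrMr // mul1r; apply.
apply: le_trans (_ : (Num.truncn x0).+1%:R <= _); first exact/ltW/truncnS_gt.
by rewrite ler_nat.
Qed.

(** [C2B] is a total [lim], so convergence has to be established before its value can be used. No
    candidate limit is needed: for each [eps] the averages are eventually close to the period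
    average of a sufficiently long truncation, which makes them Cauchy. *)
Lemma C2B_cauchy H : 0 <= H -> forall eps : R, 0 < eps ->
  exists c : R, exists2 N0 : nat, (0 < N0)%N &
  forall N, (N0 <= N)%N -> `|avg N (fun n => dev H n ^+ 2) - c| <= eps.
Proof.
move=> H0 eps eps0; set h := Num.truncn H.
have /andP[a0 a1] := halpha.
pose beta := (alpha + 1) / 2; have hb : alpha < beta < 1 by rewrite /beta; lra.
have [C C0 HC] := L2main hB halpha hindex hb.
pose tau := eps / 4; have tau0 : 0 < tau by rewrite divr_gt0.
(* From [|dev ^ 2 - v ^ 2| <= 2 * H * |w| + w ^ 2], with
   [2 * H * |w| <= H ^ 2 / tau * w ^ 2 + tau]. *)
pose G := 1 + H ^+ 2 / tau; have G1 : 1 <= G by rewrite lerDl divr_ge0 ?sqr_ge0 // ltW.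
have G0 : 0 < G by apply: lt_le_trans G1.
pose A : R := h%:R + h%:R ^+ 2 + 1.
have A1 : 1 <= A by rewrite /A lerDr addr_ge0 // sqr_ge0.
have A0 : 0 < A by apply: lt_le_trans A1.
have [Y Y0 HY] := @exists_powR_le (G * C * A) (beta - 1) ltac:(rewrite !mulr_gt0 //) ltac:(lra) _ tau0.
have {HY} := HY Y (leqnn Y) => HY.
(* [fB] is centred for the integer length [h]; [kap] corrects for the fractional part of [H]. *)
pose kap : R := MB R B * (H - h%:R).
pose m1 := momB Y h 1; pose m2 := momB Y h 2.
exists (m2 - 2 * kap * m1 + kap ^+ 2).
pose K1 : R := G * C * Y%:R ^+ 6 + (2 * Y%:R ^+ 3) ^+ 2 + `|2 * kap| * (2 * Y%:R ^+ 3) ^+ 1.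
have K10 : 0 <= K1.
  apply: addr_ge0; last by rewrite expr1 !mulr_ge0 ?exprn_ge0.
  by apply: addr_ge0; rewrite ?sqr_ge0 // !mulr_ge0 ?(ltW G0) ?(ltW C0) ?exprn_ge0.
exists (maxn (Num.truncn (K1 / tau)).+1 h.+1) => [|N]; first by rewrite leq_max.
rewrite geq_max => /andP[hN1 hN2].
have N0 : (0 < N)%N by apply: leq_trans hN2.
have N0r : (0 : R) < N%:R by rewrite ltr0n.
have KN : N%:R^-1 * K1 <= tau.
  rewrite ler_pdivrMl // -ler_pdivrMr //; apply: le_trans (_ : (Num.truncn (K1 / tau)).+1%:R <= _).
    exact/ltW/truncnS_gt.
  by rewrite ler_nat.
pose w n := (NBfree B n H)%:R - MB R B * h%:R - fB Y h n.
pose v n := fB Y h n - kap.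
have uv n : dev H n = v n + w n by rewrite /dev /v /w /kap; ring.
have hw : avg N (fun n => w n ^+ 2) <= C * (A * Y%:R `^ (beta - 1) + Y%:R ^+ 6 / N%:R).
  have := @HC H Y Y N H0; rewrite Y0 leqnn N0 => /(_ isT isT (ltnW hN2)); rewrite -/h.
  move=> hh; apply: le_trans hh _; apply: ler_wpM2l; first exact: ltW.
  have : 0 <= (Y%:R : R) `^ (beta - 1) by exact: powR_ge0.
  by rewrite /A !mulrDl mul1r; lra.
have hv : avg N (fun n => v n ^+ 2) = avg N (fun n => fB Y h n ^+ 2)
    - 2 * kap * avg N (fun n => fB Y h n ^+ 1) + kap ^+ 2.
  rewrite -mulNr -!avgZ -(avg_cst (kap ^+ 2) N0) -!avgD; apply: eq_avg => n.
  by rewrite /v expr1; ring.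
have d1 := @fB_transfer R B hB Y h 1 N N0; have d2 := @fB_transfer R B hB Y h 2 N N0.
have hvm : `|avg N (fun n => v n ^+ 2) - (m2 - 2 * kap * m1 + kap ^+ 2)|
   <= N%:R^-1 * ((2 * Y%:R ^+ 3) ^+ 2 + `|2 * kap| * (2 * Y%:R ^+ 3) ^+ 1).
  rewrite hv.
  set e2 := avg N _ in d2 *; set e1 := avg N _ in d1 *.
  have -> : e2 - 2 * kap * e1 + kap ^+ 2 - (m2 - 2 * kap * m1 + kap ^+ 2)
     = (e2 - m2) - 2 * kap * (e1 - m1) by ring.
  apply: le_trans (ler_normB _ _) _; rewrite [leRHS]mulrDr; apply: lerD; first exact: d2.
  by rewrite normrM [leRHS]mulrCA; apply: ler_wpM2l.
have huv : `|avg N (fun n => dev H n ^+ 2) - avg N (fun n => v n ^+ 2)|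
   <= G * avg N (fun n => w n ^+ 2) + tau.
  have pt n : `|dev H n ^+ 2 - v n ^+ 2| <= G * w n ^+ 2 + tau.
    have -> : dev H n ^+ 2 - v n ^+ 2 = 2 * dev H n * w n - w n ^+ 2 by rewrite uv; ring.
    have hd := dev_le n H0.
    apply: le_trans (ler_normB _ _) _; rewrite [`|w n ^+ 2|]ger0_norm ?sqr_ge0 //.
    rewrite !normrM ger0_norm // /G mulrDl mul1r.
    have : 2 * `|dev H n| * `|w n| <= 2 * H * `|w n| by apply: ler_wpM2r => //; lra.
    have : 2 * H * `|w n| <= H ^+ 2 / tau * w n ^+ 2 + tau.
      have -> : H ^+ 2 / tau * w n ^+ 2 + tau = 2 * H * `|w n| + (H * `|w n| - tau) ^+ 2 / tau.
        rewrite -(real_normK (num_real (w n))); field; exact: lt0r_neq0.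
      by rewrite lerDl divr_ge0 ?sqr_ge0 // ltW.
    lra.
  have -> : G * avg N (fun n => w n ^+ 2) + tau = avg N (fun n => G * w n ^+ 2 + tau).
    by rewrite avgD avgZ avg_cst.
  have -> : avg N (fun n => dev H n ^+ 2) - avg N (fun n => v n ^+ 2)
     = avg N (fun n => dev H n ^+ 2 - v n ^+ 2).
    by rewrite /avg sumrB mulrBr.
  apply: le_trans (_ : avg N (fun n => `|dev H n ^+ 2 - v n ^+ 2|) <= _).
    rewrite /avg normrM ger0_norm ?invr_ge0 //; apply: ler_wpM2l; first by rewrite invr_ge0.
    exact: ler_norm_sum.
  by apply: le_avg => n _.
have hGw := ler_wpM2l (ltW G0) hw.
rewrite -(subrKA (avg N (fun n => v n ^+ 2))); apply: le_trans (ler_normD _ _) _.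
have E : G * (C * (A * Y%:R `^ (beta - 1) + Y%:R ^+ 6 / N%:R))
   = G * C * A * Y%:R `^ (beta - 1) + N%:R^-1 * (G * C * Y%:R ^+ 6) by ring.
rewrite E in hGw; rewrite /K1 -addrA mulrDr in KN.
have : 4 * tau = eps by rewrite /tau; lra.
lra.
Qed.

Lemma C2B_cvg H : 0 <= H ->
  ((X^-1 * \sum_(1 <= n < (Num.truncn X).+1) dev H n ^+ 2) @[X --> (+oo : set_system R)] --> C2B B H)%classic.
Proof.
move=> H0.
set F := fun X : R => X^-1 * \sum_(1 <= n < (Num.truncn X).+1) dev H n ^+ 2.
suff : cvg (F X @[X --> +oo])%classic by [].
apply/cauchy_cvgP/cauchy_exP => eps eps0.
have e4 : 0 < eps / 4 by rewrite divr_gt0.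
have [c [N0 N00 Hc]] := C2B_cauchy H0 e4.
exists c; apply/near_pinftyP.
pose x0 := 1 + N0%:R + H ^+ 2 / (eps / 4).
have q0 : 0 <= H ^+ 2 / (eps / 4) by rewrite divr_ge0 ?sqr_ge0 // ltW.
exists x0; first by rewrite /x0 -addrA lerDl addr_ge0.
move=> X hX; set N := Num.truncn X.
have X1 : 1 <= X by apply: le_trans hX; rewrite /x0 -addrA lerDl addr_ge0.
have X0 : 0 < X by apply: lt_le_trans X1.
have /andP[NX XN] := truncn_itv (ltW X0).
have hN : (N0 <= N)%N.
  by rewrite (truncn_ge_nat _ (ltW X0)); apply: le_trans hX; rewrite /x0; lra.
have N1 : (0 < N)%N by apply: leq_trans hN.
have := Hc N hN; set a := avg N _ => ha.
have aE : F X = a * (N%:R / X).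
  rewrite /F /a /avg -/N; field; rewrite gt_eqF //= pnatr_eq0 -lt0n //.
have a0 : 0 <= a by apply: avg_ge0 => n; exact: sqr_ge0.
have aH : a <= H ^+ 2.
  rewrite -(avg_cst (H ^+ 2) N1); apply: le_avg => n _.
  rewrite -real_normK ?num_real //; apply: lerXn2r; rewrite ?nnegrE //; exact: dev_le.
have hd : `|F X - a| <= eps / 4.
  have -> : F X - a = - (a * ((X - N%:R) / X)) by rewrite aE; field; rewrite gt_eqF.
  rewrite normrN ger0_norm; last by rewrite mulr_ge0 // divr_ge0 ?subr_ge0 // ltW.
  apply: le_trans (_ : H ^+ 2 * (1 / X) <= _).
    apply: ler_pM => //; first by rewrite divr_ge0 ?subr_ge0 // ltW.
    rewrite -natr1 -/N in XN.
    by apply: ler_wpM2r; rewrite ?invr_ge0 ?(ltW X0) //; lra.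
  rewrite mul1r ler_pdivrMr // [leRHS]mulrC -ler_pdivrMr //; apply: le_trans hX.
  by rewrite /x0 lerDr addr_ge0.
rewrite /ball /= /ball_ /= distrC.
rewrite -(subrKA a); apply: le_lt_trans (ler_normD _ _) _; lra.
Qed.

Lemma momB2_cvg y h : ((fun N => avg N (fun n => fB y h n ^+ 2)) @ \oo --> momB y h 2)%classic.
Proof.
apply/cvgrPdist_le => eps eps0; near=> N.
have N0 : (0 < N)%N by near: N; exact: nbhs_infty_gt.
rewrite distrC; apply: le_trans (@fB_transfer R B hB y h 2 N N0) _.
rewrite ler_pdivrMl ?ltr0n // -ler_pdivrMr //.
by near: N; exact: nbhs_infty_ger.
Unshelve. all: by end_near. Qed.

Lemma dev2_cvg H : 0 <= H -> ((fun N => avg N (fun n => dev H n ^+ 2)) @ \oo --> C2B B H)%classic.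
Proof.
move=> H0; have /cvg_pinftyP := C2B_cvg H0 => /(_ (fun N => N%:R) (@cvgr_idn R)).
by apply: cvg_trans; apply: near_eq_cvg; near=> N; rewrite /avg /= natrK.
Unshelve. all: by end_near. Qed.

Lemma sqr_le_lam (a b l : R) : 0 < l -> a ^+ 2 <= (1 + l) * b ^+ 2 + (1 + l^-1) * (a - b) ^+ 2.
Proof.
move=> l0.
have E : (1 + l) * b ^+ 2 + (1 + l^-1) * (a - b) ^+ 2 - a ^+ 2 = (l * b - (a - b)) ^+ 2 / l.
  by field; rewrite gt_eqF.
by rewrite -subr_ge0 E divr_ge0 ?sqr_ge0 // ltW.
Qed.

(** The conditions on [Y] and [N] make the last two error terms of [L2main] at most 1. The constant
    term also absorbs the replacement of [H] by its integer part. *)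
Lemma avg_dev_fB beta : alpha < beta < 1 -> exists2 C : R, 0 < C &
  forall (H : R) (y : nat), 0 <= H -> (0 < y)%N ->
  forall Y N : nat, (y <= Y)%N -> ((Num.truncn H)%:R ^+ 2 + 1) * Y%:R `^ (beta - 1) <= 1 ->
  (Y ^ 6 + Num.truncn H < N)%N ->
  avg N (fun n => (dev H n - fB y (Num.truncn H) n) ^+ 2)
   <= C * (1 + (Num.truncn H)%:R * y%:R `^ (beta - 1)).
Proof.
move=> hb; have /andP[_ b1] := hb; have [C C0 HC] := L2main hB halpha hindex hb.
exists (4 * C + 2); first by lra.
move=> H y H0 y0; set h := Num.truncn H.
have hb1 : beta - 1 < 0 by lra.
move=> Y N yY HY hN.
have N0 : (0 < N)%N by exact: leq_ltn_trans hN.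
have hN1 : (h <= N)%N by apply: ltnW; apply: leq_ltn_trans hN; exact: leq_addl.
have hN2 : (Y ^ 6 <= N)%N by apply: ltnW; apply: leq_ltn_trans hN; exact: leq_addr.
have N0r : (0 : R) < N%:R by rewrite ltr0n.
have := HC H y Y N H0; rewrite y0 yY N0 => /(_ isT isT); rewrite -/h => /(_ hN1).
set w := fun n => _ => hw.
have /andP[M0 M1] := MB_itv hB.
have /andP[t1 t2] := truncn_itv H0; rewrite -/h -natr1 in t1 t2.
have k1 : (MB R B * (H - h%:R)) ^+ 2 <= 1.
  rewrite expr_le1 ?mulr_ge0 ?subr_ge0 //.
  by apply: le_trans (_ : 1 * (H - h%:R) <= _); [apply: ler_wpM2r; rewrite ?subr_ge0 | lra].
have pt n : (dev H n - fB y h n) ^+ 2 <= 2 * w n + 2.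
  have -> : dev H n - fB y h n = ((NBfree B n H)%:R - MB R B * h%:R - fB y h n) - MB R B * (H - h%:R).
    by rewrite /dev; ring.
  rewrite /w; move: k1; set a := _ - fB y h n; set c := MB R B * _ => k1.
  have := sqr_ge0 (a + c); have -> : (a + c) ^+ 2 = a ^+ 2 + c ^+ 2 + 2 * a * c by ring.
  have -> : (a - c) ^+ 2 = a ^+ 2 + c ^+ 2 - 2 * a * c by ring.
  lra.
apply: le_trans (le_avg (fun n _ => pt n)) _; rewrite avgD avgZ avg_cst //.
have h1 : (h%:R : R) ^+ 2 * Y%:R `^ (beta - 1) <= 1.
  have := HY; rewrite mulrDl mul1r.
  have : 0 <= (Y%:R : R) `^ (beta - 1) by exact: powR_ge0.
  lra.
have h2 : (Y%:R : R) ^+ 6 / N%:R <= 1.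
  by rewrite ler_pdivrMr // mul1r -natrX ler_nat.
set P := h%:R * y%:R `^ (beta - 1) in hw *.
have P0 : 0 <= P by rewrite mulr_ge0 // powR_ge0.
have : C * (P + Y%:R ^+ 6 / N%:R + h%:R ^+ 2 * Y%:R `^ (beta - 1)) <= C * (P + 2).
  by apply: ler_wpM2l; rewrite ?(ltW C0) //; lra.
have : 0 <= C * P by rewrite mulr_ge0 // ltW.
rewrite !mulrDl !mulrDr; lra.
Qed.

(** The free parameter [l] keeps the leading constant close to 1: once [E] is of smaller order than
    the variance, both inequalities together give ratio 1, which a plain factor 2 would not. *)
Lemma C2B_compare beta : alpha < beta < 1 -> exists2 C : R, 0 < C &
  forall (H : R) (y : nat) (l : R), 0 <= H -> (0 < y)%N -> 0 < l ->
  let E := C * (1 + (Num.truncn H)%:R * y%:R `^ (beta - 1)) in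
  C2B B H <= (1 + l) * momB y (Num.truncn H) 2 + (1 + l^-1) * E
  /\ momB y (Num.truncn H) 2 <= (1 + l) * C2B B H + (1 + l^-1) * E.
Proof.
move=> hb; have [C C0 HC] := avg_dev_fB hb; exists C => // H y l H0 y0 l0 E.
set h := Num.truncn H.
have hb1 : beta - 1 < 0 by case/andP: hb => _ b1; lra.
have A0 : 0 < (h%:R : R) ^+ 2 + 1 by apply: ltr_wpDl => //; exact: sqr_ge0.
have [Y0 Y00 HY] := @exists_powR_le _ _ A0 hb1 1 ltr01.
pose Y := maxn Y0 y.
have l1 : 0 <= 1 + l^-1 by rewrite addr_ge0 // invr_ge0 ltW.
have key (u v : nat -> R) (a c : R) : ((fun N => avg N (fun n => u n ^+ 2)) @ \oo --> a)%classic ->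
    ((fun N => avg N (fun n => v n ^+ 2)) @ \oo --> c)%classic ->
    (\forall N \near \oo, avg N (fun n => (u n - v n) ^+ 2) <= E)%classic ->
    a <= (1 + l) * c + (1 + l^-1) * E.
  move=> ua vc hE.
  have vc' : ((fun N => (1 + l) * avg N (fun n => v n ^+ 2) + (1 + l^-1) * E) @ \oo
      --> (1 + l) * c + (1 + l^-1) * E)%classic.
    by apply: cvgD; [apply: cvgMr | exact: cvg_cst].
  apply: ler_cvg_to ua vc' _.
  apply: filterS hE => N hE.
  apply: le_trans (_ : avg N (fun n => (1 + l) * v n ^+ 2 + (1 + l^-1) * (u n - v n) ^+ 2) <= _).
    by apply: le_avg => n _; exact: sqr_le_lam.
  by rewrite avgD !avgZ lerD2l; apply: ler_wpM2l.
have nearE : (\forall N \near \oo, avg N (fun n => (dev H n - fB y h n) ^+ 2) <= E)%classic.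
  near=> N; apply: (HC H y H0 y0 Y); [exact: leq_maxr|exact/HY/leq_maxl|].
  by near: N; exact: nbhs_infty_gt.
split.
  by apply: (key (dev H) (fB y h)); [exact: dev2_cvg | exact: momB2_cvg | exact: nearE].
apply: (key (fB y h) (dev H)); [exact: momB2_cvg | exact: dev2_cvg |].
apply: filterS nearE => N; apply: le_trans.
by apply: le_avg => n _; rewrite -sqrrN opprB.
Unshelve. all: by end_near. Qed.

(** For [0 < x <= 1 / 2] one has [(1 - x) * (1 + x) ^ 2 >= 1], so the product is at least the
    inverse square of the product of [1 + 1 / b]. The latter expands into the sum of [1 / dd S],
    bounded because [alpha < 1]. *)
Lemma prod_onem_ge : exists2 c : R, 0 < c & forall L (V : {set Bidx L}),
  c <= \prod_(i : Bidx L | i \notin V) (1 - ((bval i)%:R : R)^-1).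
Proof.
have a1 : alpha < 1 by case/andP: halpha.
have [Z Z0 HZ] := dd_sum_le hB halpha hindex a1.
exists ((Z ^+ 2)^-1); first by rewrite invr_gt0 exprn_gt0.
move=> L V; have bv (i : Bidx L) := @bvalV_le R B hB L i.
set x := fun i : Bidx L => ((bval i)%:R : R)^-1.
have sumZ : \prod_(i : Bidx L) (1 + x i) <= Z.
  rewrite -sum_prod_set; apply: le_trans (HZ L); apply: ler_sum => S _.
  by rewrite powR_inv1 // /dd natr_prod -prodfV.
have p1 : \prod_(i : Bidx L | i \notin V) (1 + x i) <= Z.
  apply: le_trans sumZ; rewrite [leRHS](bigID (fun i => i \notin V)) /=.
  apply: ler_peMr; first by apply: prodr_ge0 => i _; have := bv i; rewrite -/(x i); lra.
  elim/big_rec: _ => [|i u _ hu]; first exact: lexx.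
  by apply: mulr_ege1 => //; have := bv i; rewrite -/(x i); lra.
have p0 : 0 < \prod_(i : Bidx L | i \notin V) (1 + x i).
  by apply: prodr_gt0 => i _; have := bv i; rewrite -/(x i); lra.
set P := \prod_(i | _) (1 + x i) in p1 p0.
apply: le_trans (_ : (P ^+ 2)^-1 <= _).
  by rewrite lef_pV2 ?posrE ?exprn_gt0 //; apply: lerXn2r; rewrite ?nnegrE // ltW.
rewrite -exprVn -prodfV -prodrXl; apply: ler_prod => i _; have := bv i; rewrite -/(x i) => /andP[x0 xh].
rewrite exprn_ge0 ?invr_ge0 /=; last lra.
rewrite exprVn -[leLHS]mul1r ler_pdivrMr ?exprn_gt0 //; last lra.
have -> : (1 - x i) * (1 + x i) ^+ 2 = 1 + x i * (1 - x i - x i * x i) by ring.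
rewrite lerDl mulr_ge0 //; first exact: ltW.
have := ler_pM (ltW x0) (ltW x0) xh xh; lra.
Qed.

(** Over all [S] containing [V] the signed sum is exactly [1 / dd V] in absolute value times an
    Euler product bounded below by [c]. The omitted [dd S > y] are multiples of [dd V], so Rankin
    bounds them relative to [1 / dd V] by [Z * (y / dd V) ^ (s - 1)]. *)
Lemma coeff_ge s Z c : alpha < s -> s <= 1 -> 0 < c ->
  (forall L, \sum_(S : {set Bidx L}) ((ddB L S)%:R : R) `^ (- s) <= Z) ->
  (forall L (V : {set Bidx L}), c <= \prod_(i : Bidx L | i \notin V) (1 - ((bval i)%:R : R)^-1)) ->
  forall L (y : nat) (V : {set Bidx L}), (0 < y)%N ->
  (c - Z * (y%:R / (ddB L V)%:R) `^ (s - 1)) / (ddB L V)%:R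
  <= `|\sum_(S in @Dset B L y | V \subset S) (-1) ^+ #|S| / (ddB L S)%:R|.
Proof.
move=> als s1 c0 HZ Hc L y V y0.
have s0 : 0 < s by case/andP: halpha => a0 _; apply: lt_trans als.
have y0r : (0 : R) < y%:R by rewrite ltr0n.
have dg (S : {set Bidx L}) : (0 : R) < (ddB L S)%:R.
  by rewrite ltr0n dd_gt0 //; exact: (bval_gt1 hB).
set d : R := (ddB L V)%:R; have d0 : 0 < d by exact: dg.
have full : \sum_(S : {set Bidx L} | V \subset S) (-1) ^+ #|S| / ((ddB L S)%:R : R)
   = (-1) ^+ #|V| / d * \prod_(i : Bidx L | i \notin V) (1 - ((bval i)%:R : R)^-1).
  rewrite -(prod_signed R (@bval B L)) -sum_supset; apply: eq_bigr => S _.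
  by rewrite prod_signed.
have tail : \sum_(S : {set Bidx L} | (V \subset S) && (S \notin @Dset B L y)) ((ddB L S)%:R : R)^-1
   <= Z * (y%:R / d) `^ (s - 1) / d.
  apply: le_trans (_ : (\sum_(S : {set Bidx L} | V \subset S) ((ddB L S)%:R : R) `^ (- s)) * y%:R `^ (s - 1) <= _).
    rewrite mulr_suml big_mkcondr; apply: ler_sum => S VS; rewrite inE -ltnNge.
    case: ifP => h; last by rewrite mulr_ge0 // powR_ge0.
    have e0 := dg S; set e : R := (ddB L S)%:R in e0 *.
    have -> : e^-1 = e `^ (- s) * e `^ (s - 1).
      by rewrite -powRD ?(gt_eqF e0) ?implybT // -[e^-1]powR_inv1 ?ltW //; congr (_ `^ _); ring.
    apply: ler_wpM2l; first exact: powR_ge0.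
    rewrite -(opprB 1 s) !powRN lef_pV2 ?posrE ?powR_gt0 //.
    by apply: ge0_ler_powR; rewrite ?nnegrE ?subr_ge0 // /e ?ler_nat ltnW.
  pose x (i : Bidx L) := ((bval i)%:R : R) `^ (- s).
  have xdd (S : {set Bidx L}) : ((ddB L S)%:R : R) `^ (- s) = \prod_(i in S) x i.
    rewrite /dd /x; elim/big_rec2: _ => [|i u v _ <-]; first by rewrite powR1.
    by rewrite natrM powRM.
  have sub : \sum_(S : {set Bidx L} | V \subset S) ((ddB L S)%:R : R) `^ (- s) <= d `^ (- s) * Z.
    under eq_bigr do rewrite xdd.
    rewrite sum_supset -xdd -/d; apply: ler_wpM2l; first exact: powR_ge0.
    apply: le_trans (HZ L); rewrite (eq_bigr (fun S : {set Bidx L} => \prod_(i in S) x i)) => [|S _]; last exact: xdd.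
    rewrite sum_prod_set [leRHS](bigID (fun i => i \notin V)) /=.
    apply: ler_peMr; first by apply: prodr_ge0 => i _; rewrite addr_ge0 // powR_ge0.
    elim/big_rec: _ => [|i u _ hu]; first exact: lexx.
    by apply: mulr_ege1 => //; rewrite lerDl powR_ge0.
  apply: le_trans (ler_wpM2r (powR_ge0 _ _) sub) _.
  rewrite powRM ?invr_ge0 ?(ltW d0) ?(ltW y0r) //.
  have -> : (d^-1) `^ (s - 1) = d `^ (- s) * d.
    rewrite -[d^-1]powR_inv1 ?(ltW d0) // -powRrM.
    rewrite -[X in _ = _ * X](powRr1 (ltW d0)) -powRD ?(gt_eqF d0) ?implybT //.
    by congr (_ `^ _); ring.
  rewrite le_eqVlt; apply/orP; left; apply/eqP; field; exact: lt0r_neq0.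
have E : \sum_(S in @Dset B L y | V \subset S) (-1) ^+ #|S| / ((ddB L S)%:R : R)
   = (-1) ^+ #|V| / d * \prod_(i : Bidx L | i \notin V) (1 - ((bval i)%:R : R)^-1)
     - \sum_(S : {set Bidx L} | (V \subset S) && (S \notin @Dset B L y)) (-1) ^+ #|S| / (ddB L S)%:R.
  rewrite -full [X in _ = X - _](bigID (fun S => S \in @Dset B L y)) /= addrK.
  by apply: eq_bigl => S; rewrite andbC.
rewrite E; apply: le_trans (lerB_dist _ _).
rewrite mulrBl; apply: lerB.
  rewrite normrM normrM normrX normrN1 expr1n mul1r [`|d^-1|]ger0_norm ?invr_ge0 ?(ltW d0) // mulrC.
  apply: ler_wpM2l; first by rewrite invr_ge0 ltW.
  by apply: le_trans (Hc L V) _; exact: ler_norm.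
apply: le_trans (ler_norm_sum _ _ _) _; apply: le_trans tail; apply: ler_sum => S _.
by rewrite normrM normrX normrN1 expr1n mul1r ger0_norm // invr_ge0 ltW.
Qed.

End Variance.

(** * Asymptotics of the moments *)

Section PowerBounds.
Variable R : realType.
Implicit Types (u v : nat -> R) (e c : R).

Definition pbound u e := exists2 C : R, 0 < C &
  forall h, (0 < h)%N -> 0 <= u h <= C * h%:R `^ e.

Lemma pbound_le u v e : (forall h, (0 < h)%N -> 0 <= u h <= v h) -> pbound v e -> pbound u e.
Proof.
move=> uv [C C0 HC]; exists C => // h h0; have /andP[u0 le_uv] := uv h h0.
by rewrite u0; have /andP[_] := HC h h0; apply: le_trans.
Qed.

Lemma pbound_cst c : 0 <= c -> pbound (fun=> c) 0.
Proof.
move=> c0; exists (c + 1); first by rewrite ltr_wpDl.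
by move=> h _; rewrite powRr0 mulr1 c0 lerDl ler01.
Qed.

Lemma pboundM u v e f : pbound u e -> pbound v f -> pbound (fun h => u h * v h) (e + f).
Proof.
move=> [C C0 HC] [D D0 HD]; exists (C * D); first exact: mulr_gt0.
move=> h h0; have /andP[u0 uC] := HC h h0; have /andP[v0 vD] := HD h h0.
rewrite mulr_ge0 //= powRD ?pnatr_eq0 -?lt0n ?h0 ?implybT // mulrACA; exact: ler_pM.
Qed.

Lemma pboundX u e k : pbound u e -> pbound (fun h => u h ^+ k) (k%:R * e).
Proof.
move=> ue; elim: k => [|k IH]; first by rewrite mul0r; exact: pbound_cst.
rewrite -natr1 mulrDl mul1r [_ + e]addrC.
by apply: pbound_le (pboundM ue IH) => h h0; case: ue => C C0 /(_ h h0) /andP[u0 _]; rewrite exprS lexx mulr_ge0 ?exprn_ge0.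
Qed.

Lemma pbound_powR u e s : 0 <= s -> pbound u e -> pbound (fun h => u h `^ s) (e * s).
Proof.
move=> s0 [C C0 HC]; exists (C `^ s); first exact: powR_gt0.
move=> h h0; have /andP[u0 uC] := HC h h0; rewrite powR_ge0 /=.
rewrite powRrM -powRM ?powR_ge0 ?(ltW C0) //.
by apply: ge0_ler_powR; rewrite ?nnegrE // mulr_ge0 ?powR_ge0 ?(ltW C0).
Qed.

Lemma pboundW u e f : e <= f -> pbound u e -> pbound u f.
Proof.
move=> ef [C C0 HC]; exists C => // h h0; have /andP[-> uC] /= := HC h h0.
apply: le_trans uC _; apply: ler_wpM2l; first exact: ltW.
by apply: ler_powR => //; rewrite ler1n.
Qed.

Lemma pboundD u v e : pbound u e -> pbound v e -> pbound (fun h => u h + v h) e.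
Proof.
move=> [C C0 HC] [D D0 HD]; exists (C + D); first exact: addr_gt0.
move=> h h0; have /andP[u0 uC] := HC h h0; have /andP[v0 vD] := HD h h0.
by rewrite addr_ge0 //= mulrDl lerD.
Qed.

Lemma pbound_cvg0 u v e f : pbound u e -> e < f ->
  (exists h0 : nat, forall h, (h0 <= h)%N -> h%:R `^ f <= v h) ->
  (u h / v h @[h --> \oo] --> (0 : R))%classic.
Proof.
move=> [C C0 HC] ef [h0 Hv]; apply/cvgrPdist_le => eps eps0.
have fe0 : e - f < 0 by lra.
have [h1 h10 H1] := @exists_powR_le R _ _ C0 fe0 _ eps0.
near=> h.
have hh0 : (h0 <= h)%N by near: h; exact: nbhs_infty_ge.
have hh1 : (h1 <= h)%N by near: h; exact: nbhs_infty_ge.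
have hp : (0 < h)%N by apply: leq_trans hh1.
have hr : (0 : R) < h%:R by rewrite ltr0n.
have /andP[u0 uC] := HC h hp; have vf := Hv h hh0.
have v0 : 0 < v h by apply: lt_le_trans vf; rewrite powR_gt0.
rewrite sub0r normrN ger0_norm; last by rewrite divr_ge0 // ltW.
rewrite ler_pdivrMr //; apply: le_trans uC _.
have := H1 h hh1; rewrite powRB ?(gt_eqF hr) ?implybT // mulrA ler_pdivrMr ?powR_gt0 // => /le_trans; apply.
by apply: ler_wpM2l => //; exact: ltW.
Unshelve. all: by end_near. Qed.

Lemma ler_powRn (a b e : R) : 0 < a -> a <= b -> e <= 0 -> b `^ e <= a `^ e.
Proof.
move=> a0 ab e0; have b0 : 0 < b by apply: lt_le_trans ab.
rewrite -(opprK e); set f := - e.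
rewrite (powRN a f) (powRN b f) lef_pV2 ?posrE ?powR_gt0 //.
by apply: ge0_ler_powR; rewrite ?nnegrE /f ?oppr_ge0 // ltW.
Qed.

Lemma harmonic_le n : \sum_(a < n.+1) ((a.+1)%:R : R)^-1 <= 1 + ln (n.+1%:R).
Proof.
elim: n => [|n IH]; first by rewrite big_ord1 invr1 ln1 addr0.
rewrite big_ord_recr /=; apply: le_trans (lerD IH (lexx _)) _.
have p1 : (0 : R) < n.+1%:R by rewrite ltr0n.
have p2 : (0 : R) < n.+2%:R by rewrite ltr0n.
have q1 : (n.+2%:R : R)^-1 < 1 by rewrite invf_lt1 // ltr1n.
have q2 : -1 < - (n.+2%:R : R)^-1 by rewrite ltrN2.
have := le_ln1Dx q2.
have -> : 1 - (n.+2%:R : R)^-1 = n.+1%:R / n.+2%:R.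
  by rewrite -[n.+1%:R](addrK 1) natr1 mulrBl mulfV ?gt_eqF // mul1r.
rewrite ln_div ?posrE // -addrA lerD2l.
by move: (ln n.+1%:R) (ln n.+2%:R) (n.+2%:R^-1) => u v w; lra.
Qed.

Lemma ln_le_powR (x e : R) : 1 <= x -> 0 < e -> ln x <= e^-1 * x `^ e.
Proof.
move=> x1 e0; rewrite ler_pdivlMl // -ln_powR; apply/ltW/ln_sublinear/powR_gt0.
exact: lt_le_trans x1.
Qed.

Lemma pbound_harmonic (y : nat -> nat) e d : (forall h, (0 < y h)%N) -> 0 < d ->
  pbound (fun h => (y h)%:R) e ->
  pbound (fun h => 2 * \sum_(a < y h) ((a.+1)%:R : R)^-1) (e * d).
Proof.
move=> y0 d0 /(pbound_powR (ltW d0)) Hy.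
have c0 : 0 <= 2 * (1 + d^-1) by rewrite mulr_ge0 // addr_ge0 // invr_ge0 ltW.
apply: pboundW (pbound_le _ (pboundM (pbound_cst c0) Hy)); first by rewrite add0r.
move=> h _; rewrite mulr_ge0 //=; last by apply: sumr_ge0 => a _; rewrite invr_ge0.
rewrite -mulrA; apply: ler_wpM2l => //; have := y0 h; case: (y h) => // n _.
have n1 : (1 : R) <= n.+1%:R by rewrite ler1n.
apply: le_trans (harmonic_le n) _; rewrite mulrDl mul1r; apply: lerD; last exact: ln_le_powR.
by rewrite -[leLHS](powRr0 n.+1%:R); apply: ler_powR => //; exact: ltW.
Qed.

End PowerBounds.

Section MomentAsymptotics.
Import mathcomp.boot.fintype mathcomp.boot.finset.
Variables (R : realType) (B : set nat) (alpha : R).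
Hypothesis hB : sieving_set R B.
Hypothesis halpha : 0 < alpha < 1.
Hypothesis hindex : has_index (semigroup_gen B) alpha.
Local Notation Bidx := (Bidx B).
Local Notation ddB L := (dd (@bval B L)).
Local Notation momB := (@momB R B).

(** At least [h ^ alpha] sets [V] satisfy [8 * h <= dd V <= x] with [x = h ^ (1 + e)]. For each,
    [y / dd V >= h ^ (eps / 2)] makes the tail in [coeff_ge] at most [c / 2], so its Bessel
    coefficient is at least [h / 2 * (c / 2 / x) = c / 4 * h ^ (- e)]. *)
Lemma momB2_ge (eps eta : R) : 0 < eps -> 0 < eta -> exists h0 : nat,
  forall h y : nat, (h0 <= h)%N -> h%:R `^ (1 + eps) <= (y%:R : R) ->
  h%:R `^ (alpha - eta) <= momB y h 2.
Proof.
move=> eps0 eta0; have /andP[a0 a1] := halpha.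
pose e := Num.min 1 (Num.min (eps / 2) (eta / 8)).
have e0 : 0 < e by rewrite !lt_min ltr01 !divr_gt0.
have e1 : e <= 1 by rewrite ge_min lexx.
have e2 : e <= eps / 2 by rewrite !ge_min lexx !orbT.
have e3 : e <= eta / 8 by rewrite !ge_min lexx !orbT.
pose s := (alpha + 1) / 2; have as_ : alpha < s by rewrite /s; lra.
have s1 : s <= 1 by rewrite /s; lra.
have [Z Z0 HZ] := dd_sum_le hB halpha hindex as_.
have [c c0 Hc] := prod_onem_ge hB halpha hindex.
(* Small enough that the lower count at [x], with exponent [(1 + e) * (alpha - eta1)], beats the
   upper count at [8 * h], with exponent [alpha + eta1]. *)
pose eta1 := e * alpha / 4.
have eta10 : 0 < eta1 by rewrite divr_gt0 // mulr_gt0.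
have as1 : alpha < alpha + eta1 by rewrite ltrDl.
have [Z1 Z10 HZ1] := dd_sum_le hB halpha hindex as1.
have [x0 x01 Hx0] := index_lower hB halpha hindex eta10.
pose C1 := Z1 * 8 `^ (alpha + eta1) + 1.
have ee : alpha + eta1 < (1 + e) * (alpha - eta1).
  have E : (1 + e) * (alpha - eta1) - (alpha + eta1) = e * alpha * ((2 - e) / 4).
    by rewrite /eta1; field.
  by rewrite -subr_gt0 E; apply: mulr_gt0; [exact: mulr_gt0 | lra].
have [x1 x11 Hx1] := @powR_dom R C1 _ _ ee.
have ee2 : alpha - eta < alpha - 2 * e by lra.
have [x2 x21 Hx2] := @powR_dom R (16 / c ^+ 2) _ _ ee2.
have ee3 : eps / 2 * (s - 1) < 0 by rewrite nmulr_llt0 ?divr_gt0 // /s; lra.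
have [x3 x31 Hx3] := @powR_dom R (2 * Z / c) _ _ ee3.
exists (Num.truncn (x0 + x1 + x2 + x3)).+1 => h y hh hy.
have hx : x0 + x1 + x2 + x3 <= h%:R.
  by apply: le_trans (_ : (Num.truncn (x0 + x1 + x2 + x3)).+1%:R <= _); [exact/ltW/truncnS_gt | rewrite ler_nat].
have hx0 : x0 <= h%:R by lra.
have hx1 := Hx1 h%:R ltac:(lra); have hx2 := Hx2 h%:R ltac:(lra).
have hx3 := Hx3 h%:R ltac:(lra).
have h1 : 1 <= (h%:R : R) by lra.
have h0r : 0 < (h%:R : R) by lra.
have h0 : (0 < h)%N by rewrite -(ltr0n R).
pose x : R := h%:R `^ (1 + e).
have hp : h%:R `^ (1 + e) <= (y%:R : R).
  by apply: le_trans hy; apply: ler_powR => //; lra.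
have xx : h%:R <= x by rewrite -[leLHS]powRr1 ?(ltW h0r) //; apply: ler_powR => //; lra.
have x_gt0 : 0 < x by apply: lt_le_trans xx.
have y0r : (0 : R) < y%:R by apply: lt_le_trans hp.
have y0 : (0 < y)%N by rewrite -(ltr0n R).
pose L := y.+1.
have xL : (Num.truncn x < L)%N.
  by rewrite ltnS -(ler_nat R); apply: le_trans hp; have /andP[] := truncn_itv (ltW x_gt0).
have cardx := Hx0 x L (le_trans hx0 xx) xL.
have e8 : (0 : R) <= (8 * h)%N%:R by [].
have card8 := @card_dd_rankin R B hB _ _ HZ1 ltac:(lra) L _ e8.
pose W : {set {set Bidx L}} := [set V | (8 * h <= ddB L V)%N && ((ddB L V)%:R <= x)].
have cardW : h%:R `^ alpha <= (#|W|%:R : R).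
  pose Ax : {set {set Bidx L}} := [set S | ((ddB L S)%:R : R) <= x].
  pose A8 : {set {set Bidx L}} := [set S | ((ddB L S)%:R : R) <= (8 * h)%N%:R].
  have sub : (#|Ax| <= #|W| + #|A8|)%N.
    apply: leq_trans (leq_card_setU _ _); apply: subset_leq_card; apply/subsetP => S.
    by rewrite !inE => ->; rewrite andbT ler_nat leq_total.
  rewrite -(ler_nat R) natrD in sub.
  have E1 : x `^ (alpha - eta1) = h%:R `^ ((1 + e) * (alpha - eta1)) by rewrite /x -powRrM.
  have E2 : ((8 * h)%N%:R : R) `^ (alpha + eta1) = 8 `^ (alpha + eta1) * h%:R `^ (alpha + eta1).
    by rewrite natrM powRM.
  rewrite E1 -/Ax in cardx; rewrite E2 mulrA -/A8 in card8; rewrite /C1 mulrDl mul1r in hx1.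
  have : (h%:R : R) `^ alpha <= h%:R `^ (alpha + eta1) by apply: ler_powR => //; exact: ltW.
  lra.
have W8 V : V \in W -> (8 * h <= ddB L V)%N by rewrite inE => /andP[].
have := @mom2_ge R _ _ (@bval_gt1 R B hB L) (@bval_coprime R B hB L) h (Dset B L y) W W8 h0.
apply: le_trans.
pose q : R := c / 4 * h%:R `^ (- e).
have q0 : 0 <= q by rewrite mulr_ge0 ?powR_ge0 // divr_ge0 // ltW.
apply: le_trans (_ : h%:R `^ alpha * q ^+ 2 <= _).
  have -> : h%:R `^ alpha * q ^+ 2 = c ^+ 2 / 16 * h%:R `^ (alpha - 2 * e).
    have -> : alpha - 2 * e = alpha + (- e + - e) by ring.
    by rewrite !powRD ?(gt_eqF h0r) ?implybT // /q; field.
  by rewrite -ler_pdivrMl ?divr_gt0 ?exprn_gt0 // invf_div.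
apply: le_trans (_ : #|W|%:R * q ^+ 2 <= _); first by apply: ler_wpM2r; rewrite ?sqr_ge0.
rewrite mulr_natl -sumr_const; apply: ler_sum => V VW.
have VW2 : ((ddB L V)%:R : R) <= x by move: VW; rewrite inE => /andP[].
set d : R := (ddB L V)%:R in VW2.
have d0 : 0 < d by rewrite ltr0n dd_gt0 //; exact: (bval_gt1 hB).
have := coeff_ge hB halpha as_ s1 c0 HZ Hc V y0; rewrite -/d.
set sg := \sum_(S in _ | _) _ => hsg.
rewrite -[leRHS]real_normK ?num_real //; apply: lerXn2r; rewrite ?nnegrE //.
rewrite normrM ger0_norm ?divr_ge0 //.
have r1 : h%:R `^ (eps / 2) <= y%:R / d.
  rewrite ler_pdivlMr //; apply: le_trans hy.
  apply: le_trans (_ : h%:R `^ (eps / 2) * h%:R `^ (1 + e) <= _).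
    by apply: ler_wpM2l => //; exact: powR_ge0.
  by rewrite -powRD ?(gt_eqF h0r) ?implybT //; apply: ler_powR => //; lra.
have r2 : Z * (y%:R / d) `^ (s - 1) <= c / 2.
  apply: le_trans (_ : Z * h%:R `^ (eps / 2 * (s - 1)) <= _).
    apply: ler_wpM2l; first exact: ltW.
    by rewrite powRrM; apply: ler_powRn => //; rewrite ?powR_gt0 //; lra.
  have -> : Z * h%:R `^ (eps / 2 * (s - 1)) = c / 2 * (2 * Z / c * h%:R `^ (eps / 2 * (s - 1))).
    by field; rewrite gt_eqF.
  rewrite -[leRHS]mulr1; apply: ler_wpM2l; first by rewrite divr_ge0 // ltW.
  by rewrite powRr0 in hx3.
have r3 : c / 2 / d <= `|sg|.
  by apply: le_trans hsg; apply: ler_wpM2r; rewrite ?invr_ge0 ?(ltW d0) //; lra.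
apply: le_trans (_ : h%:R / 2 * (c / 2 / x) <= _); last first.
  apply: ler_wpM2l; first by rewrite divr_ge0.
  apply: le_trans r3; apply: ler_wpM2l; first by rewrite divr_ge0 // ltW.
  by rewrite lef_pV2 ?posrE.
have -> : h%:R / 2 * (c / 2 / x) = c / 4 * (h%:R / x) by field; rewrite gt_eqF.
rewrite /q; apply: ler_wpM2l; first by rewrite divr_ge0 // ltW.
rewrite /x powRD ?(gt_eqF h0r) ?implybT // powRr1 ?(ltW h0r) // powRN invfM mulrA mulfV ?mul1r //.
by rewrite gt_eqF.
Qed.

Lemma momB0 y h : momB y h 0 = 1.
Proof.
rewrite /momB /mom; under eq_bigr do rewrite expr0.
rewrite sumr_const card_ord mulVf // pnatr_eq0 -lt0n dd_gt0 //.
exact: (bval_gt1 hB).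
Qed.

Lemma momB1 y h : momB y h 1 = 0.
Proof.
have Q0 : (0 : R) < (ddB y.+1 [set: Bidx y.+1])%:R.
  by rewrite ltr0n dd_gt0 //; exact: (bval_gt1 hB).
rewrite /momB /mom; under eq_bigr do rewrite expr1.
rewrite /fsum exchange_big /= mulr_sumr big1 // => S _.
rewrite -mulr_sumr mulrCA [X in _ * X](_ : _ = 0) ?mulr0 //.
rewrite /saw sumrB mulrBr (mean_hits R (@bval_gt1 R B hB y.+1)) sumr_const card_ord.
set q := h%:R / _; rewrite -(mulr_natl q (ddB _ _)).
by rewrite mulrA mulVf ?(gt_eqF Q0) // mul1r subrr.
Qed.

(** Defined by the recursion that the normalized moments satisfy in the limit; [gE_pow] identifies
    the values with the moments of the normal density. *)
Fixpoint gauss_moment (k : nat) : R :=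
  if k is n.+2 then n.+1%:R * gauss_moment n else (k == 0%N)%:R.

Section ParameterChoice.
Variable K : nat.
Let M := K.+3.
(** The balance of [exponent_lt]: the saved factor [t] is worth [alpha / (2 * M)] in the exponent,
    [eps] makes the cost [k * eps] of truncating above [h] at most [alpha / (4 * M)], and [kap] does
    the same for the roughly [3 * k] divisor and harmonic factors. The choice
    [eta = eps * (1 - alpha) / 8] leaves the gap needed in [tail_cvg]. *)
Let eps : R := alpha / (4 * M%:R * K.+1%:R).
Let eta : R := eps * (1 - alpha) / 8.
Let kap : R := alpha / (16 * M%:R * (3 * K.+1%:R)).

(* [y = t ^ M] is about [h ^ (1 + eps)]; taking an exact [M]-th power makes the factor
   [t] saved by the non-diagonal tuples an integer. *)
Definition tpar (h : nat) : nat := (Num.truncn ((h%:R : R) `^ ((1 + eps) / M%:R))).+1.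
Definition ypar (h : nat) : nat := (tpar h ^ M)%N.

Let M0 : (0 : R) < M%:R. Proof. by rewrite ltr0n. Qed.
Let K0 : (0 : R) < K.+1%:R. Proof. by rewrite ltr0n. Qed.
Let a0 : 0 < alpha. Proof. by case/andP: halpha. Qed.
Let a1 : alpha < 1. Proof. by case/andP: halpha. Qed.
Let eps0 : 0 < eps. Proof. by rewrite divr_gt0 // !mulr_gt0. Qed.
Let kap0 : 0 < kap. Proof. by rewrite divr_gt0 // !mulr_gt0. Qed.
Let eta0 : 0 < eta. Proof. by rewrite divr_gt0 // mulr_gt0 // subr_gt0. Qed.
Let eps_le : eps <= alpha / 4.
Proof.
rewrite /eps; apply: ler_wpM2l; first exact: ltW.
have p : (0 : R) < 4 * M%:R * K.+1%:R by rewrite !mulr_gt0.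
rewrite lef_pV2 ?posrE // -mulrA ler_peMr // -natrM ler1n muln_gt0 //.
Qed.
Let eta_le : eta <= eps / 8.
Proof.
rewrite /eta; apply: ler_wpM2r => //; rewrite ler_piMr ?(ltW eps0) //; have := a0; lra.
Qed.
Let as_ : alpha < alpha + eta. Proof. by rewrite ltrDl. Qed.
Let as1 : alpha + eta < 1.
Proof.
have := eps_le; have := a1; have := a0; rewrite /eta => p1 p2 p3.
have : eps * (1 - alpha) <= 1 * (1 - alpha) by apply: ler_wpM2r; lra.
lra.
Qed.

Lemma tpar_ge h : (h%:R : R) `^ ((1 + eps) / M%:R) <= (tpar h)%:R.
Proof. exact/ltW/truncnS_gt. Qed.

Lemma pbound_tpar : pbound (fun h => ((tpar h)%:R : R)) ((1 + eps) / M%:R).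
Proof.
exists 2 => // h h0; rewrite ler0n /= /tpar.
set x := _ `^ _; have x1 : 1 <= x.
  rewrite /x -[leLHS](powRr0 h%:R); apply: ler_powR; first by rewrite ler1n.
  by rewrite divr_ge0 // ?(ltW M0) //; have := eps0; lra.
have /andP[t1 _] := truncn_itv (le_trans ler01 x1).
rewrite -natr1; lra.
Qed.

Lemma ypar_gt0 h : (0 < ypar h)%N. Proof. by rewrite expn_gt0. Qed.

Lemma ypar_ge h : (h%:R : R) `^ (1 + eps) <= (ypar h)%:R.
Proof.
have -> : (h%:R : R) `^ (1 + eps) = (h%:R `^ ((1 + eps) / M%:R)) ^+ M.
  by rewrite -powR_mulrn ?powR_ge0 // -powRrM; congr (_ `^ _); field; rewrite gt_eqF.
by rewrite /ypar natrX; apply: lerXn2r; rewrite ?nnegrE ?powR_ge0 //; exact: tpar_ge.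
Qed.

Lemma pbound_ypar : pbound (fun h => ((ypar h)%:R : R)) (1 + eps).
Proof.
have -> : 1 + eps = M%:R * ((1 + eps) / M%:R) by field; rewrite gt_eqF.
apply: pbound_le (pboundX M pbound_tpar) => h _; rewrite ler0n /= /ypar natrX; exact: lexx.
Qed.

Let s := alpha + eta.

Lemma tau_exists d : 0 < d -> exists2 tau : nat -> nat,
  pbound (fun h => ((tau h)%:R : R)) d &
  forall h (S : {set Bidx (ypar h).+1}), (ddB (ypar h).+1 S <= 2 * ypar h ^ K.+2)%N -> (2 ^ #|S| <= tau h)%N.
Proof.
move=> d0.
pose q := (Num.truncn (K.+2%:R * (1 + eps) / d)).+1.
have q0r : (0 : R) < q%:R by rewrite ltr0n.
have qd : K.+2%:R * (1 + eps) * q%:R^-1 <= d.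
  by rewrite ler_pdivrMr // [leRHS]mulrC -ler_pdivrMr //; exact/ltW/truncnS_gt.
pose A : nat := ((2 ^ q) ^ 2 ^ q)%N.
pose G h : R := (A%:R * (2 * (ypar h)%:R ^+ K.+2)) `^ q%:R^-1.
exists (fun h => Num.truncn (G h)) => [|h S hS].
  apply: pboundW qd _; apply: pbound_le (pbound_powR _ _); last first.
  - rewrite -[K.+2%:R * _]add0r; apply: pboundM (pbound_cst _) _; first exact: (ler0n R A).
    rewrite -[K.+2%:R * _]add0r; apply: pboundM (pbound_cst _) _; first exact: (ler0n R 2).
    exact: pboundX pbound_ypar.
  - by rewrite invr_ge0.
  - by move=> h _; rewrite ler0n /=; have /andP[] := truncn_itv (powR_ge0 _ _ : 0 <= G h).
rewrite truncn_ge_nat ?powR_ge0 //; apply: le_trans (exp2_card_pow hB S (ltn0Sn _ : 0 < q)%N) _.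
have g0 : 0 <= A%:R * (2 * (ypar h)%:R ^+ K.+2) :> R.
  by apply: mulr_ge0 => //; apply: mulr_ge0 => //; exact: exprn_ge0.
apply: ge0_ler_powR; rewrite ?nnegrE ?invr_ge0 //.
apply: ler_wpM2l => //; rewrite -natrX -natrM ler_nat; exact: hS.
Qed.

(** Since [y = t ^ M], the condition reads [dd S <= t ^ ((M * n.+2 - 1) / 2)], and Rankin's trick
    turns the saved [t] into a power of [h]. *)
Lemma card_pbound n Z : (n.+2 <= K)%N ->
  (forall L, \sum_(S : {set Bidx L}) ((ddB L S)%:R : R) `^ (- s) <= Z) -> 0 < Z ->
  pbound (fun h => (#|[set S : {set Bidx (ypar h).+1} | (ddB (ypar h).+1 S ^ 2 * tpar h <= ypar h ^ n.+2)%N]|%:R : R))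
    ((1 + eps) / M%:R * ((M * n.+2).-1%:R / 2 * s)).
Proof.
move=> nK HZ Z0; have s0 : 0 <= s by have := a0; have := eta0; rewrite /s; lra.
have e0 : 0 <= (M * n.+2).-1%:R / 2 * s by rewrite mulr_ge0 // divr_ge0.
have PB := pboundM (pbound_cst (ltW Z0)) (pbound_powR e0 pbound_tpar).
rewrite add0r in PB; apply: pbound_le PB => h _; rewrite ler0n /= powRrM.
have t0 : (0 < tpar h)%N by [].
have u0 : 0 <= ((tpar h)%:R : R) `^ ((M * n.+2).-1%:R / 2) by exact: powR_ge0.
apply: le_trans (card_dd_rankin hB HZ s0 (ypar h).+1 u0); rewrite ler_nat.
apply: subset_leq_card; apply/subsetP => S; rewrite !in_set => hS.
have d2 : (ddB (ypar h).+1 S ^ 2 <= tpar h ^ (M * n.+2).-1)%N.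
  by rewrite -(leq_pmul2r t0); apply: leq_trans hS _; rewrite /ypar -expnM -expnSr prednK.
rewrite -(ler_pXn2r (ltn0Sn 1)) ?nnegrE //.
rewrite -[leRHS]powR_mulrn ?powR_ge0 // -powRrM -mulrA mulVf // mulr1 powR_mulrn //.
by rewrite -!natrX ler_nat.
Qed.

(** In units of [alpha / M], the costs are at most [1 / 16] from [kap], [1 / 8] from [eps] and
    [1 / 32] from [eta], against the saving [1 / 2]; the main terms [k * alpha / 2] cancel. *)
Lemma exponent_lt n : (n.+2 <= K)%N ->
  n.+2%:R * kap + (n.+2%:R * kap + ((1 + eps) / M%:R * ((M * n.+2).-1%:R / 2 * s) + (n.+2%:R * kap + kap)))
  < n.+2%:R * ((alpha - eta) / 2).
Proof.
move=> nK; set k : R := n.+2%:R.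
have kK : k + 1 <= K.+1%:R by rewrite natr1 ler_nat.
have k2 : 2 <= k by rewrite ler_nat.
have E1 : (M * n.+2).-1%:R = M%:R * k - 1 :> R by rewrite -subn1 natrB ?muln_gt0 // natrM.
have c1 : (3 * k + 1) * kap <= alpha / (16 * M%:R).
  have -> : alpha / (16 * M%:R) = 3 * K.+1%:R * kap.
    by rewrite /kap; field; rewrite !gt_eqF.
  by apply: ler_wpM2r; [exact: ltW | lra].
have c2 : k * eps <= alpha / (4 * M%:R).
  have -> : alpha / (4 * M%:R) = K.+1%:R * eps by rewrite /eps; field; rewrite !gt_eqF.
  by apply: ler_wpM2r; [exact: ltW | lra].
have p0 : 0 < alpha / M%:R by rewrite divr_gt0.
have e1 : eps <= 1 / 4 by have := eps_le; have := a1; lra.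
have ke : k * eta <= k * eps / 8 by rewrite -mulrA; apply: ler_wpM2l; [lra|].
have kes : k * eps * s <= k * eps.
  apply: ler_piMr; last exact: ltW.
  by apply: mulr_ge0; [lra | exact: ltW].
have E2 : (1 + eps) / M%:R * ((M * n.+2).-1%:R / 2 * s)
  = k * s / 2 + k * eps * s / 2 - (1 + eps) * s / (2 * M%:R).
  by rewrite E1; field; rewrite gt_eqF.
have E3 : alpha / (2 * M%:R) <= (1 + eps) * s / (2 * M%:R).
  apply: ler_wpM2r; first by rewrite invr_ge0 mulr_ge0 // ltW.
  have : 0 <= eps * s by rewrite mulr_ge0 ?(ltW eps0) // /s; have := eta0; have := a0; lra.
  by rewrite mulrDl mul1r /s; have := eta0; lra.
rewrite E2.
have F1 : alpha / (16 * M%:R) = alpha / M%:R / 16 by field; rewrite gt_eqF.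
have F2 : alpha / (4 * M%:R) = alpha / M%:R / 4 by field; rewrite gt_eqF.
have F3 : alpha / (2 * M%:R) = alpha / M%:R / 2 by field; rewrite gt_eqF.
rewrite F1 in c1; rewrite F2 in c2; rewrite F3 in E3.
have -> : k * s / 2 = k * alpha / 2 + k * eta / 2 by rewrite /s; ring.
have -> : k * ((alpha - eta) / 2) = k * alpha / 2 - k * eta / 2 by ring.
rewrite mulrDl mul1r -mulrA in c1.
move: c1 c2 E3 ke kes p0.
set p := alpha / M%:R; set ke1 := k * eps; set ke2 := k * eta; set kk := k * kap.
lra.
Qed.

Lemma momB2_ypar_ge : exists h0 : nat, forall h, (h0 <= h)%N ->
  (h%:R : R) `^ (alpha - eta) <= momB (ypar h) h 2.
Proof.
have [h0 H0] := momB2_ge eps0 eta0; exists h0 => h hh; apply: H0 => //; exact: ypar_ge.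
Qed.

Lemma momB_rec_cvg n : (n.+2 <= K)%N ->
  (`|momB (ypar h) h n.+2 - n.+1%:R * momB (ypar h) h 2 * momB (ypar h) h n|
   / Num.sqrt (momB (ypar h) h 2) ^+ n.+2 @[h --> \oo] --> (0 : R))%classic.
Proof.
move=> nK.
have [Z Z0 HZ] := dd_sum_le hB halpha hindex as_.
have kk : 0 < kap / (1 + eps) by rewrite divr_gt0 //; have := eps0; lra.
have PH := pbound_harmonic ypar_gt0 kk pbound_ypar.
have Ek : (1 + eps) * (kap / (1 + eps)) = kap by field; have := eps0; lra.
rewrite Ek in PH.
have [tau Ptau Htau] := tau_exists kap0.
have PC := card_pbound nK HZ Z0.
set Cf := fun h : nat => _ in PC.
have P1 := pboundM (pboundX n.+2 PH) (pboundM (pboundX n.+2 Ptau) (pboundM PC (pboundM (pboundX n.+2 Ptau) Ptau))).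
have PT := pboundM (pbound_cst (ler0n R (n.+2 * n.+3)%N)) P1.
rewrite add0r in PT.
apply: (@pbound_cvg0 R _ _ _ (n.+2%:R * ((alpha - eta) / 2))); last first.
- have [h0 Hh0] := momB2_ypar_ge; exists h0 => h hh.
  have hm := Hh0 h hh; rewrite mulrC powRrM powR_mulrn ?powR_ge0 //.
  apply: lerXn2r; rewrite ?nnegrE ?powR_ge0 ?sqrtr_ge0 //.
  by rewrite powRrM powR12_sqrt ?powR_ge0 //; exact: ler_wsqrtr.
- exact: exponent_lt nK.
apply: pbound_le PT => h h0; rewrite normr_ge0 /=.
have y0 := ypar_gt0 h; set y := ypar h in y0 *.
(* The level [2 * y ^ K.+2] meets the three size requirements of [mom_rec_le] at once. *)
have H2 : (2 * y ^ 2 <= 2 * y ^ K.+2)%N by rewrite leq_mul2l leq_pexp2l.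
have H1 : (y <= 2 * y ^ K.+2)%N.
  by apply: leq_trans H2; rewrite expnS expn1 mulnCA leq_pmulr // muln_gt0 y0.
have H3 : (y ^ n.+2 <= 2 * y ^ K.+2)%N.
  apply: leq_trans (_ : y ^ K.+2 <= _)%N; last by rewrite leq_pmull.
  by apply: leq_pexp2l => //; apply: leq_trans nK _; rewrite -addn2 leq_addr.
have Dd : Dset B y.+1 y = [set S | dd (@bval B y.+1) S <= tpar h ^ M]%N by [].
have nM : (n.+2 < M)%N by rewrite ltnS; apply: leq_trans nK _; rewrite -addn2 leq_addr.
have := @mom_rec_le R _ _ (@bval_gt1 R B hB y.+1) (@bval_coprime R B hB y.+1) h
  (tpar h) M n (2 * y ^ K.+2)%N (tau h) _ _ Dd (ltn0Sn _) nM H1 H2 H3 (Htau h) (leqnn _).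
rewrite -/(momB y h 2) -/(momB y h n) -/(momB y h n.+2) => /le_trans; apply.
change (tpar h ^ M)%N with y.
rewrite /Cf -/y -(natrX R (tau h) n.+2); set T := (tau h ^ n.+2)%N; rewrite !natrM.
by rewrite le_eqVlt; apply/orP; left; apply/eqP; ring.
Qed.

Lemma moments_cvg k : (k <= K)%N ->
  (momB (ypar h) h k / Num.sqrt (momB (ypar h) h 2) ^+ k @[h --> \oo] --> gauss_moment k)%classic.
Proof.
elim/ltn_ind: k => -[_ _|[_ _|n IH nK]].
- under eq_fun do rewrite momB0 expr0 divr1; exact: cvg_cst.
- under eq_fun do rewrite momB1 mul0r; exact: cvg_cst.
have IHn := IH n (leqnSn _) (ltnW (ltnW nK)).
have rec0 := momB_rec_cvg nK; have [h0 Hh0] := momB2_ypar_ge.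
pose m2 h := momB (ypar h) h 2.
pose D h := momB (ypar h) h n.+2 - n.+1%:R * momB (ypar h) h 2 * momB (ypar h) h n.
have rec1 : (D h / Num.sqrt (m2 h) ^+ n.+2 @[h --> \oo] --> (0 : R))%classic.
  apply/norm_cvg0P; apply: cvg_trans rec0; apply: near_eq_cvg; near=> h.
  by rewrite normrM normfV [`|_ ^+ n.+2|]ger0_norm // exprn_ge0 // sqrtr_ge0.
rewrite -[gauss_moment n.+2]add0r.
have lim1 : (n.+1%:R * (momB (ypar h) h n / Num.sqrt (momB (ypar h) h 2) ^+ n)
    @[h --> \oo] --> n.+1%:R * gauss_moment n)%classic by apply: cvgMr IHn.
apply: cvg_trans; last exact: (cvgD rec1 lim1).
 apply: near_eq_cvg; near=> h => /=.
have m20 : 0 < m2 h.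
  apply: lt_le_trans (Hh0 h _); last by near: h; exact: nbhs_infty_ge.
  by rewrite powR_gt0 // ltr0n; near: h; exact: nbhs_infty_gt.
change ((momB (ypar h) h n.+2 - n.+1%:R * m2 h * momB (ypar h) h n) / Num.sqrt (m2 h) ^+ n.+2
  + n.+1%:R * (momB (ypar h) h n / Num.sqrt (m2 h) ^+ n)
  = momB (ypar h) h n.+2 / Num.sqrt (m2 h) ^+ n.+2).
have q := sqr_sqrtr (ltW m20).
have r0 : 0 < Num.sqrt (m2 h) by rewrite sqrtr_gt0.
set r := Num.sqrt (m2 h) in q r0 *; rewrite -q.
rewrite [r ^+ n.+2](_ : _ = r ^+ 2 * r ^+ n); last by rewrite -exprD add2n.
by field; rewrite expf_eq0 !(gt_eqF r0) andbF.
Unshelve. all: by end_near. Qed.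

(** The truncation error has exponent [1 + (1 + eps) * (s - 1)], the variance at least
    [alpha - eta]. The gap is [eps * (1 - alpha) - 2 * eta - eps * eta], positive because the first
    term is [8 * eta]. *)
Lemma tail_cvg : ((1 + h%:R * (ypar h)%:R `^ (s - 1)) / momB (ypar h) h 2 @[h --> \oo] --> (0 : R))%classic.
Proof.
have P1 : pbound (fun h => h%:R * ((ypar h)%:R : R) `^ (s - 1)) (1 + (1 + eps) * (s - 1)).
  exists 1 => // h h0; rewrite mulr_ge0 ?powR_ge0 //= mul1r.
  have hr : (0 : R) < h%:R by rewrite ltr0n.
  rewrite [leRHS]powRD ?(gt_eqF hr) ?implybT // powRr1 ?(ltW hr) //; apply: ler_wpM2l => //.
  rewrite powRrM; apply: ler_powRn; rewrite ?powR_gt0 ?ypar_ge //.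
  by have := as1; rewrite /s; lra.
pose f := Num.max 0 (1 + (1 + eps) * (s - 1)).
have P2 : pbound (fun h => 1 + h%:R * ((ypar h)%:R : R) `^ (s - 1)) f.
  apply: pboundD; first by apply: pboundW (pbound_cst ler01); rewrite le_max lexx.
  by apply: pboundW P1; rewrite le_max lexx orbT.
apply: pbound_cvg0 P2 _ momB2_ypar_ge.
have p1 := eps_le; have p2 := eta_le; have p3 := eps0; have p4 := a0; have p5 := a1; have p6 := eta0.
rewrite gt_max; apply/andP; split; first lra.
have E : alpha - eta - (1 + (1 + eps) * (s - 1)) = eps * (1 - alpha) - 2 * eta - eps * eta.
  by rewrite /s; ring.
rewrite -subr_gt0 E.
have E2 : eps * (1 - alpha) = 8 * eta by rewrite /eta; field.
rewrite E2; have : eps * eta <= 1 * eta by apply: ler_wpM2r; lra.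
lra.
Qed.

End ParameterChoice.

Theorem momB_gauss K : exists (beta : R) (y : nat -> nat),
  [/\ alpha < beta < 1, forall h, (0 < y h)%N,
      pbound (fun h => (y h)%:R : R) 2,
      ((1 + h%:R * (y h)%:R `^ (beta - 1)) / momB (y h) h 2 @[h --> \oo] --> (0 : R))%classic &
      (exists h0 : nat, forall h, (h0 <= h)%N -> 1 <= momB (y h) h 2) /\
      forall k, (k <= K)%N ->
      (momB (y h) h k / Num.sqrt (momB (y h) h 2) ^+ k @[h --> \oo] --> gauss_moment k)%classic].
Proof.
have /andP[p4 p5] := halpha.
pose eps : R := alpha / (4 * K.+3%:R * K.+1%:R); pose eta := eps * (1 - alpha) / 8.
have e0 : 0 < eps by rewrite divr_gt0 // !mulr_gt0 ?ltr0n.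
have e1 : eps <= alpha / 4.
  rewrite /eps; apply: ler_wpM2l; first exact: ltW.
  by rewrite lef_pV2 ?posrE ?mulr_gt0 ?ltr0n // -mulrA ler_peMr // -natrM ler1n muln_gt0.
have q0 : 0 < eta by rewrite divr_gt0 // mulr_gt0 // subr_gt0.
have q1 : eta <= (1 - alpha) / 8.
  by apply: ler_wpM2r => //; rewrite ler_piMl ?subr_ge0 ?(ltW p5) //; lra.
exists (alpha + eta), (ypar K); split; first lra.
- exact: ypar_gt0.
- by apply: pboundW (pbound_ypar K); rewrite -/eps; lra.
- exact: tail_cvg.
split; last exact: moments_cvg.
have q2 : eta <= alpha / 4.
  by apply: le_trans e1; rewrite /eta ler_pdivrMr // ler_pM2l //; lra.
have [h0 Hh0] := momB2_ypar_ge K; exists (maxn 1 h0) => h; rewrite geq_max => /andP[h1 hh].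
apply: le_trans (Hh0 h hh); rewrite -[leLHS](powRr0 h%:R); apply: ler_powR; first by rewrite ler1n.
rewrite -/eps -/eta; lra.
Qed.

End MomentAsymptotics.

Local Open Scope classical_set_scope.
Local Open Scope ring_scope.

(** * Gaussian moments *)

Section CosineTaylor.
Variable R : realType.
Implicit Types (f df : R -> R) (x p u : R).

Lemma is_derive_monomial n (x : R) :
  is_derive x 1 (fun y : R => y ^+ n.+1 / (n.+1)`!%:R) (x ^+ n / n`!%:R).
Proof.
have -> : (fun y : R => y ^+ n.+1 / (n.+1)`!%:R) = ((n.+1)`!%:R^-1 : R) \*: (id ^+ n.+1 : R -> R).
  by apply/funext => y; rewrite /= mulrC /GRing.scale /= fctE.
apply: is_derive_eq.
rewrite /GRing.scale /= mulr1 factS natrM; field.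
by rewrite pnatr_eq0 -lt0n fact_gt0 /= addrC natr1 pnatr_eq0.
Qed.

Lemma derive_le_monomial f df n : (forall x, is_derive x 1 f (df x)) -> f 0 = 0 ->
  (forall x, 0 <= x -> df x <= x ^+ n / n`!%:R) ->
  forall x, 0 <= x -> f x <= x ^+ n.+1 / (n.+1)`!%:R.
Proof.
move=> fd f0 dle x; rewrite le_eqVlt => /orP[/eqP <-|x0].
  by rewrite f0 expr0n mul0r.
pose G := (fun y : R => y ^+ n.+1 / (n.+1)`!%:R) - f.
have Gd (y : R) : is_derive y 1 G (y ^+ n / n`!%:R - df y).
  by apply: is_deriveB; exact: is_derive_monomial.
have Gc : {within `[0, x], continuous G}.
  by apply: derivable_within_continuous => y _; have [] := Gd y.
have [c] := @MVT R G _ 0 x x0 (fun y _ => Gd y) Gc.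
rewrite in_itv /= => /andP[c0 cx] E.
have : 0 <= G x - G 0 by rewrite E subr0 mulr_ge0 ?(ltW x0) // subr_ge0 dle // ltW.
by rewrite /G !fctE f0 expr0n mul0r subr0 subr0 subr_ge0.
Qed.

Lemma derive_norm_le_monomial f df n : (forall x, is_derive x 1 f (df x)) -> f 0 = 0 ->
  (forall x, `|df x| <= `|x| ^+ n / n`!%:R) ->
  forall x, `|f x| <= `|x| ^+ n.+1 / (n.+1)`!%:R.
Proof.
move=> fd f0 dle.
have key (g dg : R -> R) : (forall x, is_derive x 1 g (dg x)) -> g 0 = 0 ->
    (forall x, `|dg x| <= `|x| ^+ n / n`!%:R) -> forall x, 0 <= x -> `|g x| <= x ^+ n.+1 / (n.+1)`!%:R.
  move=> gd g0 gle x x0; rewrite ler_norml lerNl; apply/andP; split.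
    apply: (@derive_le_monomial (- g) (fun y => - dg y)) => //.
    - by rewrite fctE g0 oppr0.
    - move=> y y0; have := gle y; rewrite (ger0_norm y0); apply: le_trans.
      by rewrite -normrN ler_norm.
  apply: (@derive_le_monomial g dg) => // y y0.
  by have := gle y; rewrite (ger0_norm y0); apply: le_trans; exact: ler_norm.
move=> x; have [x0|x0] := leP 0 x; first by rewrite [in leRHS](ger0_norm x0); exact: (key f df).
have x0' : 0 <= - x by lra.
rewrite [in leRHS](ltr0_norm x0) -[in leLHS](opprK x).
apply: (@key (f \o -%R) (fun y => - df (- y)) _ _ _ (- x) x0').
- move=> y; have -> : - df (- y) = df (- y) * (- 1) by rewrite mulrN1.
  by apply: is_derive1_comp.
- by rewrite /= oppr0.
- by move=> y; rewrite normrN -(normrN y); exact: dle.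
Qed.

(** The [k]-th derivative of the cosine at [p]. *)
Definition cos_coef p k : R := cos (p + k%:R * (pi / 2)).
Definition cos_rem n p u : R := cos (u + p) - \sum_(k < n) cos_coef p k * (u ^+ k / k`!%:R).

(** Differentiating lowers the order by one and advances the phase by [pi / 2]; keeping [p]
    arbitrary therefore makes the remainder bound a plain induction on the order. *)
Lemma is_derive_cos_rem n p u : is_derive u 1 (cos_rem n.+1 p) (cos_rem n (p + pi / 2) u).
Proof.
have dc : is_derive u 1 (cos \o (fun y => y + p)) (- sin (u + p) * 1).
  apply: is_derive1_comp.
  have -> : (fun y : R => y + p) = (id + cst p : R -> R) by apply/funext.
  by apply: is_derive_eq; rewrite addr0.
have c0 : cos_rem 0 (p + pi / 2) u = - sin (u + p) * 1.
  by rewrite /cos_rem big_ord0 subr0 addrA cosDpihalf mulr1.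
elim: n => [|n IH].
  have -> : cos_rem 1 p = cos \o (fun y => y + p) - cst (cos_coef p 0).
    by apply/funext => y; rewrite /cos_rem big_ord1 fctE /= expr0 fact0 divr1 mulr1.
  rewrite c0 -[X in is_derive _ _ _ X]subr0; exact: (is_deriveB dc (is_derive_cst _ _ _)).
have -> : cos_rem n.+2 p = cos_rem n.+1 p - cos_coef p n.+1 \*: (fun y : R => y ^+ n.+1 / (n.+1)`!%:R).
  by apply/funext => y; rewrite /cos_rem [in LHS]big_ord_recr /= opprD addrA.
have -> : cos_rem n.+1 (p + pi / 2) u = cos_rem n (p + pi / 2) u - cos_coef p n.+1 *: (u ^+ n / n`!%:R).
  rewrite /cos_rem big_ord_recr /= opprD addrA; congr (_ - _ * _).
  by rewrite /cos_coef -addrA -natr1; congr (cos (_ + _)); ring.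
by apply: is_deriveB; apply: is_deriveZ; exact: is_derive_monomial.
Qed.

Lemma cos_taylor n p u : `|cos_rem n p u| <= `|u| ^+ n / n`!%:R.
Proof.
elim: n p u => [|n IH] p u.
  by rewrite /cos_rem big_ord0 subr0 expr0 fact0 divr1 ler_norml cos_geN1 cos_le1.
apply: (@derive_norm_le_monomial _ (cos_rem n (p + pi / 2))) => [x||x].
- exact: is_derive_cos_rem.
- rewrite /cos_rem big_ord_recl big1 => [|i _]; last by rewrite /= exprS mul0r mul0r mulr0.
  by rewrite /cos_coef /= mul0r add0r !addr0 expr0 fact0 divr1 mulr1 subrr.
- exact: IH.
Qed.

Lemma cos_lip (x y : R) : `|cos x - cos y| <= `|x - y|.
Proof.
have := @cos_taylor 1 y (x - y).
by rewrite /cos_rem big_ord1 subrK /cos_coef mul0r addr0 expr0 fact0 divr1 mulr1 expr1 (_ : 1`! = 1%N) // divr1.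
Qed.

End CosineTaylor.

Section Gaussian.
Variable R : realType.
Local Notation mu := (@lebesgue_measure R).
Implicit Types f g : R -> R.

Definition gw (x : R) : R := (Num.sqrt (2 * pi))^-1 * expR (- x ^+ 2 / 2).

Lemma gw_normal : normal_pdf 0 1 = gw :> (R -> R).
Proof.
rewrite normal_pdfE ?oner_neq0 //; apply/funext => x.
by rewrite /normal_peak /normal_fun /gw subr0 expr1n mul1r -(mulr_natl pi 2).
Qed.

Lemma gw_ge0 x : 0 <= gw x.
Proof. by rewrite -gw_normal normal_pdf_ge0. Qed.

Lemma gw_le1 x : gw x <= 1.
Proof.
rewrite /gw -[leRHS]mulr1; apply: ler_pM.
- by rewrite invr_ge0 sqrtr_ge0.
- exact: expR_ge0.
- have : 1 <= Num.sqrt (2 * pi) :> R.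
    rewrite -[leLHS]sqrtr1 ler_wsqrtr //; have := pi_ge2 R; lra.
  by move=> h; rewrite invf_le1 // (lt_le_trans ltr01).
- rewrite -[leRHS]expR0 ler_expR; have := sqr_ge0 x; lra.
Qed.

Lemma gw_cont : continuous gw.
Proof. by rewrite -gw_normal; apply: continuous_normal_pdf; rewrite oner_neq0. Qed.

Lemma integral_gw : (\int[mu]_x (gw x)%:E = 1)%E.
Proof. by rewrite -gw_normal integral_normal_pdf. Qed.

Definition gE f : R := \int[mu]_x (f x * gw x).
Definition gint f := mu.-integrable setT (EFin \o (fun x => f x * gw x)).

Lemma gint1 : gint (fun=> 1).
Proof.
rewrite /gint; have -> : (fun x => 1 * gw x) = normal_pdf 0 1 by apply/funext => x; rewrite mul1r gw_normal.
exact: integrable_normal_pdf.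
Qed.

Lemma gE1 : gE (fun=> 1) = 1.
Proof.
rewrite /gE /Rintegral; under eq_integral do rewrite mul1r.
by rewrite integral_gw.
Qed.

Lemma gintD f g : gint f -> gint g -> gint (fun x => f x + g x).
Proof.
move=> hf hg; rewrite /gint; have := integrableD measurableT hf hg.
by apply: eq_integrable => // x _; rewrite /= mulrDl EFinD.
Qed.

Lemma gintZ c f : gint f -> gint (fun x => c * f x).
Proof.
move=> hf; rewrite /gint; have := integrableZl measurableT c hf.
by apply: eq_integrable => // x _; rewrite /= -mulrA EFinM.
Qed.

Lemma gED f g : gint f -> gint g -> gE (fun x => f x + g x) = gE f + gE g.
Proof.
move=> hf hg; rewrite /gE -RintegralD //; apply: eq_Rintegral => x _; exact: mulrDl.
Qed.

Lemma gEZ c f : gint f -> gE (fun x => c * f x) = c * gE f.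
Proof.
move=> hf; rewrite /gE -RintegralZl //; apply: eq_Rintegral => x _; exact/esym/mulrA.
Qed.

Lemma gE_le f g : gint f -> gint g -> (forall x, f x <= g x) -> gE f <= gE g.
Proof.
move=> hf hg fg; apply: le_Rintegral => // x _; apply: ler_wpM2r => //; exact: gw_ge0.
Qed.

Lemma gint_le f g : measurable_fun setT f -> (forall x, `|f x| <= g x) -> gint g -> gint f.
Proof.
move=> mf fg hg; apply: le_integrable hg => //.
  apply/measurable_EFinP; apply: measurable_funM => //; rewrite -gw_normal; exact: measurable_normal_pdf.
move=> x _; rewrite /= lee_fin !normrM; apply: ler_wpM2r => //.
by apply: le_trans (fg x) _; exact: ler_norm.
Qed.

Lemma gint_pow_abs k : gint (fun x => `|x| ^+ k).
Proof.
pose C : R := 1 + 4 ^+ k.+1 * (k.+1)`!%:R.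
pose s : R := Num.sqrt 2.
have s0 : s != 0 by rewrite gt_eqF // sqrtr_gt0.
have Is : mu.-integrable setT (EFin \o (fun x => C * expR (- x ^+ 2 / 4))).
  have := integrableZl measurableT (C / normal_peak s) (integrable_normal_pdf 0 s).
  apply: eq_integrable => // x _; rewrite /= -EFinM; congr (_%:E).
  rewrite normal_pdfE // /normal_fun subr0 /s sqr_sqrtr //.
  have p0 : normal_peak s != 0 by rewrite gt_eqF // normal_peak_gt0.
  have -> : (2 : R) *+ 2 = 4 by rewrite -mulrnA.
  by field.
apply: le_integrable Is => //.
  apply/measurable_EFinP; apply: measurable_funM.
    by apply: measurable_funX; apply: continuous_measurable_fun; exact: norm_continuous.
  by rewrite -gw_normal; exact: measurable_normal_pdf.
move=> x _; rewrite /= lee_fin ger0_norm ?mulr_ge0 ?exprn_ge0 ?gw_ge0 //.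
apply: le_trans (ler_norm _).
apply: le_trans (_ : (C * expR (x ^+ 2 / 4)) * expR (- x ^+ 2 / 2) <= _); last first.
  by rewrite -mulrA -expRD le_eqVlt; apply/orP; left; apply/eqP; congr (_ * expR _); field.
apply: ler_pM; rewrite ?exprn_ge0 ?gw_ge0 //.
  have y0 : 0 <= x ^+ 2 / 4 by rewrite divr_ge0 ?sqr_ge0.
  have e1 : 1 <= expR (x ^+ 2 / 4) by rewrite -[leLHS]expR0 ler_expR.
  have := expR_ge1Dxn k y0; set e := expR _ in e1 *.
  rewrite exprMn exprVn -exprM => h.
  have F0 : (0 : R) < (k.+1)`!%:R by rewrite ltr0n fact_gt0.
  have P4 : (0 : R) < 4 ^+ k.+1 by rewrite exprn_gt0.
  have h2 : x ^+ (2 * k.+1) <= 4 ^+ k.+1 * (k.+1)`!%:R * e.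
    have : x ^+ (2 * k.+1) / 4 ^+ k.+1 / (k.+1)`!%:R <= e by lra.
    by rewrite ler_pdivrMr // ler_pdivrMr // mulrC mulrA mulrAC -mulrA.
  rewrite /C mulrDl mul1r; apply: le_trans (_ : 1 + x ^+ (2 * k.+1) <= _); last exact: lerD.
  have -> : x ^+ (2 * k.+1) = `|x| ^+ (2 * k.+1) by rewrite !exprM real_normK ?num_real.
  have [x1|x1] := leP `|x| 1.
    have : `|x| ^+ k <= 1 by rewrite exprn_ile1.
    have : 0 <= `|x| ^+ (2 * k.+1) by rewrite exprn_ge0.
    lra.
  have : `|x| ^+ k <= `|x| ^+ (2 * k.+1) by rewrite ler_weXn2l ?(ltW x1) //; lia.
  lra.
rewrite /gw -[leRHS]mul1r; apply: ler_wpM2r; first exact: expR_ge0.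
have h1 : 1 <= Num.sqrt (2 * pi) :> R.
  by rewrite -[leLHS]sqrtr1 ler_wsqrtr //; have := pi_ge2 R; lra.
by rewrite invf_le1 // (lt_le_trans ltr01).
Qed.

Lemma gint_pow k : gint (fun x => x ^+ k).
Proof.
apply: gint_le (gint_pow_abs k) => [|x]; last by rewrite normrX.
by apply: measurable_funX; exact: measurable_id.
Qed.

Lemma gint_bounded f C : measurable_fun setT f -> (forall x, `|f x| <= C) -> gint f.
Proof.
move=> mf fC; apply: (gint_le mf fC).
by have := gintZ C gint1; congr gint; apply/funext => x; rewrite mulr1.
Qed.

Lemma is_derive_pow_gw k (x : R) :
  is_derive x 1 (fun y => - (y ^+ k * gw y)) ((x ^+ k.+1 - k%:R * x ^+ k.-1) * gw x).
Proof.
have -> : (fun y => - (y ^+ k * gw y)) =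
   - ((id ^+ k : R -> R) * ((Num.sqrt (2 * pi))^-1 \*: (expR \o ((- 2^-1) \*: (id ^+ 2 : R -> R))))) .
  apply/funext => y; rewrite /gw !fctE /=; congr (- (_ * (_ * expR _))).
  by rewrite /GRing.scale /=; field.
have Ee : - x ^+ 2 / 2 = - 2^-1 *: (x ^+ 2 : R) by rewrite /GRing.scale /=; field.
apply: is_derive_eq; rewrite /= !fctE /gw Ee.
set c := (Num.sqrt _)^-1; set e := expR _; by rewrite (exprS x k) /GRing.scale /= !expr1; field.
Qed.

(** The fundamental theorem on [[- n, n]], with dominated convergence as [n] grows. *)
Lemma integral_derive0 f F : mu.-integrable setT (EFin \o f) ->
  (forall x : R, is_derive x 1 F (f x)) -> continuous f ->
  F n%:R @[n --> \oo] --> (0 : R) -> F (- n%:R) @[n --> \oo] --> (0 : R) ->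
  \int[mu]_x f x = 0.
Proof.
move=> fi Fd fc F1 F2.
pose g n := (EFin \o f) \_ (`[- n%:R, n%:R] : set R).
have lim : (\int[mu]_x g n x)%E @[n --> \oo] --> (\int[mu]_x (f x)%:E)%E.
  apply: (@dominated_cvg _ _ _ mu _ measurableT g _ (fun x => `|f x|%:E)) => //.
  - move=> n; apply/(measurable_restrictT _ _).1 => //.
    apply: measurable_funS (measurable_int _ fi) => //.
  - move=> x _; apply: cvg_near_cst; near=> n; rewrite /g patchE mem_set //=.
    rewrite in_itv /= -ler_norml; near: n; exact: nbhs_infty_ger.
  - by have := integrable_abse fi; apply: eq_integrable.
  - move=> n x _; rewrite /g patchE; case: ifP => _; by rewrite /= ?abse0 ?lee_fin ?normr0 ?normr_ge0 ?lexx.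
have E n : (0 < n)%N -> (\int[mu]_x g n x)%E = (F n%:R - F (- n%:R))%:E.
  move=> n0; rewrite /g -integral_mkcond.
  have nn : - n%:R < n%:R :> R by rewrite gtrN // ltr0n.
  rewrite (@continuous_FTC2 R f F _ _ nn) //.
  - exact: continuous_subspaceT.
  - have Fc (x : R) : {for x, continuous F}.
      by apply/differentiable_continuous/derivable1_diffP; have [] := Fd x.
    split.
    + by move=> x _; have [] := Fd x.
    + by apply: cvg_at_right_filter; exact: Fc.
    + by apply: cvg_at_left_filter; exact: Fc.
  - by move=> x _; rewrite derive1E; exact: derive_val.
have fk : (\int[mu]_x (f x)%:E)%E = (\int[mu]_x f x)%:E.
  by rewrite /Rintegral fineK //; exact: integrable_fin_num.
rewrite fk in lim; have l1 : (fine \o (fun n => \int[mu]_x g n x)%E) n @[n --> \oo] --> \int[mu]_x f x.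
  exact: fine_cvg.
have F12 : F n%:R - F (- n%:R) @[n --> \oo] --> (0 : R).
  by rewrite -[X in _ --> X](subr0 0); exact: cvgB.
have l2 : (fine \o (fun n => \int[mu]_x g n x)%E) n @[n --> \oo] --> (0 : R).
  apply: cvg_trans F12; apply: near_eq_cvg; near=> n; rewrite /= E //.
  by near: n; exact: nbhs_infty_gt.
move/cvg_lim: l1 => <- //; exact: cvg_lim l2.
Unshelve. all: by end_near. Qed.

Lemma pow_gw_le k (x : R) : 1 <= x -> x ^+ k * gw x <= 2 ^+ k.+1 * (k.+1)`!%:R / x.
Proof.
move=> x1; have x0 : 0 < x by apply: lt_le_trans x1.
have y0 : 0 <= x ^+ 2 / 2 by rewrite divr_ge0 ?sqr_ge0.
have := expR_ge1Dxn k y0; rewrite exprMn exprVn -exprM => h.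
have F0 : (0 : R) < (k.+1)`!%:R by rewrite ltr0n fact_gt0.
have P2 : (0 : R) < 2 ^+ k.+1 by rewrite exprn_gt0.
have h2 : x ^+ (2 * k.+1) <= 2 ^+ k.+1 * (k.+1)`!%:R * expR (x ^+ 2 / 2).
  have : x ^+ (2 * k.+1) / 2 ^+ k.+1 / (k.+1)`!%:R <= expR (x ^+ 2 / 2) by lra.
  by rewrite ler_pdivrMr // ler_pdivrMr // mulrC mulrA mulrAC -mulrA.
rewrite ler_pdivlMr //.
have g1 : gw x <= expR (- x ^+ 2 / 2).
  rewrite /gw -[leRHS]mul1r; apply: ler_wpM2r; first exact: expR_ge0.
  have h1 : 1 <= Num.sqrt (2 * pi) :> R.
    by rewrite -[leLHS]sqrtr1 ler_wsqrtr //; have := pi_ge2 R; lra.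
  by rewrite invf_le1 // (lt_le_trans ltr01).
have -> : x ^+ k * gw x * x = x ^+ k.+1 * gw x by rewrite exprSr; ring.
apply: le_trans (_ : x ^+ (2 * k.+1) * expR (- x ^+ 2 / 2) <= _).
  by apply: ler_pM; rewrite ?exprn_ge0 ?gw_ge0 ?(ltW x0) // ler_weXn2l //; lia.
apply: le_trans (ler_wpM2r (expR_ge0 _) h2) _.
by rewrite -(mulrA (2 ^+ k.+1 * (k.+1)`!%:R)) -expRD mulNr addrN expR0 mulr1.
Qed.

(** Integration by parts, with [- (x ^+ k * gw x)] as primitive. For [k = 0] the truncated
    predecessor is multiplied by zero. *)
Lemma gE_ibp k : gE (fun x => x ^+ k.+1) = k%:R * gE (fun x => x ^+ k.-1).
Proof.
have I1 := gint_pow k.+1; have I2 := gintZ (- k%:R) (gint_pow k.-1).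
have := gED I1 I2; rewrite (gEZ _ (gint_pow k.-1)) => E.
suff : gE (fun x => x ^+ k.+1 + - k%:R * x ^+ k.-1) = 0 by rewrite E; lra.
have IT := gintD I1 I2.
pose C : R := 2 ^+ k.+1 * (k.+1)`!%:R.
have small (G : nat -> R) : (forall n, (0 < n)%N -> `|G n| <= n%:R ^+ k * gw n%:R) ->
    G n @[n --> \oo] --> (0 : R).
  move=> hG; apply/cvgrPdist_le => eps eps0; near=> n.
  have n0 : (0 < n)%N by near: n; exact: nbhs_infty_gt.
  rewrite sub0r normrN; apply: le_trans (hG n n0) _.
  apply: le_trans (pow_gw_le _ _) _; first by rewrite ler1n.
  rewrite ler_pdivrMr ?ltr0n // [leRHS]mulrC -ler_pdivrMr // -/C.
  by near: n; exact: nbhs_infty_ger.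
have cont : continuous (fun x : R => (x ^+ k.+1 + - k%:R * x ^+ k.-1) * gw x).
  move=> x; apply: cvgM; last exact: gw_cont.
  by apply: cvgD; [exact: exprn_continuous | apply: cvgMr; exact: exprn_continuous].
apply: (@integral_derive0 _ (fun y => - (y ^+ k * gw y))) => //.
- move=> x; rewrite mulNr; exact: is_derive_pow_gw.
- by apply: small => n n0; rewrite normrN ger0_norm // mulr_ge0 ?exprn_ge0 ?gw_ge0.
- apply: small => n n0; rewrite normrN normrM normrX normrN (ger0_norm (gw_ge0 _)).
  by rewrite [`|n%:R|]ger0_norm // /gw sqrrN lexx.
Unshelve. all: by end_near. Qed.

Lemma gE_pow k : gE (fun x => x ^+ k) = gauss_moment R k.
Proof.
elim/ltn_ind: k => -[_|[_|k IH]].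
- by rewrite -[RHS]gE1; apply: eq_Rintegral => x _; rewrite expr0.
- by rewrite gE_ibp mul0r.
- by rewrite gE_ibp /= IH // ltnW.
Qed.

(** Makes the Gaussian mean of the Taylor remainder [(t x) ^ (2 * m) / (2 * m)!] equal to
    [(t ^ 2 / 2) ^ m / m!], which tends to zero for every [t]. *)
Lemma gauss_moment_even m : gauss_moment R (2 * m) / (2 * m)`!%:R = (2 ^+ m * m`!%:R)^-1.
Proof.
elim: m => [|m IH]; first by rewrite /= fact0 divr1 expr0 mulr1 invr1.
rewrite (_ : (2 * m.+1)%N = (2 * m).+2); last by lia.
rewrite !factS [gauss_moment _ _]/= !natrM exprS.
have -> : (2 * m).+2%:R = 2 * m.+1%:R :> R by rewrite -natrM; congr (_%:R); lia.
have f0 j : (j`!%:R : R) != 0 by rewrite pnatr_eq0 -lt0n fact_gt0.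
have -> : (2 * m).+1%:R * gauss_moment R (2 * m) / (2 * m.+1%:R * ((2 * m).+1%:R * (2 * m)`!%:R))
   = (2 * m.+1%:R)^-1 * (gauss_moment R (2 * m) / (2 * m)`!%:R).
  have alg (a b c g : R) : a != 0 -> b != 0 -> c != 0 -> b * g / (2 * a * (b * c)) = (2 * a)^-1 * (g / c).
    by move=> a0 b0 c0; field; rewrite ?a0 ?b0 ?c0.
  by apply: alg; rewrite ?f0 ?pnatr_eq0.
by rewrite IH -invfM; congr (_^-1); ring.
Qed.

End Gaussian.

(** * From moments to the distribution *)

Section StepApproximation.
Variable R : realType.
Implicit Types (f g : R -> R) (x z t p a : R).

(** The phase [p] brings in the sines, so that the class is closed under products by the
    product-to-sum formula. *)
Inductive trigp : (R -> R) -> Prop :=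
| Trig_cos a t p : trigp (fun x => a * cos (t * x + p))
| Trig_add f g : trigp f -> trigp g -> trigp (fun x => f x + g x).

Lemma trigp_ext f g : f =1 g -> trigp f -> trigp g.
Proof. by move=> /funext ->. Qed.

Lemma trigp_cst a : trigp (fun=> a).
Proof. by apply: trigp_ext (Trig_cos a 0 0) => x; rewrite mul0r addr0 cos0 mulr1. Qed.

Lemma trigpM f g : trigp f -> trigp g -> trigp (fun x => f x * g x).
Proof.
move=> hf hg; elim: hf => [a t p|f1 f2 _ IH1 _ IH2]; last first.
  by apply: trigp_ext (Trig_add IH1 IH2) => x; rewrite mulrDl.
elim: hg => [b s q|g1 g2 _ IH1 _ IH2]; last first.
  by apply: trigp_ext (Trig_add IH1 IH2) => x; rewrite mulrDr.
have := Trig_add (Trig_cos (a * b / 2) (t + s) (p + q)) (Trig_cos (a * b / 2) (t - s) (p - q)).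
apply: trigp_ext => x.
have -> : (t + s) * x + (p + q) = (t * x + p) + (s * x + q) by ring.
have -> : (t - s) * x + (p - q) = (t * x + p) - (s * x + q) by ring.
by rewrite cosD cosB; field.
Qed.

Lemma trigpX f n : trigp f -> trigp (fun x => f x ^+ n).
Proof.
move=> hf; elim: n => [|n IH]; first exact: trigp_ext (trigp_cst 1).
by apply: trigp_ext (trigpM hf IH) => x; rewrite exprS.
Qed.

Lemma bernoulli_ge (a : R) n : -1 <= a -> 1 + n%:R * a <= (1 + a) ^+ n.
Proof.
move=> a1; elim: n => [|n IH]; first by rewrite mul0r addr0 expr0.
rewrite exprS; have h : (1 + a) * (1 + n%:R * a) <= (1 + a) * (1 + a) ^+ n by apply: ler_wpM2l => //; lra.
apply: le_trans h; rewrite -natr1.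
have -> : (1 + a) * (1 + n%:R * a) = 1 + (n%:R + 1) * a + n%:R * a ^+ 2 by ring.
by rewrite lerDl mulr_ge0 // sqr_ge0.
Qed.

Lemma onem_expn_le (a : R) n : 0 <= a <= 1 -> (1 - a) ^+ n * (1 + n%:R * a) <= 1.
Proof.
move=> /andP[a0 a1]; apply: le_trans (_ : (1 - a) ^+ n * (1 + a) ^+ n <= _).
  by apply: ler_wpM2l; [rewrite exprn_ge0 // subr_ge0 | apply: bernoulli_ge; lra].
rewrite -exprMn exprn_ile1 //; first by rewrite mulr_ge0 //; lra.
by rewrite -subr_sqr expr1n; have := sqr_ge0 a; lra.
Qed.

(* Brosowski--Deutsch polynomials: they converge to the indicator of [u < 1/2]
   on [0, 1]. *)
Definition stepfun n (u : R) : R := (1 - u ^+ n) ^+ (2 ^ n).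

Lemma stepfun_itv n u : 0 <= u <= 1 -> 0 <= stepfun n u <= 1.
Proof.
move=> /andP[u0 u1]; have h : 0 <= u ^+ n <= 1 by rewrite exprn_ge0 //= exprn_ile1.
by rewrite /stepfun exprn_ge0 ?exprn_ile1 //; lra.
Qed.

(** Bernoulli's inequality with exponent [2 ^ n] produces [2 ^ n * u ^ n = (2 * u) ^ n], which is
    why the transition sits at [u = 1 / 2]. *)
Lemma stepfun_ge n u : 0 <= u <= 1 -> 1 - (2 * u) ^+ n <= stepfun n u.
Proof.
move=> /andP[u0 u1]; have := @bernoulli_ge (- u ^+ n) (2 ^ n).
rewrite natrX mulrN -exprMn /stepfun; apply.
by rewrite lerN2 exprn_ile1.
Qed.

Lemma stepfun_le n u : 0 <= u <= 1 -> stepfun n u * (2 * u) ^+ n <= 1.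
Proof.
move=> /andP[u0 u1]; have h : 0 <= u ^+ n <= 1 by rewrite exprn_ge0 //= exprn_ile1.
have := @onem_expn_le (u ^+ n) (2 ^ n) h; rewrite natrX -exprMn.
apply: le_trans; apply: ler_wpM2l; last by rewrite lerDr.
by rewrite exprn_ge0 //; lra.
Qed.

(** Compose [stepfun] with [u x = (1 - sin (tau * (x - z))) / 2], which crosses [1 / 2] at [z]. A
    periodic function cannot follow the step on the whole line; beyond half a period the quadratic
    term makes both inequalities trivial. *)
Lemma step_approx (z d e : R) : 0 < d <= 1 -> 0 < e -> exists2 f, trigp f &
  forall x, (z + d <= x)%R%:R - e * (1 + (x - z) ^+ 2) <= f x /\
            f x <= (z - d <= x)%R%:R + e * (1 + (x - z) ^+ 2).
Proof.
move=> /andP[d0 d1] e0.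
(* [e * L ^+ 2 >= 1] covers [|x - z| >= L]; [tau] is chosen so that the sine is increasing on
   [|x - z| <= L]. *)
pose L := 1 + e^-1; have L1 : 1 <= L by rewrite lerDl invr_ge0 ltW.
have L0 : 0 < L by lra.
pose tau : R := pi / 2 / L; have pi0 := pi_gt0 R.
have tau0 : 0 < tau by rewrite !divr_gt0.
have tauL : tau * L = pi / 2 by rewrite /tau; field; rewrite gt_eqF.
pose dl := sin (tau * d).
have hi (y : R) : - L <= y <= L -> tau * y \in `[- (pi / 2), pi / 2].
  by rewrite in_itv /= -tauL -mulrN => /andP[h1 h2]; rewrite !ler_pM2l ?h1.
have dl0 : 0 < dl.
  apply: sin_gt0_pihalf; rewrite mulr_gt0 //= -tauL ltr_pM2l //.
  by apply: le_lt_trans d1 _; rewrite ltrDl invr_gt0.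
have sinmon (y1 y2 : R) : - L <= y1 -> y1 <= y2 -> y2 <= L -> sin (tau * y1) <= sin (tau * y2).
  move=> h1; rewrite le_eqVlt => /orP[/eqP -> //|h12] h2.
  by apply/ltW; rewrite ltr_sin ?ltr_pM2l // hi //; apply/andP; split; lra.
have [n hn1 hn2] : exists2 n, (1 - dl) ^+ n <= e & (1 + dl)^-1 ^+ n <= e.
  have dl1 : dl <= 1 by exact: sin_le1.
  have r1 : `|1 - dl| < 1 by rewrite ger0_norm; lra.
  have r2 : `|(1 + dl)^-1| < 1.
    by rewrite ger0_norm ?invr_ge0 ?invf_lt1; lra.
  have /cvgrPdist_le /(_ e e0) [n1 _ H1] := cvg_expr r1.
  have /cvgrPdist_le /(_ e e0) [n2 _ H2] := cvg_expr r2.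
  exists (maxn n1 n2).
    by have := H1 _ (leq_maxl n1 n2); rewrite /= sub0r normrN; apply: le_trans; exact: ler_norm.
  by have := H2 _ (leq_maxr n1 n2); rewrite /= sub0r normrN; apply: le_trans; exact: ler_norm.
pose u x := (1 - sin (tau * (x - z))) / 2.
have u01 x : 0 <= u x <= 1.
  by rewrite /u; have := sin_le1 (tau * (x - z)); have := sin_geN1 (tau * (x - z)); lra.
exists (fun x => stepfun n (u x)).
  have tu : trigp u.
    have := Trig_add (trigp_cst (2^-1)) (Trig_cos (- 2^-1) tau (- (tau * z) - pi / 2)).
    apply: trigp_ext => x; by rewrite addrA cosBpihalf -mulrBr /u; field.
  apply: trigpX; have := trigpM (trigp_cst (-1)) (trigpX n tu).
  move=> h; have := Trig_add (trigp_cst 1) h; apply: trigp_ext => x; by rewrite mulN1r.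
move=> x; have /andP[f0 f1] := stepfun_itv n (u01 x).
have q0 : 0 <= e * (x - z) ^+ 2 by rewrite mulr_ge0 ?sqr_ge0 // ltW.
have far : L <= `|x - z| -> 1 <= e * (x - z) ^+ 2.
  move=> h; have : L * L <= `|x - z| * `|x - z| by apply: ler_pM => //; lra.
  rewrite -expr2 -expr2 real_normK ?num_real // => h2.
  have : e * (L ^+ 2) <= e * (x - z) ^+ 2 by apply: ler_wpM2l => //; exact: ltW.
  apply: le_trans; rewrite /L.
  have -> : e * (1 + e^-1) ^+ 2 = e + 2 + e^-1 by field; rewrite gt_eqF.
  have : 0 < e^-1 by rewrite invr_gt0.
  lra.
rewrite mulrDr mulr1; split.
  case: (leP (z + d) x) => [zx|_]; rewrite ?mulr1n; last by rewrite sub0r; lra.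
  have [/far|xL] := leP L `|x - z|; first lra.
  have xz : x - z <= L by apply: le_trans (ler_norm _) (ltW xL).
  have s1 : dl <= sin (tau * (x - z)) by apply: sinmon => //; lra.
  have u2 : 0 <= 2 * u x <= 1 - dl by have := u01 x; rewrite /u; lra.
  have := stepfun_ge n (u01 x).
  have : (2 * u x) ^+ n <= (1 - dl) ^+ n by apply: lerXn2r; rewrite ?nnegrE; lra.
  rewrite /=; lra.
case: (leP (z - d) x) => [_|zx]; rewrite ?mulr1n ?mulr0n; first lra.
have [/far|xL] := leP L `|x - z|; first by rewrite /=; lra.
have xz : - L <= x - z by move: xL; rewrite ltr_norml => /andP[h _]; exact: ltW.
have s1 : sin (tau * (x - z)) <= - dl.
  by rewrite /dl -sinN -mulrN; apply: sinmon => //; lra.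
have u2 : 1 + dl <= 2 * u x by rewrite /u; lra.
have p0 : 0 < 1 + dl by lra.
have := stepfun_le n (u01 x).
have h : (1 + dl) ^+ n <= (2 * u x) ^+ n by apply: lerXn2r; rewrite ?nnegrE; lra.
have := ler_wpM2l f0 h => h1 h2.
have : stepfun n (u x) <= (1 + dl)^-1 ^+ n.
  by rewrite exprVn -[leRHS]mul1r ler_pdivlMr ?exprn_gt0 //; exact: le_trans h1 h2.
rewrite /=; lra.
Qed.

End StepApproximation.

(** * Convergence in distribution from approximants with Gaussian moments *)

Section MethodOfMoments.
Variables (R : realType) (W : R -> nat -> R).
Local Notation N := (@Num.truncn R).
Hypothesis approx : forall K, exists V : R -> nat -> R,
  (forall k, (k <= K)%N -> avg (N X) (fun n => V X n ^+ k) @[X --> +oo] --> gauss_moment R k) /\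
  (avg (N X) (fun n => (W X n - V X n) ^+ 2) @[X --> +oo] --> (0 : R)).

Lemma near_truncn_gt0 : \forall X \near (+oo : set_system R), (0 < N X)%N.
Proof.
near=> X; rewrite truncn_gt0; near: X; exact: nbhs_pinfty_ge.
Unshelve. all: by end_near. Qed.

Lemma poly_gE (c : nat -> R) K : gint (fun x => \sum_(k < K) c k * x ^+ k) /\
  gE (fun x => \sum_(k < K) c k * x ^+ k) = \sum_(k < K) c k * gauss_moment R k.
Proof.
elim: K => [|K [I E]].
  have -> : (fun x : R => \sum_(k < 0) c k * x ^+ k) = (fun x => 0 * 1).
    by apply/funext => x; rewrite big_ord0 mul0r.
  split; first exact: (gintZ 0 (gint1 R)).
  by rewrite (gEZ 0 (gint1 R)) mul0r big_ord0.
have -> : (fun x : R => \sum_(k < K.+1) c k * x ^+ k) = (fun x => \sum_(k < K) c k * x ^+ k + c K * x ^+ K).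
  by apply/funext => x; rewrite big_ord_recr.
have I2 := gintZ (c K) (gint_pow R K).
split; first exact: gintD.
by rewrite (gED I I2) E (gEZ _ (gint_pow R K)) gE_pow big_ord_recr.
Qed.

Lemma avg_poly (c : nat -> R) K M (v : nat -> R) :
  avg M (fun n => \sum_(k < K) c k * v n ^+ k) = \sum_(k < K) c k * avg M (fun n => v n ^+ k).
Proof.
elim: K => [|K IH]; first by rewrite big_ord0 /avg big1 ?mulr0 // => n _; rewrite big_ord0.
under eq_avg do rewrite big_ord_recr; rewrite avgD IH avgZ big_ord_recr //.
Qed.

(** The expansion stops at an even order so that the remainder bound is itself a monomial without
    absolute value, whose averages are controlled by a moment. *)
Lemma cos_sandwich m (t p x : R) :
  let c k := cos_coef p k * (t ^+ k / k`!%:R) in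
  let q := t ^+ (2 * m) / (2 * m)`!%:R in
  \sum_(k < 2 * m) c k * x ^+ k - q * x ^+ (2 * m) <= cos (t * x + p) /\
  cos (t * x + p) <= \sum_(k < 2 * m) c k * x ^+ k + q * x ^+ (2 * m).
Proof.
move=> c q; have := cos_taylor (2 * m) p (t * x); rewrite /cos_rem.
have -> : \sum_(k < 2 * m) cos_coef p k * ((t * x) ^+ k / k`!%:R) = \sum_(k < 2 * m) c k * x ^+ k.
  by apply: eq_bigr => k _; rewrite /c exprMn; ring.
have -> : `|t * x| ^+ (2 * m) / (2 * m)`!%:R = q * x ^+ (2 * m).
  by rewrite exprM real_normK ?num_real // -exprM exprMn /q; ring.
by rewrite ler_norml; lra.
Qed.

Lemma measurable_cos_affine (t p : R) : measurable_fun setT (fun x : R => cos (t * x + p)).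
Proof.
apply: continuous_measurable_fun => x.
apply: (@continuous_comp _ _ _ (fun y : R => t * y + p) cos); last exact: continuous_cos.
by apply: cvgD; [apply: cvgMr; exact: cvg_id | exact: cvg_cst].
Qed.

Lemma gint_cos (t p : R) : gint (fun x => cos (t * x + p)).
Proof.
apply: (@gint_bounded _ _ 1); first exact: measurable_cos_affine.
by move=> x; rewrite ler_norml cos_geN1 cos_le1.
Qed.

Lemma small_remainder (t e : R) : 0 < e -> exists m : nat,
  t ^+ (2 * m) / (2 * m)`!%:R * gauss_moment R (2 * m) <= e.
Proof.
move=> e0; have := @cvg_exp_coeff R (t ^+ 2 / 2) => /cvgrPdist_le /(_ e e0) [m _ /(_ m (leqnn m))].
rewrite /= sub0r normrN => h; exists m; apply: le_trans h; apply: le_trans (ler_norm _).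
have -> : t ^+ (2 * m) / (2 * m)`!%:R * gauss_moment R (2 * m)
  = t ^+ (2 * m) * (gauss_moment R (2 * m) / (2 * m)`!%:R) by ring.
rewrite gauss_moment_even exprM /exp_coeff /= expr_div_n.
by rewrite le_eqVlt; apply/orP; left; apply/eqP; rewrite invfM mulrA.
Qed.

(** First fix the Taylor order from the Gaussian mean of the remainder, then take the approximant
    for that many moments. The passage from [V] to [W] uses only that the cosine is Lipschitz and
    that the mean square of [W - V] tends to zero. *)
Lemma avg_cos_cvg (t p : R) :
  avg (N X) (fun n => cos (t * W X n + p)) @[X --> +oo] --> gE (fun x => cos (t * x + p)).
Proof.
apply/cvgrPdist_le => eps eps0; pose l := eps / 8; have l0 : 0 < l by rewrite divr_gt0.
have [m hm] := small_remainder t l0.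
have [V [VM VW]] := approx (2 * m).
pose c k := cos_coef p k * (t ^+ k / k`!%:R).
pose q : R := t ^+ (2 * m) / (2 * m)`!%:R.
have q0 : 0 <= q by rewrite divr_ge0 // exprM exprn_ge0 // sqr_ge0.
rewrite -/q in hm.
have [IP EP] := poly_gE c (2 * m).
have IQ := gintZ q (gint_pow R (2 * m)).
have EQ := gEZ q (gint_pow R (2 * m)); rewrite gE_pow in EQ.
have g1 : gE (fun x => cos (t * x + p)) <= \sum_(k < 2 * m) c k * gauss_moment R k + l.
  apply: le_trans (_ : gE (fun x => \sum_(k < 2 * m) c k * x ^+ k + q * x ^+ (2 * m)) <= _).
    by apply: gE_le; [exact: gint_cos | exact: gintD | move=> x; have [] := cos_sandwich m t p x].
  by rewrite (gED IP IQ) EP EQ lerD2l.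
have g2 : \sum_(k < 2 * m) c k * gauss_moment R k - l <= gE (fun x => cos (t * x + p)).
  have IQ' := gintZ (-1) IQ.
  apply: le_trans (_ : gE (fun x => \sum_(k < 2 * m) c k * x ^+ k + -1 * (q * x ^+ (2 * m))) <= _).
    by rewrite (gED IP IQ') EP (gEZ _ IQ) EQ mulN1r lerD2l lerN2.
  apply: gE_le; [exact: gintD | exact: gint_cos |].
  by move=> x; rewrite mulN1r; have [] := cos_sandwich m t p x.
have S : \sum_(k < 2 * m) c k * avg (N X) (fun n => V X n ^+ k) @[X --> +oo]
    --> \sum_(k < 2 * m) c k * gauss_moment R k.
  have : forall j, (j <= 2 * m)%N -> \sum_(k < j) c k * avg (N X) (fun n => V X n ^+ k) @[X --> +oo]
      --> \sum_(k < j) c k * gauss_moment R k.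
    elim=> [|j IH] jm.
      by under eq_fun do rewrite big_ord0; rewrite big_ord0; exact: cvg_cst.
    under eq_fun do rewrite big_ord_recr /=; rewrite big_ord_recr /=.
    by apply: cvgD; [exact: IH (ltnW jm) | apply: cvgMr; apply: VM; exact: ltnW].
  exact.
have Q := VM (2 * m)%N (leqnn _).
have Q2 : q * avg (N X) (fun n => V X n ^+ (2 * m)) @[X --> +oo] --> q * gauss_moment R (2 * m).
  exact: cvgMr.
have T : t ^+ 2 / l * avg (N X) (fun n => (W X n - V X n) ^+ 2) @[X --> +oo] --> (0 : R).
  by rewrite -[X in _ --> X](mulr0 (t ^+ 2 / l)); exact: cvgMr.
near=> X.
have N0 : (0 < N X)%N by near: X; exact: near_truncn_gt0.
have s1 : `|\sum_(k < 2 * m) c k * gauss_moment R k - \sum_(k < 2 * m) c k * avg (N X) (fun n => V X n ^+ k)| <= l.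
  by near: X; move/cvgrPdist_le: S; apply.
have s2 : `|q * gauss_moment R (2 * m) - q * avg (N X) (fun n => V X n ^+ (2 * m))| <= l.
  by near: X; move/cvgrPdist_le: Q2; apply.
have s3 : `|0 - t ^+ 2 / l * avg (N X) (fun n => (W X n - V X n) ^+ 2)| <= l.
  by near: X; move/cvgrPdist_le: T; apply.
set AW := avg (N X) (fun n => cos (t * W X n + p)).
pose AV := avg (N X) (fun n => cos (t * V X n + p)).
have v1 : AV <= \sum_(k < 2 * m) c k * avg (N X) (fun n => V X n ^+ k) + q * avg (N X) (fun n => V X n ^+ (2 * m)).
  rewrite -avg_poly -avgZ -avgD; apply: le_avg => n _; by have [] := cos_sandwich m t p (V X n).
have v2 : \sum_(k < 2 * m) c k * avg (N X) (fun n => V X n ^+ k) - q * avg (N X) (fun n => V X n ^+ (2 * m)) <= AV.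
  rewrite -mulNr -avg_poly -avgZ -avgD; apply: le_avg => n _; rewrite mulNr.
  by have [] := cos_sandwich m t p (V X n).
have pt n : `|cos (t * W X n + p) - cos (t * V X n + p)| <= l + t ^+ 2 / l * (W X n - V X n) ^+ 2.
  apply: le_trans (cos_lip _ _) _.
  have -> : t * W X n + p - (t * V X n + p) = t * (W X n - V X n) by ring.
  set w := W X n - V X n.
  have -> : t ^+ 2 / l * w ^+ 2 = `|t * w| ^+ 2 / l by rewrite real_normK ?num_real // exprMn; ring.
  set r := `|t * w|; have r0 : 0 <= r by exact: normr_ge0.
  have : 0 <= (r - l) ^+ 2 / l by rewrite divr_ge0 ?sqr_ge0 // ltW.
  have -> : (r - l) ^+ 2 / l = r ^+ 2 / l - 2 * r + l by field; rewrite gt_eqF.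
  lra.
have w1 : `|AW - AV| <= 2 * l.
  have h : avg (N X) (fun n => l + t ^+ 2 / l * (W X n - V X n) ^+ 2) <= 2 * l.
    rewrite avgD avg_cst // avgZ; move: s3; rewrite ler_norml; lra.
  rewrite ler_norml; apply/andP; split.
    rewrite lerNl opprB lerBlDl; apply: le_trans (_ : AW + avg (N X) (fun n => l + t ^+ 2 / l * (W X n - V X n) ^+ 2) <= _); last by rewrite lerD2l.
    by rewrite -avgD; apply: le_avg => n _; have := pt n; rewrite ler_norml; lra.
  rewrite lerBlDl; apply: le_trans (_ : AV + avg (N X) (fun n => l + t ^+ 2 / l * (W X n - V X n) ^+ 2) <= _); last by rewrite lerD2l.
  by rewrite -avgD; apply: le_avg => n _; have := pt n; rewrite ler_norml; lra.
have el : eps = 8 * l by rewrite /l; field.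
move: s1 s2 w1 g1 g2 v1 v2 hm; rewrite el !ler_norml; lra.
Unshelve. all: by end_near. Qed.

Definition good f := gint f /\
  (avg (N X) (fun n => f (W X n)) @[X --> +oo] --> gE f).

Lemma trig_good f : trigp f -> good f.
Proof.
elim=> [a t p|f1 f2 _ [I1 C1] _ [I2 C2]].
  split; first exact: gintZ (gint_cos t p).
  rewrite (gEZ a (gint_cos t p)); under eq_fun do rewrite avgZ.
  by apply: cvgMr; exact: avg_cos_cvg.
split; first exact: gintD.
by rewrite (gED I1 I2); under eq_fun do rewrite avgD; exact: cvgD.
Qed.

(** Bounds the quadratic error of [step_approx]. The constant 7 exceeds [1 + 2 / 4 + 4 * (5 / 4)],
    from mean squares of [W - V] and [V] near 0 and 1. *)
Lemma avg_sqr_bounded z : \forall X \near +oo,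
  avg (N X) (fun n => 1 + (W X n - z) ^+ 2) <= 7 + 4 * z ^+ 2.
Proof.
have [V [VM VW]] := approx 2.
have V2 := VM 2%N (leqnn _); rewrite /= mulr1 in V2.
near=> X.
have N0 : (0 < N X)%N by near: X; exact: near_truncn_gt0.
have s1 : `|1 - avg (N X) (fun n => V X n ^+ 2)| <= 1 / 4.
  by near: X; move/cvgrPdist_le: V2; apply; lra.
have s2 : `|0 - avg (N X) (fun n => (W X n - V X n) ^+ 2)| <= 1 / 4.
  by near: X; move/cvgrPdist_le: VW; apply; lra.
apply: le_trans (_ : avg (N X) (fun n => 1 + 4 * z ^+ 2 + 2 * (W X n - V X n) ^+ 2 + 4 * V X n ^+ 2) <= _).
  apply: le_avg => n _; set w := W X n; set v := V X n.
  have E : 1 + 4 * z ^+ 2 + 2 * (w - v) ^+ 2 + 4 * v ^+ 2 - (1 + (w - z) ^+ 2)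
     = ((w - v) - (v - z)) ^+ 2 + 2 * (v + z) ^+ 2 by ring.
  rewrite -subr_ge0 E; apply: addr_ge0; first exact: sqr_ge0.
  by apply: mulr_ge0 => //; exact: sqr_ge0.
rewrite !avgD avg_cst // avg_cst // !avgZ.
move: s1 s2; rewrite !ler_norml; lra.
Unshelve. all: by end_near. Qed.

Definition gtail (z : R) : R := gE (fun x => (z <= x)%R%:R).

Lemma measurable_tail (z : R) : measurable_fun setT (fun x : R => (z <= x)%R%:R : R).
Proof.
have -> : (fun x : R => (z <= x)%R%:R : R) = \1_(`[z, +oo[%classic : set R).
  by apply/funext => x; rewrite indicE; congr (_%:R); rewrite mem_setE in_itv /= andbT.
exact: measurable_indic.
Qed.

Lemma gint_tail (z : R) : gint (fun x => (z <= x)%R%:R).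
Proof.
apply: (@gint_bounded _ _ 1); first exact: measurable_tail.
by move=> x; case: (z <= x)%R; rewrite ?normr1 ?normr0.
Qed.

Lemma gtailE z : gtail z = \int[lebesgue_measure]_(x in `[z, +oo[) gw x.
Proof.
rewrite Rintegral_mkcond; apply: eq_Rintegral => x _; rewrite patchE mem_setE in_itv /= andbT.
by case: (z <= x)%R; rewrite ?mul1r ?mul0r.
Qed.

(** The normal density is at most 1, so the tail is Lipschitz in its threshold. *)
Lemma gtail_le a b : a <= b -> gtail a <= gtail b + (b - a).
Proof.
move=> ab.
pose f (x : R) : R := (a <= x)%R%:R + -1 * (b <= x)%R%:R.
have I2 := gintZ (-1) (gint_tail b).
have If : gint f by exact: gintD (gint_tail a) I2.
have Ef : gE f = gtail a - gtail b by rewrite (gED (gint_tail a) I2) (gEZ _ (gint_tail b)) mulN1r.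
have ab' : lebesgue_measure (`[a, b]%classic : set R) = (b - a)%:E.
  rewrite lebesgue_measure_itv /= lte_fin; case: ltP => // ba.
  have -> : b = a by apply/eqP; rewrite eq_le ab ba.
  by rewrite subrr.
suff : gE f <= b - a by rewrite Ef; lra.
have Ic : (@lebesgue_measure R).-integrable setT (EFin \o \1_(`[a, b]%classic : set R)).
  exact: integrable_indic_itv.
have -> : b - a = \int[lebesgue_measure]_x (\1_(`[a, b]%classic : set R) x).
  by rewrite -[LHS]/(fine (b - a)%:E) -ab' /Rintegral integral_indic // setIT.
apply: le_Rintegral => // x _; rewrite indicE mem_setE in_itv /= /f.
have g0 := gw_ge0 x; have g1 := gw_le1 x.
case: (leP a x) => ax; case: (leP b x) => bx /=; rewrite ?mulr0 ?mulr1 ?addr0 ?add0r ?mul0r ?mul1r ?subrr ?mul0r ?ler0n //.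
- by rewrite (ltW bx).
- by lra.
Qed.

(** Step approximations centred at [z - d] and [z + d] lie, up to the quadratic error, above and
    below the indicator of [z <= x], and within the indicators with thresholds [z - 2 * d] and
    [z + 2 * d]. *)
Theorem clt_of_moments z :
  avg (N X) (fun n => (z <= W X n)%R%:R) @[X --> +oo] --> gtail z.
Proof.
apply/cvgrPdist_le => eps eps0.
pose d := Num.min 1 (eps / 8).
have d01 : 0 < d <= 1 by rewrite lt_min ltr01 divr_gt0 // ge_min lexx.
have d8 : d <= eps / 8 by rewrite ge_min lexx orbT.
have /andP[d0 d1] := d01.
have C0 (y : R) : 0 < 7 + 4 * y ^+ 2 by have := sqr_ge0 y; lra.
pose C := (7 + 4 * (z - d) ^+ 2) + (7 + 4 * (z + d) ^+ 2).
have CC0 : 0 < C by rewrite addr_gt0.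
pose e := eps / (8 * C); have e0 : 0 < e by rewrite divr_gt0 // mulr_gt0.
have eC : e * C = eps / 8 by rewrite /e; field; rewrite gt_eqF.
have gq (y : R) : gint (fun x => 1 + (x - y) ^+ 2) /\ gE (fun x => 1 + (x - y) ^+ 2) <= 7 + 4 * y ^+ 2.
  have -> : (fun x : R => 1 + (x - y) ^+ 2) = (fun x => (1 + y ^+ 2) * 1 + (x ^+ 2 + (- 2 * y) * x ^+ 1)).
    by apply/funext => x; rewrite expr1; ring.
  have J1 := gintZ (1 + y ^+ 2) (gint1 R); have J2 := gint_pow R 2.
  have J3 := gintZ (- 2 * y) (gint_pow R 1); have J23 := gintD J2 J3.
  split; first exact: gintD.
  rewrite (gED J1 J23) (gED J2 J3) (gEZ _ (gint1 R)) (gEZ _ (gint_pow R 1)) gE1 !gE_pow /=.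
  by have := sqr_ge0 y; rewrite !mulr1 !mulr0; lra.
have Cy : e * (7 + 4 * (z - d) ^+ 2) <= eps / 8 /\ e * (7 + 4 * (z + d) ^+ 2) <= eps / 8.
  by rewrite -eC !(ler_pM2l e0) /C; have := C0 (z - d); have := C0 (z + d); lra.
have [Cm Cp] := Cy.
have [f1 T1 H1] := step_approx (z - d) d01 e0; have [G1 L1] := trig_good T1.
have [f2 T2 H2] := step_approx (z + d) d01 e0; have [G2 L2] := trig_good T2.
have [Q1 q1] := gq (z - d); have [Q2 q2] := gq (z + d).
have u1 : gE f1 <= gtail (z - d - d) + eps / 8.
  have J := gintZ e Q1.
  apply: le_trans (_ : gE (fun x => (z - d - d <= x)%R%:R + e * (1 + (x - (z - d)) ^+ 2)) <= _).
    by apply: gE_le => //; [exact: gintD (gint_tail _) J | move=> x; have [] := H1 x].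
  rewrite (gED (gint_tail _) J) (gEZ _ Q1) lerD2l; apply: le_trans Cm.
  by apply: ler_wpM2l => //; exact: ltW.
have u2 : gtail (z + d + d) - eps / 8 <= gE f2.
  have J := gintZ (-1) (gintZ e Q2).
  apply: le_trans (_ : gE (fun x => (z + d + d <= x)%R%:R + -1 * (e * (1 + (x - (z + d)) ^+ 2))) <= _); last first.
    by apply: gE_le => //; [exact: gintD (gint_tail _) J | move=> x; rewrite mulN1r; have [] := H2 x].
  rewrite (gED (gint_tail _) J) (gEZ _ (gintZ e Q2)) (gEZ _ Q2) mulN1r lerD2l lerN2; apply: le_trans Cp.
  by apply: ler_wpM2l => //; exact: ltW.
have t1 : gtail (z - d - d) <= gtail z + 2 * d.
  by apply: le_trans (gtail_le (_ : z - d - d <= z)) _; lra.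
have t2 : gtail z <= gtail (z + d + d) + 2 * d.
  by apply: le_trans (gtail_le (_ : z <= z + d + d)) _; lra.
near=> X.
have b1 : avg (N X) (fun n => 1 + (W X n - (z - d)) ^+ 2) <= 7 + 4 * (z - d) ^+ 2.
  by near: X; exact: avg_sqr_bounded.
have b2 : avg (N X) (fun n => 1 + (W X n - (z + d)) ^+ 2) <= 7 + 4 * (z + d) ^+ 2.
  by near: X; exact: avg_sqr_bounded.
have c1 : `|gE f1 - avg (N X) (fun n => f1 (W X n))| <= eps / 8.
  by near: X; move/cvgrPdist_le: L1; apply; rewrite divr_gt0.
have c2 : `|gE f2 - avg (N X) (fun n => f2 (W X n))| <= eps / 8.
  by near: X; move/cvgrPdist_le: L2; apply; rewrite divr_gt0.
have v1 : avg (N X) (fun n => (z <= W X n)%R%:R)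
   <= avg (N X) (fun n => f1 (W X n)) + e * avg (N X) (fun n => 1 + (W X n - (z - d)) ^+ 2).
  rewrite -avgZ -avgD; apply: le_avg => n _; have [] := H1 (W X n).
  by rewrite subrK lerBlDr.
have v2 : avg (N X) (fun n => f2 (W X n))
   <= avg (N X) (fun n => (z <= W X n)%R%:R) + e * avg (N X) (fun n => 1 + (W X n - (z + d)) ^+ 2).
  rewrite -avgZ -avgD; apply: le_avg => n _; have [_] := H2 (W X n).
  by rewrite addrK.
have w1 := le_trans (ler_wpM2l (ltW e0) b1) Cm.
have w2 := le_trans (ler_wpM2l (ltW e0) b2) Cp.
move: c1 c2; rewrite !ler_norml; lra.
Unshelve. all: by end_near. Qed.

End MethodOfMoments.

(** * Averages up to X *)

Section SlowGrowth.
Variables (R : realType) (H : R -> R).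
Hypothesis hH : H X @[X --> +oo] --> +oo.
Hypothesis hHX : ln (H X) / ln X @[X --> +oo] --> (0 : R).
Local Notation N := (@Num.truncn R).
Let h (X : R) : nat := N (H X).

Lemma near_H_ge (A : R) : \forall X \near +oo, A <= H X.
Proof. by move/cvgryPge: hH => /(_ A). Qed.

Lemma h_cvg : h X @[X --> +oo] --> \oo.
Proof.
apply/cvgnyPge => A; near=> X.
rewrite truncn_ge_nat; near: X; exact: near_H_ge.
Unshelve. all: by end_near. Qed.

(** [log H = o(log X)] bounds [H] by any fixed positive power of [X] eventually. With
    [dl * b = 1 / 2] every quantity of order [h ^ b] is at most a constant times [X ^ (1 / 2)]. *)
Lemma pbound_small (u : nat -> R) e : pbound u e ->
  u (h X) / (N X)%:R @[X --> +oo] --> (0 : R).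
Proof.
move=> [C C0 HC]; pose b := (Num.truncn e).+1.
have eb : e <= b%:R by exact/ltW/truncnS_gt.
pose dl : R := (2 * b%:R)^-1; have b0 : (0 : R) < b%:R by rewrite ltr0n.
have dl0 : 0 < dl by rewrite invr_gt0 mulr_gt0.
have dlb : dl * b%:R = 2^-1 by rewrite /dl; field; rewrite gt_eqF.
apply/cvgrPdist_le => eps eps0.
have e12 : (2^-1 : R) < 1 by rewrite invf_lt1 ?ltr1n.
have [x0 x01 Hx0] := @powR_dom R (2 * C / eps) _ _ e12.
near=> X.
have X0 : x0 <= X by near: X; apply: nbhs_pinfty_ge; exact: num_real.
have X2 : 2 <= X by near: X; exact: nbhs_pinfty_ge.
have H1 : 1 <= H X by near: X; exact: near_H_ge.
have rat : `|0 - ln (H X) / ln X| <= dl.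
  by near: X; move/cvgrPdist_le: hHX; apply.
have Xp : 0 < X by lra.
have lX : 0 < ln X by rewrite ln_gt0 //; lra.
have Hp : 0 < H X by lra.
have HX : H X <= X `^ dl.
  rewrite -ler_ln ?posrE ?powR_gt0 // ln_powR -ler_pdivrMr //.
  by apply: le_trans rat; rewrite sub0r normrN; exact: ler_norm.
have h1 : (1 <= h X)%N by rewrite truncn_gt0.
have hX : ((h X)%:R : R) <= H X by have /andP[] := truncn_itv (ltW Hp).
have /andP[u0 uC] := HC (h X) h1.
have uX : u (h X) <= C * X `^ (2^-1).
  apply: le_trans uC _; apply: ler_wpM2l; first exact: ltW.
  apply: le_trans (_ : (h X)%:R `^ b%:R <= _).
    by apply: ler_powR => //; rewrite ler1n.
  rewrite -dlb powRrM; apply: ge0_ler_powR; rewrite ?nnegrE ?powR_ge0 //.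
  exact: le_trans hX HX.
have NX : X / 2 <= (N X)%:R.
  have /andP[_] := truncn_itv (ltW Xp); rewrite -natr1 => t2; lra.
have N0 : (0 : R) < (N X)%:R by apply: lt_le_trans NX; rewrite divr_gt0.
rewrite sub0r normrN ger0_norm; last by rewrite divr_ge0.
rewrite ler_pdivrMr //; apply: le_trans uX _.
apply: le_trans (_ : eps * (X / 2) <= _); last by apply: ler_wpM2l => //; exact: ltW.
have := Hx0 X X0; rewrite powRr1 ?(ltW Xp) // => hh.
have -> : C * X `^ 2^-1 = eps / 2 * (2 * C / eps * X `^ 2^-1) by field; rewrite gt_eqF.
have -> : eps * (X / 2) = eps / 2 * X by field.
by apply: ler_wpM2l => //; rewrite divr_ge0 // ltW.
Unshelve. all: by end_near. Qed.

Lemma truncn_ratio_cvg : (N X)%:R / X @[X --> +oo] --> (1 : R).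
Proof.
apply/cvgrPdist_le => eps eps0; near=> X.
have X1 : 1 <= X by near: X; exact: nbhs_pinfty_ge.
have Xe : eps^-1 <= X by near: X; apply: nbhs_pinfty_ge; exact: num_real.
have Xp : 0 < X by lra.
have /andP[t1 t2] := truncn_itv (ltW Xp); rewrite -natr1 in t2.
have -> : 1 - (N X)%:R / X = (X - (N X)%:R) / X by field; rewrite gt_eqF.
rewrite ger0_norm; last by rewrite divr_ge0 ?subr_ge0 // ltW.
rewrite ler_pdivrMr //; apply: le_trans (_ : 1 <= _); first lra.
by rewrite mulrC -ler_pdivrMr // mul1r.
Unshelve. all: by end_near. Qed.

End SlowGrowth.

(** * From averages over a period to averages over n up to X *)

Section Transfer.
Variables (R : realType) (B : set nat) (alpha : R) (H : R -> R).
Hypothesis hB : sieving_set R B.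
Hypothesis halpha : 0 < alpha < 1.
Hypothesis hindex : has_index (semigroup_gen B) alpha.
Hypothesis hH : H X @[X --> +oo] --> +oo.
Hypothesis hHX : ln (H X) / ln X @[X --> +oo] --> (0 : R).
Local Notation N := (@Num.truncn R).
Local Notation fB := (@fB R B).
Local Notation momB := (@momB R B).
Let h (X : R) : nat := N (H X).

Section FixedParameters.
Variables (beta : R) (y : nat -> nat).
Hypothesis hb : alpha < beta < 1.
Hypothesis y0 : forall j, (0 < y j)%N.
Hypothesis yb : pbound (fun j => (y j)%:R : R) 2.
Let m2 (X : R) : R := momB (y (h X)) (h X) 2.
Let T (X : R) : R := 1 + (h X)%:R * (y (h X))%:R `^ (beta - 1).
Hypothesis m2_ge1 : \forall X \near +oo, 1 <= m2 X.
Hypothesis T_cvg : T X / m2 X @[X --> +oo] --> (0 : R).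

Lemma C2B_ratio_cvg : C2B B (H X) / m2 X @[X --> +oo] --> (1 : R).
Proof.
have [C C0 HC] := C2B_compare hB halpha hindex hb.
apply/cvgrPdist_le => eps eps0.
pose l := Num.min 1 (eps / 4).
have l0 : 0 < l by rewrite lt_min ltr01 divr_gt0.
have l1 : l <= 1 by rewrite ge_min lexx.
have l2 : l <= eps / 4 by rewrite ge_min lexx orbT.
pose A := (1 + l^-1) * C.
have A0 : 0 < A by rewrite mulr_gt0 // addr_gt0 // invr_gt0.
near=> X.
have m1 : 1 <= m2 X by near: X; exact: m2_ge1.
have m0 : 0 < m2 X by lra.
have H0 : 0 <= H X by near: X; exact: near_H_ge.
have t1 : `|0 - T X / m2 X| <= l / A by near: X; move/cvgrPdist_le: T_cvg; apply; rewrite divr_gt0.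
have t2 : A * (T X / m2 X) <= l.
  rewrite mulrC -ler_pdivlMr //; apply: le_trans t1; rewrite sub0r normrN; exact: ler_norm.
have [c1 c2] := HC (H X) (y (h X)) l H0 (y0 _) l0.
set c := C2B B (H X) in c1 c2 *.
have {}c1 : c <= (1 + l) * m2 X + A * T X by rewrite /A -(mulrA _ C).
have {}c2 : m2 X <= (1 + l) * c + A * T X by rewrite /A -(mulrA _ C).
have d1 : c / m2 X <= 1 + l + A * (T X / m2 X).
  rewrite ler_pdivrMr //.
  by have -> : (1 + l + A * (T X / m2 X)) * m2 X = (1 + l) * m2 X + A * T X by field; rewrite gt_eqF.
have d2 : 1 <= (1 + l) * (c / m2 X) + A * (T X / m2 X).
  rewrite -(ler_pM2r m0) mul1r.
  by have -> : ((1 + l) * (c / m2 X) + A * (T X / m2 X)) * m2 X = (1 + l) * c + A * T X by field; rewrite gt_eqF.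
set r := c / m2 X in d1 d2 *; set tt := A * _ in d1 d2 t2.
rewrite distrC ler_norml; apply/andP; split; last lra.
have r3 : r <= 3 by lra.
have : l * r <= l * 3 by apply: ler_wpM2l => //; exact: ltW.
rewrite mulrDl mul1r in d2; lra.
Unshelve. all: by end_near. Qed.

Lemma avg_diff_cvg :
  avg (N X) (fun n => (dev B (H X) n - fB (y (h X)) (h X) n) ^+ 2) / m2 X @[X --> +oo] --> (0 : R).
Proof.
have [C C0 HC] := avg_dev_fB hB halpha hindex hb.
have /andP[_ b1] := hb.
(* [Y >= (h ^ 2 + 1) ^ g] gives [(h ^ 2 + 1) * Y ^ (beta - 1) <= 1], as [avg_dev_fB] requires. [Y]
   stays polynomial in [h], so [Y ^ 6 + h] is eventually smaller than [X]. *)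
pose g := (1 - beta)^-1; have g0 : 0 < g by rewrite invr_gt0 subr_gt0.
pose Y j := maxn (y j) (Num.truncn ((j%:R ^+ 2 + 1 : R) `^ g)).+1.
have pid : pbound (fun j => j%:R : R) 1.
  by exists 1 => // j j0; rewrite ler0n mul1r powRr1 // lexx.
have p1 : pbound (fun j => j%:R ^+ 2 + 1 : R) 2.
  apply: pboundD; last by apply: pboundW (pbound_cst ler01).
  by have := pboundX 2 pid; rewrite mulr1.
have p2 := pbound_powR (ltW g0) p1.
pose a : R := 2 + 2 * g.
have p3 : pbound (fun j => (Y j)%:R : R) a.
  apply: pbound_le (_ : pbound (fun j => (y j)%:R + ((j%:R ^+ 2 + 1 : R) `^ g + 1)) a).
    move=> j _; rewrite ler0n /= /Y; set G := _ `^ g.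
    have /andP[t1 _] := truncn_itv (powR_ge0 _ _ : 0 <= G).
    have yj : (0 : R) <= (y j)%:R by [].
    rewrite /maxn; case: ifP => _; last by have := powR_ge0 (j%:R ^+ 2 + 1 : R) g; rewrite -/G; lra.
    by rewrite -natr1; lra.
  apply: pboundD; first by apply: pboundW yb; rewrite /a; lra.
  apply: pboundD; first by apply: pboundW p2; rewrite /a; lra.
  by apply: pboundW (pbound_cst ler01); rewrite /a; lra.
have p4 : pbound (fun j => (Y j ^ 6 + j)%N%:R : R) (6 * a + 1).
  apply: pbound_le (_ : pbound (fun j => (Y j)%:R ^+ 6 + j%:R) _).
    by move=> j _; rewrite ler0n /= natrD natrX lexx.
  apply: pboundD; first by apply: pboundW (pboundX 6 p3); lra.
  by apply: pboundW pid; rewrite /a; lra.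
have small := pbound_small hH hHX p4.
apply/cvgrPdist_le => eps eps0; near=> X.
have m1 : 1 <= m2 X by near: X; exact: m2_ge1.
have m0 : 0 < m2 X by lra.
have H0 : 0 <= H X by near: X; exact: near_H_ge.
have N0 : (0 < N X)%N by near: X; exact: near_truncn_gt0.
have s1 : `|(0 : R) - (Y (h X) ^ 6 + h X)%N%:R / (N X)%:R| <= 1 / 2.
  by near: X; move/cvgrPdist_le: small; apply.
have t1 : `|0 - T X / m2 X| <= eps / C by near: X; move/cvgrPdist_le: T_cvg; apply; rewrite divr_gt0.
have N0r : (0 : R) < (N X)%:R by rewrite ltr0n.
have YN : (Y (h X) ^ 6 + h X < N X)%N.
  rewrite -(ltr_nat R); move: s1; rewrite sub0r normrN ger0_norm ?divr_ge0 //.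
  by rewrite ler_pdivrMr //; lra.
have Yb : ((h X)%:R ^+ 2 + 1) * (Y (h X))%:R `^ (beta - 1) <= 1 :> R.
  set u : R := (h X)%:R ^+ 2 + 1.
  have u0 : 0 < u by apply: ltr_wpDl => //; exact: sqr_ge0.
  have Yg : u `^ g <= (Y (h X))%:R.
    apply: le_trans (_ : (Num.truncn (u `^ g)).+1%:R <= _); first exact/ltW/truncnS_gt.
    by rewrite ler_nat leq_maxr.
  have : (Y (h X))%:R `^ (beta - 1) <= (u `^ g) `^ (beta - 1).
    by apply: ler_powRn => //; [rewrite powR_gt0 | lra].
  have -> : (u `^ g) `^ (beta - 1) = u^-1.
    rewrite -powRrM -[RHS]powR_inv1 ?(ltW u0) //; congr (_ `^ _).
    by rewrite /g; field; lra.
  by move=> hh; rewrite -ler_pdivlMl // mulr1.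
have := HC (H X) (y (h X)) H0 (y0 _) (Y (h X)) (N X) (leq_maxl _ _) Yb YN.
rewrite -/(h X) -/(T X); set D := avg _ _ => hD.
have D0 : 0 <= D by apply: avg_ge0 => n; exact: sqr_ge0.
rewrite sub0r normrN ger0_norm; last by rewrite divr_ge0 // ltW.
apply: le_trans (_ : C * (T X / m2 X) <= _).
  by rewrite mulrA; apply: ler_wpM2r => //; rewrite invr_ge0 ltW.
rewrite mulrC -ler_pdivlMr //; apply: le_trans t1; rewrite sub0r normrN; exact: ler_norm.
Unshelve. all: by end_near. Qed.

Lemma avg_fB_cvg k (g : R) : momB (y (h X)) (h X) k / Num.sqrt (m2 X) ^+ k @[X --> +oo] --> g ->
  avg (N X) (fun n => (fB (y (h X)) (h X) n / Num.sqrt (m2 X)) ^+ k) @[X --> +oo] --> g.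
Proof.
move=> cg.
have p1 : pbound (fun j => (2 * (y j)%:R ^+ 3) ^+ k : R) (k%:R * (0 + 3 * 2)).
  apply: pboundX; apply: pboundM; [exact: pbound_cst | exact: pboundX yb].
have small := pbound_small hH hHX p1.
have dz : avg (N X) (fun n => (fB (y (h X)) (h X) n / Num.sqrt (m2 X)) ^+ k)
   - momB (y (h X)) (h X) k / Num.sqrt (m2 X) ^+ k @[X --> +oo] --> (0 : R).
  apply/cvgrPdist_le => eps eps0; near=> X.
  have m1 : 1 <= m2 X by near: X; exact: m2_ge1.
  have N0 : (0 < N X)%N by near: X; exact: near_truncn_gt0.
  have s1 : `|0 - (2 * (y (h X))%:R ^+ 3) ^+ k / (N X)%:R| <= eps.
    by near: X; move/cvgrPdist_le: small; apply.
  set s := Num.sqrt (m2 X).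
  (* As the variance is at least 1, normalizing does not enlarge the transfer error. *)
  have sk : 1 <= s ^+ k by rewrite exprn_ege1 // -[leLHS]sqrtr1 ler_wsqrtr.
  have sk0 : 0 < s ^+ k by apply: lt_le_trans sk.
  have -> : avg (N X) (fun n => (fB (y (h X)) (h X) n / s) ^+ k)
     = (s ^+ k)^-1 * avg (N X) (fun n => fB (y (h X)) (h X) n ^+ k).
    by rewrite -avgZ; apply: eq_avg => n; rewrite expr_div_n mulrC.
  rewrite sub0r normrN [_ / s ^+ k]mulrC -mulrBr normrM.
  have := @fB_transfer R B hB (y (h X)) (h X) k (N X) N0 => ft.
  apply: le_trans (_ : `|avg (N X) (fun n => fB (y (h X)) (h X) n ^+ k) - momB (y (h X)) (h X) k| <= _).
    by rewrite ler_piMl // ger0_norm ?invr_ge0 ?(ltW sk0) // invf_le1.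
  apply: le_trans ft _; apply: le_trans s1; rewrite sub0r normrN mulrC; exact: ler_norm.
rewrite -[g]add0r; apply: cvg_trans; last exact: (cvgD dz cg).
by apply: near_eq_cvg; near=> X; rewrite fctE subrK.
Unshelve. all: by end_near. Qed.

Hypothesis m2_cvg : momB (y (h X)) (h X) 2 / Num.sqrt (m2 X) ^+ 2 @[X --> +oo] --> (1 : R).

Lemma avg_normalized_diff_cvg :
  avg (N X) (fun n => (dev B (H X) n / Num.sqrt (C2B B (H X))
    - fB (y (h X)) (h X) n / Num.sqrt (m2 X)) ^+ 2) @[X --> +oo] --> (0 : R).
Proof.
(* The ratio of the two normalizations: with [s] and [sg] the square roots of [m2] and [C2B], the
   difference is [rho * (dev - fB) / s + (rho - 1) * fB / s], where [rho] tends to 1. *)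
pose rho X := (Num.sqrt (C2B B (H X) / m2 X))^-1.
have rho1 : rho X @[X --> +oo] --> (1 : R).
  rewrite -[X in _ --> X]invr1; apply: cvgV; first exact: oner_neq0.
  rewrite -[X in _ --> X]sqrtr1.
  apply: (@cvg_comp _ _ _ _ (@Num.sqrt R) _ _ _ C2B_ratio_cvg); exact: sqrt_continuous.
have A2 := avg_fB_cvg m2_cvg.
have A3 := avg_diff_cvg.
pose D X := avg (N X) (fun n => (dev B (H X) n - fB (y (h X)) (h X) n) ^+ 2) / m2 X.
pose F X := avg (N X) (fun n => (fB (y (h X)) (h X) n / Num.sqrt (m2 X)) ^+ 2).
have up : 2 * (rho X ^+ 2 * D X) + 2 * ((rho X - 1) ^+ 2 * F X) @[X --> +oo] --> (0 : R).
  have -> : (0 : R) = 2 * (1 ^+ 2 * 0) + 2 * ((1 - 1) ^+ 2 * 1) by rewrite subrr expr0n /= !(mulr0, mul0r) addr0.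
  apply: cvgD; apply: cvgMr; apply: cvgM => //.
    by apply: (@cvg_comp _ _ _ _ (fun x : R => x ^+ 2) _ _ _ rho1); exact: exprn_continuous.
  apply: (@cvg_comp _ _ _ _ (fun x : R => (x - 1) ^+ 2) _ _ _ rho1).
  apply: (@cvg_comp _ _ _ (fun x : R => x - 1) (fun x : R => x ^+ 2) _ _ _ _); last exact: exprn_continuous.
  by apply: cvgB; [exact: cvg_id | exact: cvg_cst].
apply: (squeeze_cvgr _ (cvg_cst 0) up); near=> X.
have m1 : 1 <= m2 X by near: X; exact: m2_ge1.
have m0 : 0 < m2 X by lra.
have r1 : `|1 - C2B B (H X) / m2 X| <= 1 / 2 by near: X; move/cvgrPdist_le: C2B_ratio_cvg; apply.
have c0 : 0 < C2B B (H X).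
  have : 0 < C2B B (H X) / m2 X by move: r1; rewrite ler_norml; lra.
  by rewrite pmulr_lgt0 // invr_gt0.
apply/andP; split; first by apply: avg_ge0 => n; exact: sqr_ge0.
rewrite /D /F; set s := Num.sqrt (m2 X); set sg := Num.sqrt (C2B B (H X)).
have s0 : 0 < s by rewrite sqrtr_gt0.
have sg0 : 0 < sg by rewrite sqrtr_gt0.
have rE : rho X = s / sg.
  by rewrite /rho sqrtrM ?(ltW c0) // sqrtrV ?(ltW m0) // -/s -/sg invf_div.
have mE : m2 X = s ^+ 2 by rewrite sqr_sqrtr // ltW.
rewrite [X in _ <= X](_ : _ = avg (N X) (fun n =>
  2 * (rho X ^+ 2 / m2 X * (dev B (H X) n - fB (y (h X)) (h X) n) ^+ 2)
  + 2 * ((rho X - 1) ^+ 2 * (fB (y (h X)) (h X) n / s) ^+ 2))); last first.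
  by rewrite avgD !avgZ; congr (2 * _ + _); ring.
apply: le_avg => n _; rewrite mE rE; set dv := dev B (H X) n; set f := fB _ _ n.
have -> : dv / sg - f / s = s / sg * ((dv - f) / s) + (s / sg - 1) * (f / s).
  by field; rewrite !gt_eqF.
have -> : (s / sg) ^+ 2 / s ^+ 2 * (dv - f) ^+ 2 = (s / sg * ((dv - f) / s)) ^+ 2.
  by field; rewrite !gt_eqF.
rewrite -exprMn; set p := s / sg * _; set q := (s / sg - 1) * _.
have := sqr_ge0 (p - q); have -> : (p - q) ^+ 2 = p ^+ 2 + q ^+ 2 - 2 * p * q by ring.
have -> : (p + q) ^+ 2 = p ^+ 2 + q ^+ 2 + 2 * p * q by ring.
lra.
Unshelve. all: by end_near. Qed.

End FixedParameters.

Lemma dev_moment_approx K : exists V : R -> nat -> R,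
  (forall k, (k <= K)%N -> avg (N X) (fun n => V X n ^+ k) @[X --> +oo] --> gauss_moment R k) /\
  (avg (N X) (fun n => (dev B (H X) n / Num.sqrt (C2B B (H X)) - V X n) ^+ 2) @[X --> +oo] --> (0 : R)).
Proof.
(* Order 2 is always included, since comparing the normalizations needs the second moment even when
   [K < 2]. *)
have [beta [y [hb y0 yb Tc [m2c mc]]]] := momB_gauss hB halpha hindex (maxn K 2).
have hc := h_cvg hH.
pose m2 X := momB (y (h X)) (h X) 2.
have m2_ge1 : \forall X \near +oo, 1 <= m2 X.
  have [j0 Hj] := m2c; near=> X; apply: Hj; near: X.
  by move/cvgnyPge: hc; apply.
have T_cvg : (1 + (h X)%:R * (y (h X))%:R `^ (beta - 1)) / m2 X @[X --> +oo] --> (0 : R).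
  exact: (@cvg_comp _ _ _ h (fun j => (1 + j%:R * (y j)%:R `^ (beta - 1)) / momB (y j) j 2) _ _ _ hc Tc).
have mcX k : (k <= maxn K 2)%N -> momB (y (h X)) (h X) k / Num.sqrt (m2 X) ^+ k @[X --> +oo] --> gauss_moment R k.
  move=> kK.
  exact: (@cvg_comp _ _ _ h (fun j => momB (y j) j k / Num.sqrt (momB (y j) j 2) ^+ k) _ _ _ hc (mc k kK)).
exists (fun X n => fB (y (h X)) (h X) n / Num.sqrt (m2 X)); split.
  move=> k kK; apply: (avg_fB_cvg yb m2_ge1).
  exact: mcX (leq_trans kK (leq_maxl _ _)).
apply: (avg_normalized_diff_cvg hb y0 yb m2_ge1 T_cvg).
have := mcX 2%N (leq_maxr _ _); by rewrite /= mulr1.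
Unshelve. all: by end_near. Qed.

End Transfer.

Theorem theorem1p11 (R : realType) (B : set nat) (alpha : R) (H : R -> R)
  (hB : sieving_set R B)
  (halpha : 0 < alpha < 1)
  (hindex : has_index (semigroup_gen B) alpha)
  (hH : H X @[X --> +oo] --> +oo)
  (hHX : ln (H X) / ln X @[X --> +oo] --> (0 : R))
  (z : R) :
  X^-1 * (count_upto
            [set n : nat |
               z <= ((NBfree B n (H X))%:R - MB R B * H X)
                      / Num.sqrt (C2B B (H X))] X)%:R
    @[X --> +oo] -->
  (Num.sqrt (2 * pi))^-1
    * \int[lebesgue_measure]_(t in `[z, +oo[) expR (- t ^+ 2 / 2).
Proof.
pose c : R := (Num.sqrt (2 * pi))^-1.
have c0 : 0 < c by rewrite invr_gt0 sqrtr_gt0 mulr_gt0 // pi_gt0.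
have -> : c * \int[lebesgue_measure]_(t in `[z, +oo[) expR (- t ^+ 2 / 2) = gtail z.
  rewrite gtailE -RintegralZl //.
  apply: (@integrableS _ _ _ _ setT) => //.
  have := integrableZl measurableT c^-1 (gint1 R); apply: eq_integrable => // t _.
  rewrite /= -EFinM mul1r /gw -/c mulKf // gt_eqF //.
have clt := @clt_of_moments R _ (dev_moment_approx hB halpha hindex hH hHX) z.
rewrite -[gtail z]mul1r.
(* The statement divides by [X], [avg] by the integer part of [X]; their ratio tends to 1. *)
apply: cvg_trans; last exact: (cvgM (@truncn_ratio_cvg R) clt).
apply: near_eq_cvg; near=> X.
have N0 : (0 < Num.truncn X)%N by near: X; exact: near_truncn_gt0.
have X0 : 0 < X by near: X; exact: nbhs_pinfty_gt.
rewrite /= /avg /count_upto natr_sum [in RHS]big_mkcond /=.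
have -> : \sum_(1 <= n < (Num.truncn X).+1) ((z <= dev B (H X) n / Num.sqrt (C2B B (H X)))%R%:R : R)
  = \sum_(1 <= n < (Num.truncn X).+1) (if n \in [set n : nat | z <= ((NBfree B n (H X))%:R - MB R B * H X)
                      / Num.sqrt (C2B B (H X))] then 1%:R else 0).
  apply: eq_bigr => n _; case: ifPn; first by rewrite inE /dev /= => ->.
  by rewrite notin_setE /dev /= => /negP/negbTE ->.
set S := \sum_(1 <= n < _) _; by field; rewrite (gt_eqF X0) pnatr_eq0 -lt0n N0.
Unshelve. all: by end_near. Qed.
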